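(* Let $V(x,y)=q(x,y)=\sum_{j\ne0}q_j(x)e^{2\pi i\lambda_jy}$ satisfy Hypotheses (V') with $q_{\rm av}\equiv0$; let $q_\epsilon(x)=q(x,x/\epsilon)$ and $\sigma^\epsilon_{\rm eff}(x)=-\frac{\epsilon^2}{4\pi^2}\sum_{j\ne0}\frac{|q_j(x)|^2}{\lambda_j^2}$. Then $$\sup_{k\in\mathbb{R}}\left|t^{\sigma^\epsilon_{\rm eff}}(k)-t^{q_\epsilon}(k)\right|=\mathcal{O}(\epsilon),\qquad\epsilon\to0^+.$$
   Context: Function spaces: $|g|_{\mathcal{L}^1_\gamma}=\int_{\mathbb{R}}|g(x)|(1+|x|)^\gamma\,dx$, $|g|_{\mathcal{W}^{n,1}_\gamma}=\sum_{l=0}^n|\partial_x^lg|_{\mathcal{L}^1_\gamma}$. Hypotheses (V') (with $q_{\rm av}\equiv0$): $V(x,y)=\sum_{j\in\mathbb{Z}\setminus\{0\}}q_j(x)e^{2\pi i\lambda_jy}$ is real-valued, $\overline{q_j}=q_{-j}$, $\lambda_{-j}=-\lambda_j$; there is $\theta>0$ with $\inf_{j\ne k}|\lambda_j-\lambda_k|\ge\theta$ and $\inf_{j\ne0}|\lambda_j|\ge\theta$ ($\lambda_j$ real); and $\sum_{j\ne0}|q_j|_{\mathcal{W}^{3,1}_3}<\infty$. Jost solutions and transmission coefficient: for real-valued $U\in\mathcal{L}^1_2$ and $k\in\mathbb{R}$, $f^U_\pm(x;k)$ are the unique solutions of $(-\partial_x^2+U-k^2)u=0$ with $f^U_\pm(x;k)\sim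 e^{\pm ikx}$ as $x\to\pm\infty$ (equivalently, of the Volterra equations $f^U_+(x;k)=e^{ikx}+\int_x^\infty\frac{\sin(k(y-x))}{k}U(y)f^U_+(y;k)\,dy$, $f^U_-(x;k)=e^{-ikx}-\int_{-\infty}^x\frac{\sin(k(y-x))}{k}U(y)f^U_-(y;k)\,dy$, with $\sin(kz)/k=z$ at $k=0$). With $\mathcal{W}[h_1,h_2]=h_1h_2'-h_2h_1'$, $t^U$ is defined by $\mathcal{W}[f^U_+,f^U_-](k)=-2ik/t^U(k)$ (by continuity at $k=0$). *)

(* Defs.v *)
From mathcomp Require Import all_boot all_order all_algebra.
From mathcomp Require Import all_classical all_reals all_analysis.
From mathcomp Require Import complex.

Set Implicit Arguments.
Unset Strict Implicit.
Unset Printing Implicit Defensive.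

Import Order.TTheory GRing.Theory Num.Theory.
Import numFieldNormedType.Exports.
Local Open Scope classical_set_scope.
Local Open Scope ring_scope.

Section ComplexValuedFunctions.
Variable R : realType.

Definition Cexpi (t : R) : R[i] := (cos t +i* sin t)%C.

(* The library has no derivative of functions from R to R[i]. *)
Definition Cderive (u : R -> R[i]) (x : R) : R[i] :=
  (derive1 (fun y => complex.Re (u y)) x +i*
   derive1 (fun y => complex.Im (u y)) x)%C.

(* Sums over Z \ {0}, as limits of the symmetric partial sums over
   0 < |j| <= N; all series below converge absolutely at almost every point. *)
Definition zsum (a : int -> R) : R :=
  limn (fun N : nat => \sum_(0 <= j < N) (a j.+1%:Z + a (- j.+1%:Z))).

Definition Czsum (a : int -> R[i]) : R[i] :=
  (zsum (fun j => complex.Re (a j)) +i* zsum (fun j => complex.Im (a j)))%C.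

End ComplexValuedFunctions.

Section SobolevSpaces.
Variable R : realType.
Local Notation mu := (@lebesgue_measure R).

Definition test_function (phi : R -> R) : Prop :=
  (forall n x, derivable (derive1n n phi) x 1) /\
  (exists M : R, forall x, M < `|x| -> phi x = 0).

Definition is_weak_derivative_real (l : nat) (g h : R -> R) : Prop :=
  [/\ locally_integrable setT g, locally_integrable setT h &
   forall phi, test_function phi ->
     \int[mu]_x (g x * derive1n l phi x) = (-1) ^+ l * \int[mu]_x (h x * phi x)].

Definition is_weak_derivative (l : nat) (g h : R -> R[i]) : Prop :=
  is_weak_derivative_real l (fun x => complex.Re (g x))
                            (fun x => complex.Re (h x)) /\
  is_weak_derivative_real l (fun x => complex.Im (g x))
                            (fun x => complex.Im (h x)).

(* A chosen representative; it is unique up to a null set.  It is the zero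
   function if there is none, hence the first clause of sobolev below. *)
Definition weak_derivative (l : nat) (g : R -> R[i]) : R -> R[i] :=
  xget (fun=> 0) [set h | is_weak_derivative l g h].

Definition L1_norm (gamma : nat) (g : R -> R[i]) : \bar R :=
  (\int[mu]_x (Normc.normc (g x) * (1 + `|x|) ^+ gamma)%:E)%E.

Definition sobolev_norm (n gamma : nat) (g : R -> R[i]) : \bar R :=
  (\sum_(l < n.+1) L1_norm gamma (weak_derivative l g))%E.

Definition sobolev (n gamma : nat) (g : R -> R[i]) : Prop :=
  (forall l : nat, (l <= n)%N -> exists h, is_weak_derivative l g h) /\
  (sobolev_norm n gamma g < +oo)%E.

End SobolevSpaces.

Section Scattering.
Variable R : realType.
Local Notation mu := (@lebesgue_measure R).

(* u is C^1, u' is absolutely continuous and u'' = (U - k^2) u a.e.; this is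
   what a solution means for a merely integrable potential U. *)
Definition schrodinger_solution_real (U : R -> R) (k : R) (v : R -> R) : Prop :=
  (forall x, derivable v x 1) /\
  (forall a b : R, a <= b ->
     mu.-integrable `[a, b] (fun x => ((U x - k ^+ 2) * v x)%:E) /\
     derive1 v b - derive1 v a = \int[mu]_(x in `[a, b]) ((U x - k ^+ 2) * v x)).

(* U and k being real, the equation splits into real and imaginary parts. *)
Definition schrodinger_solution (U : R -> R) (k : R) (u : R -> R[i]) : Prop :=
  schrodinger_solution_real U k (fun x => complex.Re (u x)) /\
  schrodinger_solution_real U k (fun x => complex.Im (u x)).

(* R[i]^o is R[i] with its topology. *)
Definition is_jost_plus (U : R -> R) (k : R) (f : R -> R[i]) : Prop :=
  schrodinger_solution U k f /\
  ((f x / Cexpi (k * x) : R[i]^o) @[x --> +oo] --> (1 : R[i]^o)).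

Definition is_jost_minus (U : R -> R) (k : R) (f : R -> R[i]) : Prop :=
  schrodinger_solution U k f /\
  ((f x / Cexpi (- (k * x)) : R[i]^o) @[x --> -oo] --> (1 : R[i]^o)).

(* A Jost solution exists and is unique as soon as U is in L^1_2. *)
Definition jost_plus (U : R -> R) (k : R) : R -> R[i] :=
  xget (fun=> 0) [set f | is_jost_plus U k f].

Definition jost_minus (U : R -> R) (k : R) : R -> R[i] :=
  xget (fun=> 0) [set f | is_jost_minus U k f].

Definition wronskian (h1 h2 : R -> R[i]) (x : R) : R[i] :=
  h1 x * Cderive h2 x - h2 x * Cderive h1 x.

(* The Wronskian of two solutions is constant in x: it is evaluated at 0.
   For k != 0 it does not vanish, and this is t(k). *)
Definition transmission_formula (U : R -> R) (k : R) : R[i]^o :=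
  (0 -i* (2 * k))%C / wronskian (jost_plus U k) (jost_minus U k) 0.

Definition transmission (U : R -> R) (k : R) : R[i] :=
  if k == 0 then lim (transmission_formula U h @[h --> 0^'])
  else transmission_formula U k.

End Scattering.

Section Potentials.
Variable R : realType.
Variables (q : int -> R -> R[i]) (lambda : int -> R).

(* Each q j is an arbitrary representative of its a.e.-class.  The values of
   q and lambda at the index 0 are irrelevant throughout. *)
Definition potential (x y : R) : R[i] :=
  Czsum (fun j => q j x * Cexpi (2 * pi * lambda j * y)).

Record hypotheses_V' : Prop := HypothesesV' {
  V_real : forall x y, complex.Im (potential x y) = 0 ;
  V_conj : forall (j : int) x, j != 0 -> q (- j) x = (q j x)^*%C ;
  V_freq_opp : forall j : int, j != 0 -> lambda (- j) = - lambda j ;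
  V_freq_gap : exists2 theta : R, 0 < theta &
    (forall j k : int, j != 0 -> k != 0 -> j != k ->
       theta <= `|lambda j - lambda k|) /\
    (forall j : int, j != 0 -> theta <= `|lambda j|) ;
  V_sobolev : forall j : int, j != 0 -> sobolev 3 3 (q j) ;
  V_summable :
    (\esum_(j in [set j : int | j != 0%R]) sobolev_norm 3 3 (q j) < +oo)%E }.

(* The real part only turns the real number q(x, x / eps) into an element
   of R; see V_real. *)
Definition q_osc (eps x : R) : R := complex.Re (potential x (x / eps)).

Definition sigma_eff (eps x : R) : R :=
  - (eps ^+ 2 / (4 * pi ^+ 2)) *
  zsum (fun j => Normc.normc (q j x) ^+ 2 / lambda j ^+ 2).

End Potentials.

(* Main.v *)
(** For any A with A' = U - E, the quasi-derivative w = u' - A u turns the equation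
    u'' = (U - k^2) u into a first order system which involves U only through A and
    A^2 - E, and variation of constants gives the Wronskian
      -2ik - int (A^2 - E) + O(d^3 + d |k|),
    where A = O(d) and E = O(d^2) in weighted norms.  For U = q_eps, three
    integrations by parts of each term of the series give A = O(eps) and
    E = O(eps^3); all frequencies om_i + om_j, and om_i - om_j for i != j, being of
    order 1/eps, only the diagonal terms of A^2 contribute to
      int A^2 = m eps^2 + O(eps^3), where - m eps^2 = int sigma_eff.
    The choice A = 0, E = sigma_eff gives the same expansion for U = sigma_eff.  If
    m > 0 then both transmission coefficients are within O(eps) of the one of a
    point interaction, namely 2ik / (2ik + m eps^2), uniformly in k; if m = 0 then
    all q_j vanish almost everywhere. *)

Require Import Defs.
From mathcomp Require Import all_boot all_order all_algebra.
From mathcomp Require Import all_classical all_reals all_analysis.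
From mathcomp Require Import measurable_realfun complex ring lra.

Set Implicit Arguments.
Unset Strict Implicit.
Unset Printing Implicit Defensive.

Import Order.TTheory GRing.Theory Num.Theory.
Import numFieldNormedType.Exports.
Local Open Scope classical_set_scope.
Local Open Scope ring_scope.

(** The delicate region is [k] near 0: when [m > 0], both coefficients rise from 0 at [k = 0] to
    nearly 1 across a window of width of order [eps^2], so the Wronskian must be known up to
    [O(eps (|k| + eps^2))]. This dictates the error [d^3 + d |k|], and the use of [cos(kx)] and
    [sin(kx)/k], which do not degenerate as [k] tends to 0; the price is growth like [|x|], paid by
    the weight [(1 + |x|)^2]. It also dictates the number of integrations by parts: the integral of
    [E] competes with [m eps^2] and must be [O(eps^3)]. In the integral of [A^2], the off-diagonal
    products are not smaller than the diagonal ones in norm; they become small only after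
    integration. Everything is evaluated at [x = 0]: each half line serves one Jost solution, the
    left one by reflection, and the terms with [A 0], which are merely [O(eps)], cancel in the
    Wronskian. Since each [q j] is an arbitrary representative of its class, potentials are handled
    up to null sets, and derivatives through absolutely continuous functions with a given almost
    everywhere derivative. *)

Section RealLine.
Variable R : realType.
Local Notation mu := (@lebesgue_measure R).
Local Notation L1 D f := (mu.-integrable D (EFin \o f)).
Local Notation mR := (measurableTypeR R).
Local Notation mfun f := (measurable_fun (setT : set mR) f).
Implicit Types (D E : set mR) (f g h F G phi psi : R -> R) (a b c x y : R).

(** * Integrable and absolutely continuous functions *)

Lemma L1_measurable D f : L1 D f -> measurable_fun D f.
Proof. by move=> /measurable_int/measurable_EFinP. Qed.

Lemma L1_subset D E f : measurable D -> measurable E -> D `<=` E ->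
  L1 E f -> L1 D f.
Proof. by move=> mD mE DE; exact: integrableS. Qed.

Lemma L1_dominated D f g : measurable D -> measurable_fun D f -> L1 D g ->
  (forall x, D x -> `|f x| <= g x) -> L1 D f.
Proof.
move=> mD mf ig fg; apply: (le_integrable mD _ _ ig) => //.
  exact/measurable_EFinP.
by move=> x Dx /=; rewrite lee_fin (le_trans (fg _ Dx))// ler_norm.
Qed.

Lemma L1D D f g : measurable D -> L1 D f -> L1 D g ->
  L1 D (fun x => f x + g x).
Proof. by move=> mD jf jg; exact: (integrableD mD jf jg). Qed.

Lemma L1B D f g : measurable D -> L1 D f -> L1 D g ->
  L1 D (fun x => f x - g x).
Proof. by move=> mD jf jg; exact: (integrableB mD jf jg). Qed.

Lemma L1Z D f c : measurable D -> L1 D f -> L1 D (fun x => c * f x).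
Proof. by move=> mD jf; exact: (integrableZl mD c jf). Qed.

Lemma L1_norm_fun D f : measurable D -> L1 D f -> L1 D (fun x => `|f x|).
Proof. by move=> mD; exact: integrable_norm. Qed.

Lemma L1_eq D f g : (forall x, D x -> f x = g x) -> measurable D ->
  L1 D f -> L1 D g.
Proof.
move=> fg mD; apply: eq_integrable => // x; rewrite inE => Dx /=.
by rewrite fg.
Qed.

Lemma L1N D f : measurable D -> L1 D f -> L1 D (fun x => - f x).
Proof.
move=> mD jf; apply: L1_eq (L1Z (-1) mD jf) => // x _.
by rewrite mulN1r.
Qed.

Lemma L1_sum D (I : Type) (s : seq I) (F : I -> R -> R) : measurable D ->
  (forall i, L1 D (F i)) -> L1 D (fun x => \sum_(i <- s) F i x).
Proof.
move=> mD jF; have := integrable_sum mD s (P := xpredT) (fun i _ => jF i).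
by apply: eq_integrable => // x _ /=; rewrite sumEFin.
Qed.

Lemma Rintegral_sum D (I : Type) (s : seq I) (F : I -> R -> R) : measurable D ->
  (forall i, L1 D (F i)) ->
  \int[mu]_(x in D) (\sum_(i <- s) F i x) = \sum_(i <- s) \int[mu]_(x in D) F i x.
Proof.
move=> mD jF; elim: s => [|i s IH].
  under eq_Rintegral do rewrite big_nil.
  by rewrite Rintegral_cst // mul0r big_nil.
rewrite big_cons -IH -RintegralD //; last exact: L1_sum.
by under eq_Rintegral do rewrite big_cons.
Qed.

Lemma norm_Rintegral_le D f g : measurable D -> measurable_fun D f -> L1 D g ->
  (forall x, D x -> `|f x| <= g x) ->
  `|\int[mu]_(x in D) f x| <= \int[mu]_(x in D) g x.
Proof.
move=> mD mf jg fg; have jf := L1_dominated mD mf jg fg.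
apply: (le_trans (le_normr_Rintegral mD jf)).
by apply: le_Rintegral => //; exact: L1_norm_fun.
Qed.

Lemma Rintegral_subset D E g : measurable D -> measurable E -> D `<=` E ->
  L1 E g -> (forall x, E x -> 0 <= g x) ->
  \int[mu]_(x in D) g x <= \int[mu]_(x in E) g x.
Proof.
move=> mD mE DE jg g0; rewrite /Rintegral fine_le //.
- by apply: integrable_fin_num => //; exact: L1_subset jg.
- exact: integrable_fin_num.
- apply: ge0_subset_integral => //.
  exact: measurable_int jg.
Qed.

Lemma norm_Rintegral_sub D E f g : measurable D -> measurable E -> D `<=` E ->
  measurable_fun D f -> L1 E g -> (forall x, E x -> 0 <= g x) ->
  (forall x, D x -> `|f x| <= g x) ->
  `|\int[mu]_(x in D) f x| <= \int[mu]_(x in E) g x.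
Proof.
move=> mD mE DE mf jg g0 fg.
apply: le_trans (Rintegral_subset mD mE DE jg g0).
by apply: norm_Rintegral_le => //; exact: L1_subset jg.
Qed.

Lemma ae_eq_L1 D f g : measurable D -> {ae mu, forall x, D x -> f x = g x} ->
  measurable_fun D g -> L1 D f -> L1 D g.
Proof.
move=> mD fg mg jf; have mf := L1_measurable jf.
apply/integrableP; split; first exact/measurable_EFinP.
have /integrableP[_] := jf; apply: le_lt_trans.
rewrite le_eqVlt; apply/orP; left; apply/eqP.
apply: ae_eq_integral => //.
- by apply/measurable_EFinP; exact: measurableT_comp.
- by apply/measurable_EFinP; exact: measurableT_comp.
- apply: (@filterS _ _ (ae_filter_ringOfSetsType mu) _ _ _ fg).
  by move=> x /= fgx /fgx ->.
Qed.

Lemma ae_eq_Rintegral D f g : measurable D ->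
  {ae mu, forall x, D x -> f x = g x} ->
  measurable_fun D f -> measurable_fun D g ->
  \int[mu]_(x in D) f x = \int[mu]_(x in D) g x.
Proof.
move=> mD fg mf mg; congr fine; apply: ae_eq_integral => //.
- exact/measurable_EFinP.
- exact/measurable_EFinP.
- apply: (@filterS _ _ (ae_filter_ringOfSetsType mu) _ _ _ fg).
  by move=> x /= fgx /fgx ->.
Qed.

Lemma Rintegral_itv_split f a b c : a <= b -> b <= c ->
  L1 `[a, c] f ->
  \int[mu]_(x in `[a, c]) f x =
  \int[mu]_(x in `[a, b]) f x + \int[mu]_(x in `[b, c]) f x.
Proof.
move=> ab bc jf.
have := Rintegral_itvB (f := f) (a := BLeft a) (b := BRight c) (x := b) jf.
rewrite !bnd_simp => /(_ ab bc) H.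
rewrite -[LHS](subrK (\int[mu]_(x in `[a, b]) f x)) H addrC; congr (_ + _).
rewrite Rintegral_itv_obnd_cbnd //; apply: L1_subset jf => //.
by apply: subset_itv; rewrite bnd_simp.
Qed.

Lemma Rintegral_ray_split f a b : a <= b -> L1 `[a, +oo[ f ->
  \int[mu]_(x in `[a, +oo[) f x =
  \int[mu]_(x in `[a, b]) f x + \int[mu]_(x in `[b, +oo[) f x.
Proof.
move=> ab jf.
have := Rintegral_itvB (f := f) (a := BLeft a) (b := +oo%O) (x := b) jf.
rewrite !bnd_simp => /(_ ab isT) H.
rewrite -[LHS](subrK (\int[mu]_(x in `[a, b]) f x)) H addrC; congr (_ + _).
rewrite Rintegral_itv_obnd_cbnd //; apply: L1_subset jf => //.
by apply: subset_itv; rewrite bnd_simp.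
Qed.

(* F is locally absolutely continuous with a.e. derivative f. *)
Definition ac F f := forall a b, a <= b ->
  L1 `[a, b] f /\ F b - F a = \int[mu]_(x in `[a, b]) f x.

Lemma ac_L1 F f a b : ac F f -> L1 `[a, b] f.
Proof.
move=> acF; have [ab|ba] := leP a b; first by have [] := acF _ _ ab.
by rewrite set_itv_ge -?leNgt ?bnd_simp //; exact: integrable_set0.
Qed.

Lemma measurable_fun_itvs f :
  (forall a b, a <= b -> measurable_fun (`[a, b] : set mR) f) -> mfun f.
Proof.
move=> mf.
have -> : [set: R] = \bigcup_(n : nat) `[- n%:R, n%:R]%classic.
  apply/seteqP; split=> // x _.
  have [n xn] : exists n : nat, `|x| <= n%:R.
    exists (Num.trunc `|x|).+1; apply: ltW; exact: truncnS_gt.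
  by exists n => //=; rewrite in_itv /=; rewrite ler_norml in xn.
apply/measurable_fun_bigcup => n //; apply: mf.
by rewrite (@le_trans _ _ 0)// oppr_le0.
Qed.

Lemma locL1_measurable f :
  (forall a b, a <= b -> L1 `[a, b] f) -> mfun f.
Proof. by move=> jf; apply: measurable_fun_itvs => a b /jf/L1_measurable. Qed.

Lemma ac_measurable_deriv F f : ac F f -> mfun f.
Proof. by move=> acF; apply: locL1_measurable => a b /acF[]. Qed.

Lemma ac_primitive f : (forall a b, a <= b -> L1 `[a, b] f) ->
  exists F, ac F f.
Proof.
move=> jf.
pose F x := if 0 <= x then \int[mu]_(t in `[0, x]) f t
            else - \int[mu]_(t in `[x, 0]) f t.
exists F => a b ab; split; first exact: jf.
rewrite /F; have [a0|a0] := leP 0 a; have [b0|b0] := leP 0 b.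
- rewrite (@Rintegral_itv_split _ 0 a b) //; last exact: jf.
  by rewrite addrC addKr.
- by have := le_lt_trans (le_trans a0 ab) b0; rewrite ltxx.
- rewrite (@Rintegral_itv_split _ a 0 b) //; [|exact: ltW|].
    by rewrite opprK addrC.
  by apply: jf.
- rewrite (@Rintegral_itv_split _ a b 0) //; [|exact: ltW|].
    by rewrite opprK addrC addrK.
  by apply: jf; apply: ltW.
Qed.

Lemma ac_cst c : ac (fun=> c) (fun=> 0).
Proof.
move=> a b ab; split.
  apply: (@measurable_bounded_integrable _ _ _ mu) => //.
  - by rewrite /= lebesgue_measure_itv /=; case: ifP => // _; rewrite -EFinB ltry.
  - by exists 0; split => // x x0 y _ /=; rewrite normr0 ltW.
by rewrite subrr Rintegral_cst // mul0r.
Qed.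

Lemma acD F f G g : ac F f -> ac G g ->
  ac (fun x => F x + G x) (fun x => f x + g x).
Proof.
move=> acF acG a b ab; have [jf Ff] := acF _ _ ab; have [jg Gg] := acG _ _ ab.
split; first exact: L1D.
by rewrite RintegralD // -Ff -Gg; ring.
Qed.

Lemma acZ c F f : ac F f -> ac (fun x => c * F x) (fun x => c * f x).
Proof.
move=> acF a b ab; have [jf Ff] := acF _ _ ab.
split; first exact: L1Z.
by rewrite RintegralZl // -Ff; ring.
Qed.

Lemma acB F f G g : ac F f -> ac G g ->
  ac (fun x => F x - G x) (fun x => f x - g x).
Proof.
move=> acF acG a b ab; have [jf Ff] := acF _ _ ab; have [jg Gg] := acG _ _ ab.
split; first exact: L1B.
by rewrite RintegralB // -Ff -Gg; ring.
Qed.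

Lemma ac_eq F f G g : ac F f -> F =1 G -> f =1 g -> ac G g.
Proof. by move=> acF /funext <- /funext <-. Qed.

Lemma ac_ae F f g : ac F f -> mfun g -> {ae mu, forall x, f x = g x} -> ac F g.
Proof.
move=> acF mg fg a b ab; have [jf Ff] := acF _ _ ab.
have fg' : {ae mu, forall x, `[a, b]%classic x -> f x = g x}.
  by apply: (@filterS _ _ (ae_filter_ringOfSetsType mu) _ _ _ fg) => x /= -> .
have mg' : measurable_fun (`[a, b] : set mR) g by exact: measurable_funTS.
split; first exact: ae_eq_L1 jf.
by rewrite Ff; apply: ae_eq_Rintegral => //; exact: L1_measurable jf.
Qed.

Lemma ac_within_continuous F f a b : a <= b -> ac F f ->
  {within `[a, b], continuous F}.
Proof.
move=> ab acF.
have [jf _] := acF _ _ ab.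
have := parameterized_integral_continuous ab jf.
set P := fun x => parameterized_integral _ _ _ _ => cP.
have cP' : {within `[a, b], continuous (fun x => F a + P x)}.
  by move=> x; apply: cvgD; [exact: cvg_cst|exact: cP].
apply: subspace_eq_continuous cP' => x; rewrite inE /= in_itv /= => /andP[ax xb].
rewrite /from_subspace /P /parameterized_integral.
by have [_ <-] := acF _ _ ax; rewrite subrKC.
Qed.

Lemma ac_continuous F f : ac F f -> continuous F.
Proof.
move=> acF x.
have xx : x - 1 < x + 1 by lra.
have := ac_within_continuous (ltW xx) acF.
move=> /(continuous_within_itvP _ xx)[+ _ _]; apply.
by rewrite in_itv /=; lra.
Qed.

Lemma ac_measurable F f : ac F f -> mfun F.
Proof. by move=> /ac_continuous/continuous_measurable_fun. Qed.

Lemma continuous_L1_itv f a b : continuous f -> L1 `[a, b] f.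
Proof.
move=> cf; apply: continuous_compact_integrable; first exact: segment_compact.
by apply: continuous_subspaceT.
Qed.

Lemma continuous_bounded_itv g a b : continuous g ->
  exists M, forall x, a <= x <= b -> `|g x| <= M.
Proof.
move=> cg; have [ab|ba] := leP a b; last first.
  by exists 0 => x /andP[ax xb]; have := le_lt_trans (le_trans ax xb) ba; rewrite ltxx.
have cng : {within `[a, b], continuous (fun x => `|g x|)}.
  by apply: continuous_subspaceT => x; apply: cvg_norm; exact: cg.
have [c _ cM] := EVT_max ab cng.
by exists `|g c| => x axb; apply: cM; rewrite in_itv.
Qed.

Lemma L1_itv_continuousM f g a b : L1 `[a, b] f -> continuous g ->
  L1 `[a, b] (fun x => g x * f x).
Proof.
move=> jf cg; have [M gM] := continuous_bounded_itv a b cg.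
have M0 x : a <= x <= b -> 0 <= M by move=> /gM; exact: le_trans.
apply: (L1_dominated (g := fun x => M * `|f x|)) => //.
- apply: measurable_funM; last exact: L1_measurable jf.
  by apply: measurable_funTS; exact: continuous_measurable_fun.
- by apply: L1Z => //; exact: L1_norm_fun.
- by move=> x /=; rewrite in_itv /= => axb; rewrite normrM ler_wpM2r // gM.
Qed.

(* The increment of H is at most the square of that of K; bisecting the range
   of K halves this bound. *)
Lemma increment_sq_eq0 (H K : R -> R) :
  continuous K -> {homo K : x y / x <= y} ->
  (forall x y, x <= y -> `|H y - H x| <= (K y - K x) ^+ 2) ->
  forall x y, x <= y -> H y = H x.
Proof.
move=> cK mK HK.
have step n : forall x y, x <= y -> `|H y - H x| <= (K y - K x) ^+ 2 / 2 ^+ n.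
  elim: n => [|n IH] x y xy; first by rewrite expr0 divr1 HK.
  have Kxy := mK _ _ xy.
  have [||z] := @IVT R K x y ((K x + K y) / 2) xy.
  - exact: continuous_subspaceT.
  - by rewrite min_l // max_r //; apply/andP; split; lra.
  rewrite in_itv /= => /andP[xz zy] Kz.
  have H1 := IH _ _ xz; have H2 := IH _ _ zy.
  have -> : H y - H x = (H y - H z) + (H z - H x) by ring.
  apply: (le_trans (ler_normD _ _)).
  apply: (le_trans (lerD H2 H1)).
  rewrite le_eqVlt; apply/orP; left; apply/eqP.
  have p0 : (2 : R) ^+ n != 0 by rewrite expf_neq0.
  by rewrite Kz [2 ^+ n.+1]exprS; move: (2 ^+ n) p0 => p p0; field.
move=> x y xy; apply/eqP; rewrite -subr_eq0 -normr_le0.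
apply/ler_addgt0Pl => e e0; rewrite addr0.
set c := (K y - K x) ^+ 2 in step *.
have c0 : 0 <= c by exact: sqr_ge0.
have [n ne] : exists n : nat, c / e <= n%:R.
  by exists (Num.trunc (c / e)).+1; apply: ltW; exact: truncnS_gt.
apply: (le_trans (step n x y xy)); rewrite -/c.
rewrite ler_pdivrMr ?exprn_gt0 // mulrC.
rewrite -ler_pdivrMr //; apply: (le_trans ne).
by rewrite -natrX ler_nat ltnW // ltn_expl.
Qed.

(** Let [P] be a primitive of [f G + F g] and [H = F G - P]. The increment of [H] on [[x, y]] is the
    integral of [f t (G y - G t) + g t (F x - F t)], hence at most the square of the increment of a
    primitive [K] of [|f| + |g|], and [increment_sq_eq0] makes [H] constant. *)
Lemma acM F f G g : ac F f -> ac G g ->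
  ac (fun x => F x * G x) (fun x => f x * G x + F x * g x).
Proof.
move=> acF acG.
have cF := ac_continuous acF; have cG := ac_continuous acG.
have jfG a b : L1 `[a, b] (fun x => G x * f x).
  by apply: L1_itv_continuousM => //; exact: ac_L1 acF.
have jFg a b : L1 `[a, b] (fun x => F x * g x).
  by apply: L1_itv_continuousM => //; exact: ac_L1 acG.
have jh a b : L1 `[a, b] (fun x => f x * G x + F x * g x).
  apply: L1D => //; apply: (L1_eq _ _ (jfG a b)) => // x _; exact: mulrC.
have [P acP] := ac_primitive (fun a b (_ : a <= b) => jh a b).
have jk a b : L1 `[a, b] (fun x => `|f x| + `|g x|).
  by apply: L1D => //; apply: L1_norm_fun => //; [exact: ac_L1 acF|exact: ac_L1 acG].
have [K acK] := ac_primitive (fun a b (_ : a <= b) => jk a b).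
have hK : {homo K : x y / x <= y}.
  move=> x y xy; rewrite -subr_ge0; have [_ ->] := acK _ _ xy.
  by apply: Rintegral_ge0 => t _; rewrite addr_ge0.
pose H x := F x * G x - P x.
suff HH x y : x <= y -> H y = H x.
  move=> a b ab; split; first exact: jh.
  by have [_ <-] := acP _ _ ab; have := HH _ _ ab; rewrite /H; lra.
move: x y; apply: (increment_sq_eq0 (ac_continuous acK) hK) => x y xy.
have [_ Kxy] := acK _ _ xy.
have jf := ac_L1 x y acF; have jg := ac_L1 x y acG.
have -> : H y - H x = \int[mu]_(t in `[x, y]) (f t * (G y - G t) + g t * (F x - F t)).
  have <- : \int[mu]_(t in `[x, y]) ((G y * f t + F x * g t) - (f t * G t + F t * g t))
            = \int[mu]_(t in `[x, y]) (f t * (G y - G t) + g t * (F x - F t)).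
    by apply: eq_Rintegral => t _; ring.
  rewrite RintegralB //; last by apply: L1D => //; exact: L1Z.
  rewrite RintegralD //; [|exact: L1Z..].
  rewrite !RintegralZl //.
  have [_ <-] := acP _ _ xy; have [_ <-] := acF _ _ xy; have [_ <-] := acG _ _ xy.
  by rewrite /H; ring.
have osc (A B : R -> R) : ac A B -> (forall t, `|B t| <= `|f t| + `|g t|) ->
    forall s t, x <= s -> s <= t -> t <= y -> `|A t - A s| <= K y - K x.
  move=> acA Bk s t xs st ty; have [jB ->] := acA _ _ st; rewrite Kxy.
  apply: (norm_Rintegral_sub (g := fun t => `|f t| + `|g t|)) => //.
  - by apply: subset_itv; rewrite bnd_simp.
  - exact: L1_measurable jB.
rewrite expr2 {1}Kxy -RintegralZr //.
apply: norm_Rintegral_le => //.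
- apply: measurable_funD; apply: measurable_funM.
  + exact: L1_measurable jf.
  + apply: measurable_funB; first exact: measurable_cst.
    by apply: measurable_funTS; exact: continuous_measurable_fun.
  + exact: L1_measurable jg.
  + apply: measurable_funB; first exact: measurable_cst.
    by apply: measurable_funTS; exact: continuous_measurable_fun.
- apply: L1_eq (L1Z (K y - K x) _ (jk x y)) => // t _; exact: mulrC.
move=> t /=; rewrite in_itv /= => /andP[xt ty].
rewrite mulrDl; apply: (le_trans (ler_normD _ _)); rewrite !normrM.
apply: lerD; apply: ler_wpM2l => //.
  by apply: osc acG _ _ _ _ _ _ => // u; rewrite lerDr.
by rewrite distrC; apply: osc acF _ _ _ _ _ _ => // u; rewrite lerDl.
Qed.

Lemma derivable_ac F f : continuous f -> (forall x, is_derive x 1 F (f x)) ->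
  ac F f.
Proof.
move=> cf dF a b ab; split; first exact: continuous_L1_itv.
move: ab; rewrite le_eqVlt => /predU1P[->|ab].
  by rewrite subrr set_itv1 Rintegral_set1.
have cF : continuous F.
  by move=> x; apply: differentiable_continuous; apply/derivable1_diffP; have := dF x.
rewrite /Rintegral (continuous_FTC2 (F := F) ab).
- by rewrite -EFinB.
- exact: continuous_subspaceT.
- split; first by move=> x _; have := dF x.
  + by apply: cvg_at_right_filter; exact: cF.
  + by apply: cvg_at_left_filter; exact: cF.
- by move=> x _; rewrite derive1E; apply: derive_val.
Qed.

Lemma ac_derivable F f : ac F f -> continuous f ->
  forall x, is_derive x 1 F (f x).
Proof.
move=> acF cf x.
have jf : L1 `[x - 1, x + 1] f by exact: continuous_L1_itv.
have x1 : x < x + 1 by lra.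
have x2 : x - 1 < x by lra.
have [dP Px] := continuous_FTC1_closed x1 jf x2 (cf x).
pose P y := F (x - 1) + \int[mu]_(t in `[x - 1, y]) f t.
have nFP : {near x, P =1 F}.
  near=> y; rewrite /P; have ay : x - 1 <= y.
    by near: y; apply: filterS (lt_nbhsr x2) => y /ltW.
  by have [_ <-] := acF _ _ ay; rewrite subrKC.
apply: (near_eq_is_derive nFP).
have dI : is_derive x (1 : R) (fun y => \int[mu]_(t in `[x - 1, y]) f t) (f x).
  by apply: DeriveDef; [exact: dP|rewrite -derive1E; exact: Px].
by rewrite -[f x]add0r; apply: is_deriveD.
Unshelve. all: by end_near. Qed.

Lemma ac_derive1 F f : ac F f -> continuous f -> derive1 F = f.
Proof.
move=> acF cf; apply/funext => x; rewrite derive1E.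
by have ? := ac_derivable acF cf x; apply: derive_val.
Qed.

(** * Tail integrals and limits at [+oo] *)

Lemma L1_setT_itv f a b : L1 setT f -> L1 `[a, b] f.
Proof. by apply: L1_subset. Qed.

Lemma L1_setT_ray f a : L1 setT f -> L1 `[a, +oo[ f.
Proof. by apply: L1_subset. Qed.

(** Dominated convergence concerns sequences, so it is applied to [|f|] cut off to [[n, +oo[]; the
    tail of [f] from a real [x >= N] is then at most the tail of [|f|] from [N]. *)
Lemma tail_cvg0 f : L1 setT f ->
  \int[mu]_(t in `[x, +oo[) f t @[x --> +oo] --> (0 : R).
Proof.
move=> jf.
pose u n := (fun t => `|f t|) \_ `[n%:R, +oo[.
have jaf := L1_norm_fun (@measurableT _ mR) jf.
have mu_ n : measurable_fun (setT : set mR) (EFin \o u n).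
  apply/measurable_EFinP; apply/(measurable_restrictT _ _).1 => //.
  by apply: measurable_funTS; exact: L1_measurable jaf.
have ucvg t : [set: mR] t -> (EFin \o u n) t @[n --> \oo] --> ((cst 0%E) : R -> \bar R) t.
  move=> _; apply: cvg_near_cst; exists (Num.trunc `|t|).+1 => // n /= tn.
  rewrite /u /= patchE; case: ifPn => //; rewrite inE /= in_itv /= andbT => nt.
  have : `|t| < (Num.trunc `|t|).+1%:R by exact: truncnS_gt.
  move=> /lt_le_trans - /(_ n%:R); rewrite ler_nat => /(_ tn).
  by move=> /(le_lt_trans (ler_norm _)) /lt_le_trans - /(_ _ nt); rewrite ltxx.
have ule n t : [set: mR] t -> (`|(EFin \o u n) t| <= (EFin \o (fun t => `|f t|%R)) t)%E.
  move=> _; rewrite /= lee_fin /u patchE; case: ifPn => _; first by rewrite normr_id.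
  by rewrite normr0.
have gfin t : [set: mR] t -> (EFin \o (fun t => `|f t|%R)) t \is a fin_num by [].
have := dominated_cvg (@measurableT _ mR) mu_ ucvg gfin jaf ule.
rewrite integral0 => /fine_cvgP[_ /cvgrPdist_lt H].
apply/cvgrPdist_lt => e e0; have [N _ /(_ N (leqnn N)) /=] := H e e0.
rewrite sub0r normrN /= => HN; near=> x.
rewrite sub0r normrN.
apply: (@le_lt_trans _ _ (\int[mu]_(t in `[N%:R, +oo[) `|f t|)).
  apply: norm_Rintegral_sub => //.
  - apply: subset_itvr; rewrite bnd_simp; near: x; exact: nbhs_pinfty_ge (num_real _).
  - by apply: measurable_funTS; exact: L1_measurable jf.
  - exact: L1_setT_ray.
apply: le_lt_trans HN; apply: le_trans (ler_norm _).
by rewrite Rintegral_mkcond /Rintegral.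
Unshelve. all: by end_near. Qed.

Lemma ac_cvgy F f a : ac F f -> L1 setT f ->
  F x @[x --> +oo] --> F a + \int[mu]_(t in `[a, +oo[) f t.
Proof.
move=> acF jf.
have H : (F a + (\int[mu]_(t in `[a, +oo[) f t - \int[mu]_(t in `[x, +oo[) f t))
    @[x --> +oo] --> F a + (\int[mu]_(t in `[a, +oo[) f t - 0).
  by apply: cvgD; [exact: cvg_cst|apply: cvgB; [exact: cvg_cst|exact: tail_cvg0]].
rewrite subr0 in H; apply: cvg_trans H; apply: near_eq_cvg; near=> x.
have ax : a <= x by near: x; exact: nbhs_pinfty_ge (num_real _).
rewrite (Rintegral_ray_split ax); last exact: L1_setT_ray.
by rewrite addrK; have [_ <-] := acF _ _ ax; rewrite subrKC.
Unshelve. all: by end_near. Qed.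

Lemma ac_tail F f l x : ac F f -> L1 setT f -> F y @[y --> +oo] --> l ->
  F x = l - \int[mu]_(t in `[x, +oo[) f t.
Proof.
move=> acF jf Fl.
by rewrite (cvg_unique _ Fl (ac_cvgy (a := x) acF jf)) // addrK.
Qed.

Lemma tail_ac f l : L1 setT f ->
  ac (fun x => l - \int[mu]_(t in `[x, +oo[) f t) f.
Proof.
move=> jf a b ab; split; first exact: L1_setT_itv.
rewrite (Rintegral_ray_split ab); last exact: L1_setT_ray.
by ring.
Qed.

Lemma tail_ac_cvg f l : L1 setT f ->
  l - \int[mu]_(t in `[x, +oo[) f t @[x --> +oo] --> l.
Proof.
move=> jf; rewrite -[X in _ --> X]subr0.
by apply: cvgB; [exact: cvg_cst|exact: tail_cvg0].
Qed.

(** * Reflection of the line, which exchanges the two Jost solutions *)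

Lemma pushforward_opp_integral D (g : mR -> \bar R) : measurable D ->
  (\int[pushforward mu (-%R : mR -> mR)]_(x in D) g x = \int[mu]_(x in D) g x)%E.
Proof.
by move=> mD; apply: eq_measure_integral => A mA _; exact: lebesgue_measureN.
Qed.

Lemma L1_reflect D f : measurable D -> mfun f -> L1 D f ->
  L1 ((fun x : mR => - x : mR) @^-1` D) (fun x => f (- x)).
Proof.
move=> mD mf jf; have mfo : mfun (fun x => f (- x)) by exact: measurableT_comp.
have mE : measurable ((fun x : mR => - x : mR) @^-1` D).
  have mo : measurable_fun (setT : set mR) (fun x : mR => - x : mR).
    exact: (@oppr_measurable R setT).
  by rewrite -[X in measurable X]setTI; apply: mo.
apply/integrableP; split.
  by apply/measurable_EFinP; exact: measurable_funTS.
have /integrableP[_] := jf; apply: le_lt_trans.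
have := pushforward_opp_integral (fun x => `|(EFin \o f) x|%E) mD.
rewrite ge0_integral_pushforward //; last first.
  by apply: measurable_funTS; apply/measurable_EFinP; exact: measurableT_comp.
by move=> <-.
Qed.

Lemma Rintegral_reflect D f : measurable D -> mfun f -> L1 D f ->
  \int[mu]_(x in (fun x : mR => - x : mR) @^-1` D) f (- x) = \int[mu]_(x in D) f x.
Proof.
move=> mD mf jf; rewrite /Rintegral; congr fine.
have := pushforward_opp_integral (EFin \o f) mD.
rewrite (@integral_pushforward _ _ _ _ _ (-%R : mR -> mR) _ mu D (EFin \o f)) //.
- exact/measurable_EFinP.
- exact: L1_reflect.
Qed.

Lemma preimage_opp_itvcc a b :
  (fun x : mR => - x : mR) @^-1` `[a, b] = `[- b, - a]%classic.
Proof.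
by apply/seteqP; split => x /=; rewrite !in_itv /= => /andP[h1 h2]; apply/andP; split; lra.
Qed.

Lemma ac_reflect F f : ac F f -> ac (fun x => F (- x)) (fun x => - f (- x)).
Proof.
move=> acF a b ab.
have ba : - b <= - a by rewrite lerN2.
have [jf Ff] := acF _ _ ba; have mf := ac_measurable_deriv acF.
have jfo : L1 `[a, b] (fun x => f (- x)).
  have := L1_reflect (@measurable_itv _ _) mf jf.
  by rewrite preimage_opp_itvcc !opprK.
split; first exact: L1N.
have -> : \int[mu]_(x in `[a, b]) - f (- x) = \int[mu]_(x in `[a, b]) (-1 * f (- x)).
  by apply: eq_Rintegral => x _; rewrite mulN1r.
rewrite RintegralZl //.
have := Rintegral_reflect (@measurable_itv _ _) mf jf.
rewrite preimage_opp_itvcc !opprK => ->.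
by rewrite -Ff; ring.
Qed.

Lemma Rintegral_halves f : L1 setT f -> \int[mu]_(x in setT) f x =
  \int[mu]_(x in `[0, +oo[) f x + \int[mu]_(x in `[0, +oo[) f (- x).
Proof.
move=> jf; have mf : mfun f by exact: L1_measurable jf.
have mN : measurable (`]-oo, 0%R]%classic : set mR) by exact: measurable_itv.
have jN : L1 `]-oo, 0] f by exact: (L1_subset mN (@measurableT _ mR)) jf.
have := Rintegral_reflect mN mf jN.
have -> : (fun x : mR => - x : mR) @^-1` `]-oo, 0] = `[0, +oo[%classic.
  by apply/seteqP; split => x /=; rewrite !in_itv /= ?andbT ?oppr_le0.
move=> ->; rewrite -set_itvNyy.
have := Rintegral_itvB (f := f) (a := -oo%O) (b := +oo%O) (x := 0).
rewrite set_itvNyy => /(_ jf isT isT) H.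
rewrite -[LHS](subrK (\int[mu]_(x in `]-oo, 0]) f x)) H; congr (_ + _).
by rewrite Rintegral_itv_obnd_cbnd //; apply: (L1_subset _ _ _ jf).
Qed.

Lemma measurable_norm_fun f : mfun f -> mfun (fun x => `|f x|).
Proof.
by move=> mf; apply: measurableT_comp mf; exact: normr_measurable.
Qed.

Lemma measurable_weight n : mfun (fun x : R => (1 + `|x|) ^+ n).
Proof.
apply: measurable_funX; apply: measurable_funD; first exact: measurable_cst.
exact: normr_measurable.
Qed.

(** * Linear systems with an integrable matrix *)

(** The intervals of radius [2 C / 2^n] about [u n] are nested, and the limit is the supremum of
    their left ends. The explicit rate makes the convergence of the Picard iterates uniform in the
    variable. *)
Lemma geometric_limit (u : nat -> R) (C : R) :
  (forall n, `|u n.+1 - u n| <= C / 2 ^+ n) ->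
  exists l, forall n, `|l - u n| <= 2 * C / 2 ^+ n.
Proof.
move=> uC.
have C0 : 0 <= C by have := le_trans (normr_ge0 _) (uC 0%N); rewrite expr0 divr1.
pose e n : R := 2 * C / 2 ^+ n.
have eS n : e n.+1 = C / 2 ^+ n.
  rewrite /e exprS; have : (2 : R) ^+ n != 0 by rewrite expf_neq0.
  by move: (2 ^+ n) => p p0; field.
have e2 n : e n = C / 2 ^+ n + C / 2 ^+ n by rewrite /e -mulrDl; congr (_ / _); ring.
have e0 n : 0 <= e n by rewrite /e divr_ge0 ?mulr_ge0 ?exprn_ge0.
pose A n := u n - e n; pose B n := u n + e n.
have hA : {homo A : m n / (m <= n)%N >-> m <= n}.
  apply: homo_leq => [//|x y z|n]; first exact: le_trans.
  by have := uC n; rewrite ler_norml /A eS e2 => /andP[h1 h2]; lra.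
have hB m n : (m <= n)%N -> B n <= B m.
  elim: n => [|n IH]; first by rewrite leqn0 => /eqP ->.
  rewrite leq_eqVlt => /predU1P[->//|]; rewrite ltnS => /IH; apply: le_trans.
  by have := uC n; rewrite ler_norml /B eS e2 => /andP[h1 h2]; lra.
have AB m n : A m <= B n.
  have h1 := hA m (maxn m n) (leq_maxl _ _).
  have h2 := hB n (maxn m n) (leq_maxr _ _).
  by apply: (le_trans h1); apply: le_trans h2; rewrite /A /B; have := e0 (maxn m n); lra.
have hs : has_sup (range A).
  by split; [exists (A 0%N), 0%N|exists (B 0%N) => _ [m _ <-]; exact: AB].
exists (sup (range A)) => n.
have h1 : A n <= sup (range A) by apply: ub_le_sup; [case: hs|exists n].
have h2 : sup (range A) <= B n.
  by apply: ge_sup; [case: hs|move=> _ [m _ <-]; exact: AB].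
by rewrite ler_norml -/(e n); move: h1 h2; rewrite /A /B; lra.
Qed.

Lemma geometric_cvg (u : nat -> R) (C l : R) :
  (forall n, `|l - u n| <= C / 2 ^+ n) -> u @ \oo --> l.
Proof.
move=> uC; apply/cvgrPdist_le => e e0.
have C0 : 0 <= C by have := le_trans (normr_ge0 _) (uC 0%N); rewrite expr0 divr1.
exists (Num.trunc (C / e)).+1 => // n /= nn.
apply: (le_trans (uC n)); rewrite ler_pdivrMr ?exprn_gt0 // mulrC -ler_pdivrMr //.
apply: ltW; apply: (lt_le_trans (truncnS_gt _)).
by rewrite -natrX ler_nat (leq_trans nn) // ltnW // ltn_expl.
Qed.

Definition linear_op (M : bool -> bool -> R -> R) (Y : bool -> R -> R) (i : bool)
  (t : R) := M i true t * Y true t + M i false t * Y false t.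

Section LinearSystem.
Variables (M : bool -> bool -> R -> R) (kappa : R -> R).
Hypothesis mM : forall i j, mfun (M i j).
Hypothesis Mkappa : forall i j t, `|M i j t| <= kappa t.
Hypothesis jkappa : L1 setT kappa.
Hypothesis kappa_small : \int[mu]_(t in setT) kappa t <= 8^-1.

Let kappa_ge0 t : 0 <= kappa t.
Proof. exact: le_trans (normr_ge0 _) (Mkappa true true t). Qed.

Lemma linear_op_measurable (Y : bool -> R -> R) i : (forall j, mfun (Y j)) -> mfun (linear_op M Y i).
Proof. by move=> mY; apply: measurable_funD; apply: measurable_funM. Qed.

Lemma linear_op_bound (Y : bool -> R -> R) i B t : (forall j, `|Y j t| <= B) ->
  `|linear_op M Y i t| <= 2 * B * kappa t.
Proof.
move=> YB; apply: (le_trans (ler_normD _ _)); rewrite !normrM.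
have h j : `|M i j t| * `|Y j t| <= kappa t * B by apply: ler_pM.
by have := lerD (h true) (h false); lra.
Qed.

Lemma linear_op_L1 (Y : bool -> R -> R) i B : (forall j, mfun (Y j)) -> (forall j t, `|Y j t| <= B) ->
  L1 setT (linear_op M Y i).
Proof.
move=> mY YB; apply: (L1_dominated (g := fun t => 2 * B * kappa t)) => //.
- exact: linear_op_measurable.
- exact: L1Z.
- by move=> t _; apply: linear_op_bound => j.
Qed.

Lemma linear_op_int_le D (Y : bool -> R -> R) i B : measurable D ->
  (forall j, mfun (Y j)) -> (forall j t, D t -> `|Y j t| <= B) -> 0 <= B ->
  `|\int[mu]_(t in D) linear_op M Y i t| <= 2 * B * \int[mu]_(t in setT) kappa t.
Proof.
move=> mD mY YB B0; rewrite -RintegralZl //.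
apply: norm_Rintegral_sub => //.
- by apply: measurable_funTS; apply: linear_op_measurable.
- exact: L1Z.
- by move=> t _; rewrite !mulr_ge0.
- by move=> t Dt; apply: linear_op_bound => j; exact: YB.
Qed.

Lemma linear_op_int D (Y : bool -> R -> R) i B : measurable D ->
  (forall j, mfun (Y j)) -> (forall j t, D t -> `|Y j t| <= B) -> 0 <= B ->
  `|\int[mu]_(t in D) linear_op M Y i t| <= 2 * B * 8^-1.
Proof.
move=> mD mY YB B0; apply: (le_trans (linear_op_int_le i mD mY YB B0)).
by rewrite ler_wpM2l // mulr_ge0.
Qed.

(* Picard iteration from +oo. *)
Lemma linear_system_solution (l : bool -> R) :
  exists Y : bool -> R -> R, forall i,
    ac (Y i) (linear_op M Y i) /\ Y i x @[x --> +oo] --> l i.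
Proof.
pose T (Y : bool -> R -> R) i x := l i - \int[mu]_(t in `[x, +oo[) linear_op M Y i t.
pose Yn n := iter n T (fun i _ => l i).
pose L := `|l true| + `|l false|.
have L0 : 0 <= L by rewrite addr_ge0.
have lL i : `|l i| <= L by case: i; rewrite /L ?lerDl ?lerDr.
(* The ball of radius [2 L] is stable: a row has two entries, so the integral is at most
   [2 (2 L) / 8 = L / 2], and [L + L / 2 <= 2 L]. *)
have inv n : (forall i, mfun (Yn n i)) /\
    (forall i t, `|Yn n i t| <= 2 * L).
  elim: n => [|n [mY YB]].
    split=> [i|i t]; first exact: measurable_cst.
    by apply: (le_trans (lL i)); rewrite ler_peMl // ler1n.
  split=> [i|i t].
    apply: (@ac_measurable _ (linear_op M (Yn n) i)); apply: tail_ac.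
    exact: linear_op_L1 YB.
  rewrite /Yn iterS -/(Yn n) /T; apply: (le_trans (ler_normB _ _)).
  have h := @linear_op_int `[t, +oo[ (Yn n) i (2 * L) (@measurable_itv _ _) mY (fun j t _ => YB j t).
  by have := h (mulr_ge0 (ler0n _ 2) L0); have := lL i; lra.
have mY n i := (inv n).1 i; have YB n i t := (inv n).2 i t.
(* The contraction factor is in fact [2 / 8 = 1 / 4]; the weaker [1 / 2] matches the powers of 2 in
   [geometric_limit]. *)
have TB n m x i B : 0 <= B -> (forall j t, `|Yn n j t - Yn m j t| <= B) ->
    `|T (Yn n) i x - T (Yn m) i x| <= B / 2.
  move=> B0 HB; rewrite /T.
  have -> : l i - \int[mu]_(t in `[x, +oo[) linear_op M (Yn n) i t -
      (l i - \int[mu]_(t in `[x, +oo[) linear_op M (Yn m) i t) =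
      - (\int[mu]_(t in `[x, +oo[) linear_op M (Yn n) i t -
         \int[mu]_(t in `[x, +oo[) linear_op M (Yn m) i t) by ring.
  rewrite normrN -RintegralB //; [|by apply: L1_setT_ray; apply: linear_op_L1 (YB _)..].
  have -> : \int[mu]_(t in `[x, +oo[) (linear_op M (Yn n) i t - linear_op M (Yn m) i t) =
      \int[mu]_(t in `[x, +oo[) linear_op M (fun j t => Yn n j t - Yn m j t) i t.
    by apply: eq_Rintegral => t _; rewrite /linear_op; ring.
  apply: (@le_trans _ _ (2 * B * 8^-1)); last by lra.
  by apply: linear_op_int => // j; apply: measurable_funB.
have diff n : forall i t, `|Yn n.+1 i t - Yn n i t| <= L / 2 ^+ n.
  elim: n => [|n IH] i t.
    rewrite expr0 divr1 /Yn /= /T addrAC subrr add0r normrN.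
    apply: (@le_trans _ _ (2 * L * 8^-1)); last by move: L0; lra.
    by apply: linear_op_int => // j; exact: measurable_cst.
  have B0 : 0 <= L / 2 ^+ n by rewrite divr_ge0 // exprn_ge0.
  have := TB _ _ t i _ B0 IH; rewrite exprSr invfM mulrA.
  by rewrite /Yn !iterS.
have lim i t := geometric_limit (fun n => diff n i t).
pose Y i t := sval (cid (lim i t)).
have YY i t n : `|Y i t - Yn n i t| <= 2 * L / 2 ^+ n.
  by rewrite /Y; case: (cid (lim i t)).
have mYl i : mfun (Y i).
  apply: (measurable_fun_cvg (h := fun n => Yn n i)) => [n|x _]; first exact: mY.
  exact: (geometric_cvg (YY i x)).
have YBl i t : `|Y i t| <= 4 * L.
  have := YY i t 0%N; have := lL i; rewrite expr0 divr1 /Yn /=.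
  have := ler_normD (Y i t - l i) (l i); rewrite subrK; lra.
have YT i x : Y i x = T Y i x.
  apply/eqP; rewrite -subr_eq0 -normr_le0.
  (* The limit is a fixed point of [T], being within [4 L / 2^n] of its own image for every [n]. *)
  have key n : `|Y i x - T Y i x| <= 4 * L / 2 ^+ n.
    have -> : Y i x - T Y i x = (Y i x - Yn n.+1 i x) + (Yn n.+1 i x - T Y i x) by ring.
    apply: (le_trans (ler_normD _ _)).
    have h1 := YY i x n.+1.
    have h2 : `|Yn n.+1 i x - T Y i x| <= 2 * L / 2 ^+ n.
      rewrite /Yn iterS -/(Yn n) /T.
      have -> : l i - \int[mu]_(t in `[x, +oo[) linear_op M (Yn n) i t -
        (l i - \int[mu]_(t in `[x, +oo[) linear_op M Y i t) =
        (\int[mu]_(t in `[x, +oo[) linear_op M Y i t -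
         \int[mu]_(t in `[x, +oo[) linear_op M (Yn n) i t) by ring.
      rewrite -RintegralB //; [|by apply: L1_setT_ray; apply: linear_op_L1 YBl|
        by apply: L1_setT_ray; apply: linear_op_L1 (YB _)].
      have -> : \int[mu]_(t in `[x, +oo[) (linear_op M Y i t - linear_op M (Yn n) i t) =
        \int[mu]_(t in `[x, +oo[) linear_op M (fun j t => Y j t - Yn n j t) i t.
        by apply: eq_Rintegral => t _; rewrite /linear_op; ring.
      have B0 : 0 <= 2 * L / 2 ^+ n by rewrite divr_ge0 ?mulr_ge0 // exprn_ge0.
      apply: (@le_trans _ _ (2 * (2 * L / 2 ^+ n) * 8^-1)); last by move: B0; lra.
      by apply: linear_op_int => // j; apply: measurable_funB.
    apply: (le_trans (lerD h1 h2)).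
    have p0 : (2 : R) ^+ n > 0 by rewrite exprn_gt0.
    have h0 : 0 <= L / 2 ^+ n by rewrite divr_ge0 // ltW.
    have -> : 2 * L / 2 ^+ n.+1 = L / 2 ^+ n.
      rewrite [2 ^+ n.+1]exprS.
      by move: (2 ^+ n) p0 => p p0; field; rewrite gt_eqF.
    by rewrite -!mulrA; move: h0; lra.
  apply/ler_addgt0Pl => e e0; rewrite addr0.
  have h : (fun n : nat => 4 * L / 2 ^+ n) @ \oo --> (0 : R).
    apply: (@geometric_cvg _ (4 * L)) => n; rewrite sub0r normrN ger0_norm //.
    by rewrite divr_ge0 ?mulr_ge0 // exprn_ge0.
  move/cvgrPdist_le: h => /(_ e e0)[n _ /(_ n (leqnn n))] /=.
  rewrite sub0r normrN ger0_norm ?divr_ge0 ?mulr_ge0 ?exprn_ge0 //.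
  by apply: le_trans; exact: key.
exists Y => i; have jY : L1 setT (linear_op M Y i) by apply: linear_op_L1 YBl.
have YE : Y i = T Y i by apply/funext => x; exact: YT.
by rewrite YE; split; [exact: tail_ac|exact: tail_ac_cvg].
Qed.

Section Solution.
Variable Y : bool -> R -> R.
Hypothesis acY : forall i, ac (Y i) (linear_op M Y i).

Let y t := `|Y true t| + `|Y false t|.

Let cy : continuous y.
Proof.
by move=> t; apply: cvgD; apply: cvg_norm; exact: (ac_continuous (acY _)).
Qed.

Let y_incr a b B : a <= b -> (forall t, a <= t <= b -> y t <= B) ->
  `|y b - y a| <= B / 2.
Proof.
move=> ab yB.
have B0 : 0 <= B by apply: le_trans (yB a _); rewrite ?lexx ?addr_ge0.
have H i : `|Y i b - Y i a| <= 2 * B * 8^-1.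
  have [_ ->] := acY i ab; apply: linear_op_int => //.
    by move=> j; exact: ac_measurable (acY j).
  move=> j t /=; rewrite in_itv /= => /yB; apply: le_trans.
  by rewrite /y; case: j; rewrite ?lerDl ?lerDr.
have h1 := le_trans (ler_dist_dist _ _) (H true).
have h2 := le_trans (ler_dist_dist _ _) (H false).
have -> : y b - y a = (`|Y true b| - `|Y true a|) + (`|Y false b| - `|Y false a|).
  by rewrite /y; ring.
by apply: (le_trans (ler_normD _ _)); move: h1 h2; lra.
Qed.

(** This takes the place of Gronwall's inequality. At the maximum [p] of [y] on the segment between
    [s] and [t], [y_incr] bounds [y p - y t] by [y p / 2], so [y s <= y p <= 2 y t]. Every solution
    is therefore bounded on the whole line. *)
Let y_le s t : y s <= 2 * y t.
Proof.
wlog: s t / True.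
  by move=> H; apply: H.
move=> _; pose a := Num.min s t; pose b := Num.max s t.
have ab : a <= b by rewrite /a /b ge_min le_max lexx.
have cyab : {within `[a, b], continuous y} by exact: continuous_subspaceT.
have [p pab pM] := EVT_max ab cyab.
have yp u : a <= u <= b -> y u <= y p by move=> uab; apply: pM; rewrite in_itv.
have sab : a <= s <= b by rewrite /a /b ge_min le_max lexx.
have tab : a <= t <= b by rewrite /a /b ge_min le_max lexx !orbT.
have y0 u : 0 <= y u by rewrite addr_ge0.
rewrite in_itv /= in pab.
have pt : `|y p - y t| <= y p / 2.
  have [/andP[ap pb] /andP[at_ tb]] := (pab, tab).
  have [tp|pt] := leP t p.
    apply: y_incr => // u /andP[tu up]; apply: yp.
    by rewrite (le_trans at_ tu) (le_trans up pb).
  rewrite distrC; apply: y_incr => [|u /andP[pu ut]]; first exact: ltW.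
  by apply: yp; rewrite (le_trans ap pu) (le_trans ut tb).
by have := yp s sab; move: pt; rewrite ler_norml => /andP[]; lra.
Qed.

Lemma linear_system_L1 i : L1 setT (linear_op M Y i).
Proof.
apply: (@linear_op_L1 Y i (2 * y 0)) => [j|j t].
  exact: ac_measurable (acY j).
by apply: le_trans (y_le t 0); rewrite /y; case: j; rewrite ?lerDl ?lerDr.
Qed.

Lemma linear_system_cvg : exists l : bool -> R,
  forall i, Y i x @[x --> +oo] --> l i.
Proof.
exists (fun i => Y i 0 + \int[mu]_(t in `[0, +oo[) linear_op M Y i t) => i.
by apply: ac_cvgy => //; exact: linear_system_L1.
Qed.

Variable l : bool -> R.
Hypothesis Yl : forall i, Y i x @[x --> +oo] --> l i.

Lemma linear_system_bound i t : `|Y i t| <= 2 * (`|l true| + `|l false|).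
Proof.
apply: (@le_trans _ _ (y t)).
  by rewrite /y; case: i; rewrite ?lerDl ?lerDr.
have H : 2 * y s @[s --> +oo] --> 2 * (`|l true| + `|l false|).
  by apply: cvgM; [exact: cvg_cst|apply: cvgD; apply: cvg_norm].
by apply: (ler_cvg_to (cvg_cst (y t)) H); apply: nearW => s; exact: y_le.
Qed.

Lemma linear_system_tail i x :
  Y i x = l i - \int[mu]_(t in `[x, +oo[) linear_op M Y i t.
Proof. by apply: ac_tail => //; exact: linear_system_L1. Qed.

End Solution.
End LinearSystem.

(** * Schrodinger operators and quasi-derivatives *)

Lemma is_derive_linear (w x : R) : is_derive x (1 : R) (fun y => w * y) w.
Proof. by have := is_deriveZ w (is_derive_id x (1 : R)); rewrite /GRing.scale /= mulr1. Qed.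

Lemma continuous_linear (w : R) : continuous (fun y : R => w * y).
Proof. by move=> x; apply: cvgM; [exact: cvg_cst|exact: cvg_id]. Qed.

Lemma ac_sin_linear (w : R) : ac (fun x => sin (w * x)) (fun x => w * cos (w * x)).
Proof.
apply: derivable_ac => x.
  apply: cvgM; first exact: cvg_cst.
  by apply: continuous_comp; [exact: continuous_linear|exact: continuous_cos].
have H := @is_derive1_comp R (@sin R) (fun y => w * y) x (cos (w * x)) w
  (is_derive_sin (w * x)) (is_derive_linear w x).
by apply: (is_derive_eq H); rewrite /GRing.scale /= mulrC.
Qed.

Lemma ac_cos_linear (w : R) : ac (fun x => cos (w * x)) (fun x => - w * sin (w * x)).
Proof.
apply: derivable_ac => x.
  apply: cvgM; first exact: cvg_cst.
  by apply: continuous_comp; [exact: continuous_linear|exact: continuous_sin].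
have H := @is_derive1_comp R (@cos R) (fun y => w * y) x (- sin (w * x)) w
  (is_derive_cos (w * x)) (is_derive_linear w x).
by apply: (is_derive_eq H); rewrite /GRing.scale /=; ring.
Qed.

Lemma measurable_sin_linear (w : R) : mfun (fun x => sin (w * x)).
Proof. exact: ac_measurable (ac_sin_linear w). Qed.

Lemma measurable_cos_linear (w : R) : mfun (fun x => cos (w * x)).
Proof. exact: ac_measurable (ac_cos_linear w). Qed.

Lemma sin_norm_le x : `|sin x| <= `|x|.
Proof.
wlog x0 : x / 0 <= x => [H|].
  have [/H//|/ltW x0] := leP 0 x.
  by rewrite -normrN -sinN -[leRHS]normrN; apply: H; rewrite oppr_ge0.
have cs : {within `[0, x], continuous (@sin R)}.
  by apply: continuous_subspaceT; exact: continuous_sin.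
have ds y : y \in `]0, x[%R -> is_derive y (1 : R) (@sin R) (cos y) by move=> _; exact: is_derive_sin.
have [y _] := MVT_segment x0 ds cs.
rewrite sin0 !subr0 => ->; rewrite normrM ler_piMl //; exact: cos_max.
Qed.

(** [A] is a primitive of [U] up to the remainder [E]. The weight has power 2 because [sin(kx)/k],
    which is at most [|x|] uniformly in [k], enters the system quadratically. [E] is measured at
    order [d^2], the order of [A^2], from which it is subtracted. *)
Record regularized (U A E : R -> R) (d : R) : Prop := Regularized {
  reg_ac : ac A (fun x => U x - E x);
  reg_bound : forall x, `|A x| <= d;
  reg_A_L1 : L1 setT (fun x => (1 + `|x|) ^+ 2 * `|A x|);
  reg_A_int : \int[mu]_(x in setT) ((1 + `|x|) ^+ 2 * `|A x|) <= d;
  reg_E_meas : mfun E;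
  reg_E_L1 : L1 setT (fun x => (1 + `|x|) ^+ 2 * `|E x|);
  reg_E_int : \int[mu]_(x in setT) ((1 + `|x|) ^+ 2 * `|E x|) <= d ^+ 2 }.

Section Schrodinger.
Variables (U A E : R -> R) (d k : R).
Hypothesis reg : regularized U A E d.
Hypothesis d_gt0 : 0 < d.
Hypothesis d_le : d <= 32^-1.
Hypothesis k_neq0 : k != 0.

Let cA : continuous A. Proof. exact: ac_continuous (reg_ac reg). Qed.

(** [cosk] and [sink] are the free solutions with data [(1, 0)] and [(0, 1)] at 0. The bounds
    [|cosk| <= 1], [|k sink| <= 1] and [|sink x| <= |x|] are uniform in [k]. *)
Definition cosk x := cos (k * x).
Definition sink x := sin (k * x) / k.
Definition residual_potential x := A x ^+ 2 - E x.

Lemma ac_cosk : ac cosk (fun x => - k ^+ 2 * sink x).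
Proof. by apply: ac_eq (ac_cos_linear k) _ _ => // x; rewrite /sink; field. Qed.

Lemma ac_sink : ac sink cosk.
Proof.
apply: ac_eq (acZ k^-1 (ac_sin_linear k)) _ _ => x; first by rewrite mulrC.
by rewrite mulKf.
Qed.

Lemma cosk_sink x : cosk x ^+ 2 + k ^+ 2 * sink x ^+ 2 = 1.
Proof. by rewrite -(cos2Dsin2 (k * x)) /cosk /sink; field. Qed.

Lemma cosk_le1 x : `|cosk x| <= 1. Proof. exact: cos_max. Qed.

Lemma ksink_le1 x : `|k| * `|sink x| <= 1.
Proof. by rewrite -normrM /sink mulrC divfK // sin_max. Qed.

Lemma sink_le x : `|sink x| <= `|x|.
Proof.
rewrite /sink normrM normfV ler_pdivrMr ?normr_gt0 // -normrM mulrC.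
exact: sin_norm_le.
Qed.

(* The scale of the second coordinate of the system below, chosen so that its
   matrix is small uniformly in k. *)
Definition momentum_scale := `|k| + d.

Let eta_gt0 : 0 < momentum_scale. Proof. by rewrite /momentum_scale ltr_wpDl. Qed.

(* Variation of constants: in the coordinates [v = cosk a + momentum_scale sink b],
   [w = - k^2 sink a + momentum_scale cosk b], the system [v' = A v + w],
   [w' = - (k^2 + residual_potential) v - A w] becomes [(a, b)' = system_matrix (a, b)]. *)
Definition system_matrix (i j : bool) x : R :=
  let c := cosk x in let s := sink x in
  let D := c ^+ 2 * A x + s * c * residual_potential x - k ^+ 2 * s ^+ 2 * A x in
  match i, j with
  | true, true => D
  | true, false => momentum_scale * (2 * c * s * A x + s ^+ 2 * residual_potential x)
  | false, true => (2 * k ^+ 2 * s * c * A x - c ^+ 2 * residual_potential x) / momentum_scale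
  | false, false => - D
  end.

Let PA x := (1 + `|x|) ^+ 2 * `|A x|.
Let QG x := (1 + `|x|) ^+ 2 * `|residual_potential x|.
(** The factor [d^-1] accounts for the division by [momentum_scale >= d] in the lower left entry of
    the matrix. As the weighted norm of the residual potential is [O(d^2)], the integral of the
    bound is still [O(d)]. *)
Definition system_bound x := 2 * PA x + d^-1 * QG x.

Let mA : mfun A. Proof. exact: continuous_measurable_fun. Qed.
Let mG : mfun residual_potential.
Proof.
by apply: measurable_funB; [apply: measurable_funX|exact: reg_E_meas reg].
Qed.
Let mQG : mfun QG.
Proof. by apply: measurable_funM; [exact: measurable_weight|exact: measurable_norm_fun]. Qed.

Let QG_le x : QG x <= d * PA x + (1 + `|x|) ^+ 2 * `|E x|.
Proof.
rewrite /QG /PA /residual_potential mulrCA -mulrDr ler_wpM2l ?sqr_ge0 //.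
apply: (le_trans (ler_normB _ _)); rewrite lerD2r normrX expr2 ler_wpM2r //.
exact: reg_bound reg x.
Qed.

Lemma QG_L1 : L1 setT QG.
Proof.
apply: (L1_dominated (g := fun x => d * PA x + (1 + `|x|) ^+ 2 * `|E x|)) .
- exact: measurableT.
- exact: mQG.
- apply: L1D => //; last exact: reg_E_L1 reg.
  by apply: L1Z => //; exact: reg_A_L1 reg.
by move=> x _; rewrite ger0_norm ?QG_le // mulr_ge0 ?sqr_ge0.
Qed.

Lemma QG_int : \int[mu]_(x in setT) QG x <= 2 * d ^+ 2.
Proof.
have jP := reg_A_L1 reg; have jE := reg_E_L1 reg.
apply: (@le_trans _ _ (\int[mu]_(x in setT) (d * PA x + (1 + `|x|) ^+ 2 * `|E x|))).
  by apply: le_Rintegral => //; [exact: QG_L1|by apply: L1D => //; exact: L1Z].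
rewrite RintegralD //; last exact: L1Z.
rewrite RintegralZl //.
have := reg_A_int reg; have := reg_E_int reg; rewrite -/PA => h1 h2.
have := ler_wpM2l (ltW d_gt0) h2; rewrite -/(PA _); nra.
Qed.

Lemma system_bound_L1 : L1 setT system_bound.
Proof.
apply: L1D => //; apply: L1Z => //; first exact: reg_A_L1 reg.
exact: QG_L1.
Qed.

Lemma system_bound_int : \int[mu]_(x in setT) system_bound x <= 4 * d.
Proof.
rewrite RintegralD //; [|by apply: L1Z => //; exact: reg_A_L1 reg|
  by apply: L1Z => //; exact: QG_L1].
rewrite !RintegralZl //; [|exact: QG_L1|exact: reg_A_L1 reg].
have h1 := reg_A_int reg; have h2 := QG_int.
have : d^-1 * \int[mu]_(x in setT) QG x <= 2 * d.
  by rewrite mulrC ler_pdivrMr // -mulrA -expr2.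
by move: h1; rewrite -/(PA _) /PA; lra.
Qed.

Lemma system_matrix_measurable i j : mfun (system_matrix i j).
Proof.
have mc := ac_measurable ac_cosk; have ms := ac_measurable ac_sink.
have mk (r : R) : mfun (fun=> r) by exact: measurable_cst.
have mD : mfun (fun x => cosk x ^+ 2 * A x + sink x * cosk x * residual_potential x -
   k ^+ 2 * sink x ^+ 2 * A x).
  by do ![exact: mk|exact: mA|exact: mG|exact: mc|exact: ms|apply: measurable_funB|apply: measurable_funD|apply: measurable_funM|apply: measurable_funX].
case: i; case: j; rewrite /system_matrix /=.
- exact: mD.
- by do ![exact: mk|exact: mA|exact: mG|exact: mc|exact: ms|apply: measurable_funB|apply: measurable_funD|apply: measurable_funM|apply: measurable_funX].
- by do ![exact: mk|exact: mA|exact: mG|exact: mc|exact: ms|apply: measurable_funB|apply: measurable_funD|apply: measurable_funM|apply: measurable_funX].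
- exact: (measurableT_comp (@oppr_measurable R setT) mD).
Qed.

Let a0 x : 0 <= `|A x|. Proof. by []. Qed.
Let g0 x : 0 <= `|residual_potential x|. Proof. by []. Qed.

Let weight_ge x : 1 + `|x| <= (1 + `|x|) ^+ 2.
Proof. by rewrite expr2 ler_peMl ?addr_ge0 // lerDl. Qed.

Let etas x : momentum_scale * `|sink x| <= 1 + `|x|.
Proof.
rewrite /momentum_scale mulrDl lerD ?ksink_le1 //.
apply: le_trans (sink_le x); rewrite ler_piMl //.
by apply: (le_trans d_le); lra.
Qed.

(** In the upper right entry, [momentum_scale |sink| <= 1 + |x|] and a second factor [sink] use up
    the whole weight. In the lower left entry, [k^2 sink cosk] is at most [|k| <= momentum_scale],
    and the residual potential is divided by [momentum_scale >= d]. *)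
Lemma system_matrix_le i j x : `|system_matrix i j x| <= system_bound x.
Proof.
have c1 := cosk_le1 x; have s1 := ksink_le1 x; have sx := sink_le x.
have W := weight_ge x; have X0 := normr_ge0 x; have es := etas x.
have A0 := a0 x; have G0 := g0 x.
have eA : 2 * `|A x| <= 2 * PA x.
  by rewrite ler_wpM2l // ler_peMl //; lra.
have eG0 : (1 + `|x|) * `|residual_potential x| <= QG x by rewrite ler_wpM2r.
have eG : QG x <= d^-1 * QG x.
  rewrite ler_peMl //; first by rewrite mulr_ge0 ?sqr_ge0.
  by rewrite invf_ge1 //; apply: (le_trans d_le); lra.
have c2 : `|cosk x| ^+ 2 <= 1 by rewrite exprn_ile1.
have ks2 : `|k| ^+ 2 * `|sink x| ^+ 2 <= 1.
  by rewrite -exprMn exprn_ile1 // mulr_ge0.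
have sc : `|sink x| * `|cosk x| <= `|x|.
  by rewrite -[leRHS]mulr1 ler_pM.
rewrite /system_matrix; lazy zeta; move: c1 s1 sx es c2 ks2 sc.
move: (cosk x) (sink x) => c s c1 s1 sx es c2 ks2 sc.
have hD : `|c ^+ 2 * A x + s * c * residual_potential x - k ^+ 2 * s ^+ 2 * A x|
    <= system_bound x.
  apply: (le_trans (ler_normB _ _)); apply: (le_trans (lerD (ler_normD _ _) (lexx _))).
  rewrite !normrM -?expr2.
  have h1 : `|c| ^+ 2 * `|A x| <= `|A x| by rewrite ler_piMl.
  have h2 : `|k| ^+ 2 * `|s| ^+ 2 * `|A x| <= `|A x| by rewrite ler_piMl.
  have h3 : `|s| * `|c| * `|residual_potential x| <= (1 + `|x|) * `|residual_potential x|.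
    by rewrite ler_wpM2r //; lra.
  by rewrite /system_bound; lra.
case: i; case: j; first exact: hD.
- rewrite normrM gtr0_norm //.
  apply: (@le_trans _ _ (momentum_scale * (2 * `|s| * `|A x| + `|s| ^+ 2 * `|residual_potential x|))).
    apply: ler_wpM2l; first exact: ltW.
    apply: (le_trans (ler_normD _ _)).
    rewrite !normrM -?expr2 (ger0_norm (ler0n R 2)) lerD2r ler_wpM2r //.
    by rewrite ler_wpM2r // ler_piMr.
  have h1 : momentum_scale * `|s| * `|A x| <= (1 + `|x|) * `|A x| by rewrite ler_wpM2r.
  have h1' : (1 + `|x|) * `|A x| <= PA x by rewrite ler_wpM2r.
  have h2 : momentum_scale * `|s| * (`|s| * `|residual_potential x|) <= (1 + `|x|) * ((1 + `|x|) * `|residual_potential x|).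
    apply: ler_pM => //; rewrite ?mulr_ge0 //; first exact: ltW.
    by rewrite ler_wpM2r //; lra.
  have h3 : (1 + `|x|) * ((1 + `|x|) * `|residual_potential x|) = QG x by rewrite /QG expr2 mulrA.
  by rewrite /system_bound expr2; move: h1 h2; rewrite h3; lra.
- rewrite normrM normfV (gtr0_norm eta_gt0) ler_pdivrMr //.
  apply: (@le_trans _ _ (2 * `|k| * `|A x| + `|residual_potential x|)).
    apply: (le_trans (ler_normB _ _)); rewrite !normrM -?expr2; apply: lerD.
      rewrite ler_wpM2r // (ger0_norm (ler0n R 2)).
      have -> : 2 * `|k| ^+ 2 * `|s| * `|c| = 2 * `|k| * (`|k| * `|s| * `|c|) by ring.
      by rewrite ler_piMr ?mulr_ge0 // mulr_ile1 // mulr_ge0.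
    by rewrite ler_piMl.
  have kp : `|k| <= momentum_scale by rewrite /momentum_scale lerDl ltW.
  have h1 : 2 * `|k| * `|A x| <= 2 * PA x * momentum_scale.
    rewrite mulrAC; apply: ler_pM => //; by rewrite mulr_ge0.
  have h2 : `|residual_potential x| <= d^-1 * QG x * momentum_scale.
    have h : `|residual_potential x| <= QG x by apply: le_trans eG0; rewrite ler_peMl //; lra.
    rewrite mulrAC -[leLHS]mul1r; apply: ler_pM => //.
    by rewrite mulrC ler_pdivlMr // mul1r /momentum_scale lerDr.
  by rewrite /system_bound; lra.
- by rewrite normrN.
Qed.

Lemma system_bound_small : \int[mu]_(x in setT) system_bound x <= 8^-1.
Proof. by apply: (le_trans system_bound_int); move: d_le; lra. Qed.

(** [Y] inverts the change of coordinates, whose determinant is the constant [momentum_scale]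
    because [cosk^2 + k^2 sink^2 = 1]. *)
Lemma schrodinger_to_system v w :
  ac v (fun x => w x + A x * v x) ->
  ac w (fun x => - (k ^+ 2 + residual_potential x) * v x - A x * w x) ->
  let Y (i : bool) x := if i then cosk x * v x - sink x * w x
             else momentum_scale^-1 * (k ^+ 2 * sink x * v x + cosk x * w x) in
  forall i, ac (Y i) (linear_op system_matrix Y i).
Proof.
move=> acv acw Y; have e0 : momentum_scale != 0 by rewrite gt_eqF.
have cs x : k ^+ 2 * sink x ^+ 2 = 1 - cosk x ^+ 2 by rewrite -(cosk_sink x); ring.
have vY x : v x = cosk x * Y true x + momentum_scale * sink x * Y false x.
  have -> : cosk x * Y true x + momentum_scale * sink x * Y false x =
    (cosk x ^+ 2 + k ^+ 2 * sink x ^+ 2) * v x by rewrite /Y; field.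
  by rewrite cosk_sink mul1r.
have wY x : w x = - k ^+ 2 * sink x * Y true x + momentum_scale * cosk x * Y false x.
  have -> : - k ^+ 2 * sink x * Y true x + momentum_scale * cosk x * Y false x =
    (cosk x ^+ 2 + k ^+ 2 * sink x ^+ 2) * w x by rewrite /Y; field.
  by rewrite cosk_sink mul1r.
case.
  apply: ac_eq (acB (acM ac_cosk acv) (acM ac_sink acw)) _ _ => // x.
  transitivity (cosk x * A x * v x + sink x * residual_potential x * v x + sink x * A x * w x); first ring.
  by rewrite vY wY /linear_op /system_matrix; ring.
apply: ac_eq (acZ momentum_scale^-1 (acD (acM (acZ (k ^+ 2) ac_sink) acv) (acM ac_cosk acw))) _ _ => // x.
transitivity (momentum_scale^-1 * (k ^+ 2 * sink x * A x * v x - cosk x * residual_potential x * v x -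
  cosk x * A x * w x)); first ring.
by rewrite vY wY /linear_op /system_matrix; field.
Qed.

Lemma system_to_schrodinger (Y : bool -> R -> R) :
  (forall i, ac (Y i) (linear_op system_matrix Y i)) ->
  let v x := cosk x * Y true x + momentum_scale * sink x * Y false x in
  let w x := - k ^+ 2 * sink x * Y true x + momentum_scale * cosk x * Y false x in
  ac v (fun x => w x + A x * v x) /\
  ac w (fun x => - (k ^+ 2 + residual_potential x) * v x - A x * w x).
Proof.
move=> acY v w; have e0 : momentum_scale != 0 by rewrite gt_eqF.
have acYt := acY true; have acYf := acY false.
have one x : 1 = cosk x ^+ 2 + k ^+ 2 * sink x ^+ 2 by rewrite cosk_sink.
split.
  apply: ac_eq (acD (acM ac_cosk acYt) (acM (acZ momentum_scale ac_sink) acYf)) _ _ => // x.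
  have -> : w x + A x * v x = w x + (cosk x ^+ 2 + k ^+ 2 * sink x ^+ 2) * (A x * v x).
    by rewrite cosk_sink mul1r.
  by rewrite /v /w /linear_op /system_matrix; field.
apply: ac_eq (acD (acM (acZ (- k ^+ 2) ac_sink) acYt) (acM (acZ momentum_scale ac_cosk) acYf)) _ _ => // x.
have -> : - (k ^+ 2 + residual_potential x) * v x - A x * w x =
  - k ^+ 2 * v x - (cosk x ^+ 2 + k ^+ 2 * sink x ^+ 2) * (residual_potential x * v x + A x * w x).
  by rewrite cosk_sink mul1r; ring.
by rewrite /v /w /linear_op /system_matrix; field.
Qed.

Lemma solution_quasi v : schrodinger_solution_real U k v ->
  let w x := derive1 v x - A x * v x in
  ac v (fun x => w x + A x * v x) /\
  ac w (fun x => - (k ^+ 2 + residual_potential x) * v x - A x * w x).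
Proof.
move=> [dv acdv] w.
have acv' : ac (derive1 v) (fun x => (U x - k ^+ 2) * v x) by [].
have acv : ac v (derive1 v).
  apply: derivable_ac; first exact: ac_continuous acv'.
  by move=> x; rewrite derive1E; apply: DeriveDef => //; exact: dv.
split; first by apply: ac_eq acv _ _ => // x; rewrite /w subrK.
apply: ac_eq (acB acv' (acM (reg_ac reg) acv)) _ _ => // x.
by rewrite /w /residual_potential; ring.
Qed.

(** [w + A v] is continuous, so the almost everywhere derivative of [v] is a classical one; adding
    [(A v)'] to [w'] restores [U]. *)
Lemma quasi_solution v w :
  ac v (fun x => w x + A x * v x) ->
  ac w (fun x => - (k ^+ 2 + residual_potential x) * v x - A x * w x) ->
  schrodinger_solution_real U k v /\ derive1 v = (fun x => w x + A x * v x).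
Proof.
move=> acv acw.
have cv' : continuous (fun x => w x + A x * v x).
  by move=> x; apply: cvgD; [exact: (ac_continuous acw)|apply: cvgM; [exact: cA|
    exact: (ac_continuous acv)]].
have dv := ac_derive1 acv cv'; split=> //; split.
  by move=> x; have := ac_derivable acv cv' x; case.
rewrite dv; change (ac (fun x => w x + A x * v x) (fun x => (U x - k ^+ 2) * v x)).
apply: ac_eq (acD acw (acM (reg_ac reg) acv)) _ _ => // x.
by rewrite /residual_potential; ring.
Qed.

End Schrodinger.

(** * Real solutions: amplitudes at [+oo] and values at 0 *)

Lemma eq_cvgy (f g : R -> R) (l : R) : f =1 g -> f x @[x --> +oo] --> l ->
  g x @[x --> +oo] --> l.
Proof. by move=> /funext ->. Qed.

Lemma cvgy0D (f g : R -> R) : f x @[x --> +oo] --> (0 : R) ->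
  g x @[x --> +oo] --> (0 : R) -> f x + g x @[x --> +oo] --> (0 : R).
Proof. by move=> f0 g0; rewrite -[X in _ --> X]addr0; exact: cvgD. Qed.

Lemma cvgy0B (f g : R -> R) : f x @[x --> +oo] --> (0 : R) ->
  g x @[x --> +oo] --> (0 : R) -> f x - g x @[x --> +oo] --> (0 : R).
Proof. by move=> f0 g0; rewrite -[X in _ --> X]subr0; exact: cvgB. Qed.

(** Let [g] be the given wave. A shift by the quarter period [h] turns it into [- p sin + r cos].
    Hence [p = cos(kx) g(x) - sin(kx) g(x + h)] and [r = sin(kx) g(x) + cos(kx) g(x + h)] are
    constants which tend to 0. *)
Lemma oscillation_lim0 k p r : k != 0 ->
  p * cos (k * x) + r * sin (k * x) @[x --> +oo] --> (0 : R) -> p = 0 /\ r = 0.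
Proof.
move=> k0 g0; pose g x := p * cos (k * x) + r * sin (k * x).
pose h := pi / 2 / k.
have gh : g (x + h) @[x --> +oo] --> (0 : R).
  apply: (cvg_comp _ _ _ g0); apply/cvgryPge => B.
  near=> x; rewrite -lerBlDr; near: x; exact: nbhs_pinfty_ge (num_real _).
have ghE x : g (x + h) = - p * sin (k * x) + r * cos (k * x).
  rewrite /g; have -> : k * (x + h) = k * x + pi / 2 by rewrite /h; field.
  by rewrite cosDpihalf sinDpihalf; ring.
have bcs (u : R -> R) : (forall x, `|u x| <= 1) -> forall f : R -> R,
    f x @[x --> +oo] --> (0 : R) -> u x * f x @[x --> +oo] --> (0 : R).
  move=> u1 f f0; apply/cvgr0Pnorm_le => e e0.
  move/cvgr0Pnorm_le : f0 => /(_ e e0); apply: filterS => x fx.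
  by rewrite normrM; apply: le_trans fx; rewrite ler_piMl.
have c1 x : `|cos (k * x)| <= 1 by exact: cos_max.
have s1 x : `|sin (k * x)| <= 1 by exact: sin_max.
split.
  have H : (cst p : R -> R) x @[x --> +oo] --> (0 : R).
    apply: eq_cvgy (cvgy0B (bcs _ c1 _ g0) (bcs _ s1 _ gh)) => x /=.
    rewrite ghE -[RHS]mulr1 -(cos2Dsin2 (k * x)); ring.
  by apply: (cvg_unique _ (cvg_cst p) H).
have H : (cst r : R -> R) x @[x --> +oo] --> (0 : R).
  apply: eq_cvgy (cvgy0D (bcs _ s1 _ g0) (bcs _ c1 _ gh)) => x /=.
  rewrite ghE -[RHS]mulr1 -(cos2Dsin2 (k * x)); ring.
by apply: (cvg_unique _ (cvg_cst r) H).
Unshelve. all: by end_near. Qed.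

(** The pointwise estimate behind [real_jost_estimate]: [al] and [be] stand for [Y true x] and
    [momentum_scale * Y false x], and [X] for [|x|]. The factor [a - c^2 al] is small because it
    equals [a k^2 s^2 - c^2 (al - a)], where [k^2 s^2 <= |k| X]. *)
Lemma remainder_bound (a k d B X c s be al Ax Gx : R) : 0 <= d -> 0 <= X -> 0 <= B ->
  `|a| <= 1 -> `|al - a| <= 16 * d -> `|al| <= 2 -> `|be| <= B -> `|s| <= X ->
  `|k| * `|s| <= 1 -> `|c| <= 1 -> c ^+ 2 + k ^+ 2 * s ^+ 2 = 1 ->
  `|Gx * (a - c ^+ 2 * al) + 2 * k ^+ 2 * s * c * Ax * al -
   (c ^+ 2 * Ax + s * c * Gx - k ^+ 2 * s ^+ 2 * Ax) * be| <=
 (4 * `|k| + 2 * B) * ((1 + X) ^+ 2 * `|Ax|) +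
 (16 * d + `|k| + B) * ((1 + X) ^+ 2 * `|Gx|).
Proof.
move=> d0 X0 B0 a1 al_a al2 beB sx ks1 c1 cs.
have W : 1 + X <= (1 + X) ^+ 2 by rewrite expr2 ler_peMl ?addr_ge0 // lerDl.
have c2 : `|c ^+ 2| <= 1 by rewrite normrX exprn_ile1.
have ks2 : `|k ^+ 2 * s ^+ 2| <= `|k| * X.
  rewrite -exprMn normrX normrM expr2; apply: (@le_trans _ _ (1 * (`|k| * X))).
    by apply: ler_pM; rewrite ?mulr_ge0 // ler_wpM2l.
  by rewrite mul1r.
have ks2' : `|k ^+ 2 * s ^+ 2| <= 1.
  by rewrite -exprMn normrX normrM exprn_ile1 // mulr_ge0.
have sc : `|s * c| <= X by rewrite normrM -[leRHS]mulr1 ler_pM.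
have h1 : `|Gx * (a - c ^+ 2 * al)| <= (16 * d + `|k|) * ((1 + X) ^+ 2 * `|Gx|).
  have -> : a - c ^+ 2 * al = a * (k ^+ 2 * s ^+ 2) - c ^+ 2 * (al - a).
    have -> : k ^+ 2 * s ^+ 2 = 1 - c ^+ 2 by rewrite -cs; ring.
    by ring.
  rewrite normrM [leLHS]mulrC [leRHS]mulrA; apply: ler_wpM2r => //.
  apply: (le_trans (ler_normB _ _)).
  have e1 : `|a * (k ^+ 2 * s ^+ 2)| <= `|k| * X.
    by rewrite [leLHS]normrM -[leRHS]mul1r ler_pM.
  have e2 : `|c ^+ 2 * (al - a)| <= 16 * d.
    by rewrite [leLHS]normrM -[leRHS]mul1r ler_pM.
  have e3 : `|k| * X <= `|k| * (1 + X) ^+ 2 by rewrite ler_wpM2l //; lra.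
  have e4 : 16 * d <= 16 * d * (1 + X) ^+ 2.
    by rewrite ler_peMr //; lra.
  by rewrite mulrDl; lra.
have h2 : `|2 * k ^+ 2 * s * c * Ax * al| <= 4 * `|k| * ((1 + X) ^+ 2 * `|Ax|).
  have -> : 2 * k ^+ 2 * s * c * Ax * al = (2 * k * al) * ((k * s * c) * Ax) by ring.
  rewrite normrM; apply: ler_pM => //.
    rewrite !normrM (ger0_norm (ler0n R 2)).
    have -> : 4 * `|k| = 2 * `|k| * 2 by ring.
    by rewrite ler_wpM2l // mulr_ge0.
  rewrite normrM; apply: ler_wpM2r => //; apply: (@le_trans _ _ 1); last lra.
  by rewrite normrM normrM mulr_ile1 // mulr_ge0.
have h3 : `|(c ^+ 2 * Ax + s * c * Gx - k ^+ 2 * s ^+ 2 * Ax) * be| <=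
    2 * B * ((1 + X) ^+ 2 * `|Ax|) + B * ((1 + X) ^+ 2 * `|Gx|).
  rewrite normrM.
  apply: (@le_trans _ _ ((2 * ((1 + X) ^+ 2 * `|Ax|) + (1 + X) ^+ 2 * `|Gx|) * B)); last by lra.
  apply: ler_pM => //.
  apply: (le_trans (ler_normB _ _)); apply: (le_trans (lerD (ler_normD _ _) (lexx _))).
  rewrite [`|c ^+ 2 * Ax|]normrM [`|s * c * Gx|]normrM [`|k ^+ 2 * s ^+ 2 * Ax|]normrM.
  have e1 : `|c ^+ 2| * `|Ax| <= (1 + X) ^+ 2 * `|Ax| by rewrite ler_wpM2r //; lra.
  have e2 : `|s * c| * `|Gx| <= (1 + X) ^+ 2 * `|Gx| by rewrite ler_wpM2r //; lra.
  have e3 : `|k ^+ 2 * s ^+ 2| * `|Ax| <= (1 + X) ^+ 2 * `|Ax| by rewrite ler_wpM2r //; lra.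
  by lra.
apply: (le_trans (ler_normB _ _)); apply: (le_trans (lerD (ler_normD _ _) (lexx _))).
by move: h1 h2 h3; lra.
Qed.

(** The terms without [K = |k|] are of order [d^3]: they pair [16 d] with [IQ = O(d^2)], or the part
    [16 d^2] of [B] with [IP = O(d)]. All others carry [d K]. *)
Lemma final_bound (d K IP IQ B : R) : B = (1 + 16 * d) * K + 16 * d ^+ 2 -> 0 <= d -> d <= 32^-1 -> 0 <= K -> IP <= d ->
  IQ <= 2 * d ^+ 2 ->
  (4 * K + 2 * B) * IP + (16 * d + K + B) * IQ <= 100 * (d ^+ 3 + d * K).
Proof.
move=> BE d0 dle K0 iP iQ.
have B0 : 0 <= B.
  by rewrite BE addr_ge0 // mulr_ge0 ?sqr_ge0 // addr_ge0 // mulr_ge0.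
have C1 : 0 <= 4 * K + 2 * B by rewrite addr_ge0 // mulr_ge0.
have C2 : 0 <= 16 * d + K + B by rewrite addr_ge0 // addr_ge0 // mulr_ge0.
have h1 := ler_wpM2l C1 iP; have h2 := ler_wpM2l C2 iQ.
apply: (le_trans (lerD h1 h2)); rewrite BE.
have dk : 0 <= d * K by rewrite mulr_ge0.
have ddk : d * (d * K) <= 32^-1 * (d * K) by rewrite ler_wpM2r.
have dddk : d * (d * (d * K)) <= 32^-1 * (d * K).
  apply: le_trans ddk; rewrite ler_piMl ?mulr_ge0 //.
  by apply: (le_trans dle); lra.
have d3 : 0 <= d ^+ 3 by rewrite exprn_ge0.
have d4 : d * d ^+ 3 <= 32^-1 * d ^+ 3 by rewrite ler_wpM2r.
clear -dk ddk dddk d3 d4; move: ddk dddk d3 d4; rewrite !expr2 !exprS expr0 mulr1; lra.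
Qed.

Section RealJost.
Variables (U A E : R -> R) (d k : R).
Hypothesis reg : regularized U A E d.
Hypothesis d_gt0 : 0 < d.
Hypothesis d_le : d <= 32^-1.
Hypothesis k_neq0 : k != 0.

Let M := system_matrix A E d k.
Let mM := system_matrix_measurable reg k_neq0.
Let Mk := system_matrix_le A E d_gt0 d_le k_neq0.
Let jk := system_bound_L1 reg.
Let ks := system_bound_small reg d_gt0 d_le.
Let e0 : 0 < momentum_scale d k. Proof. by rewrite /momentum_scale ltr_wpDl. Qed.

(** The bound involves [momentum_scale / |k|] and is not uniform in [k]; it serves only to identify
    the limits of the coordinates at fixed [k]. *)
Let small_wave (l : bool -> R) (Y : bool -> R -> R) :
  (forall i, Y i x @[x --> +oo] --> l i) ->
  (cosk k x * Y true x + momentum_scale d k * sink k x * Y false x)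
  - (l true * cosk k x + momentum_scale d k * l false * sink k x) @[x --> +oo] --> (0 : R).
Proof.
move=> Yl.
have h i : Y i x - l i @[x --> +oo] --> (0 : R).
  by rewrite -(subrr (l i)); apply: cvgB => //; exact: cvg_cst.
have K0 : 0 < 1 + momentum_scale d k / `|k|.
  by apply: ltr_pwDl; rewrite ?ltr01 // divr_ge0 // ltW.
apply/cvgr0Pnorm_le => e e_gt0.
have e'0 : 0 < e / (1 + momentum_scale d k / `|k|) by rewrite divr_gt0.
have /cvgr0Pnorm_le /(_ _ e'0) := h true; have /cvgr0Pnorm_le /(_ _ e'0) := h false.
apply: filterS2 => x hf ht.
have -> : cosk k x * Y true x + momentum_scale d k * sink k x * Y false x
  - (l true * cosk k x + momentum_scale d k * l false * sink k x) =
  cosk k x * (Y true x - l true) + momentum_scale d k * sink k x * (Y false x - l false) by ring.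
apply: (le_trans (ler_normD _ _)); rewrite [`|_ * _|]normrM [`|_ * (_ - _)|]normrM.
have c1 := cosk_le1 k x; have s1 := ksink_le1 k_neq0 x.
have es : `|momentum_scale d k * sink k x| <= momentum_scale d k / `|k|.
  rewrite ler_pdivlMr ?normr_gt0 // [`|_ * _|]normrM gtr0_norm // -mulrA.
  by rewrite (mulrC `|sink k x|) ler_piMr // ltW.
have h1 := ler_pM (normr_ge0 _) (normr_ge0 _) c1 ht.
have h2 := ler_pM (normr_ge0 _) (normr_ge0 _) es hf.
apply: (le_trans (lerD h1 h2)); rewrite -mulrDl mulrC divfK //.
by rewrite gt_eqF.
Qed.

Lemma real_jost_exists a b : exists v, schrodinger_solution_real U k v /\
  v x - (a * cosk k x + b * sink k x) @[x --> +oo] --> (0 : R).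
Proof.
have [Y HY] := linear_system_solution mM Mk jk ks
  (fun i : bool => if i then a else b / momentum_scale d k).
have [acv acw] := system_to_schrodinger d_gt0 k_neq0 (fun i => (HY i).1).
have [sv _] := quasi_solution reg acv acw.
eexists; split; first exact: sv.
have := small_wave (fun i => (HY i).2).
by rewrite (_ : momentum_scale d k * (b / momentum_scale d k) = b) // mulrC divfK // gt_eqF.
Qed.

(** The normalization [|a| + |b| / momentum_scale <= 1] gives [|Y| <= 2], so the coordinates differ
    from their limits by at most [2 * 2 * 4 d = 16 d]. Inserting this once more in the integral
    equation for [Y false] at 0, where [momentum_scale * Y false] is the quasi-derivative, isolates
    the main term [a] times the integral of [A^2 - E]. *)
Lemma real_jost_estimate a b v : schrodinger_solution_real U k v ->
  v x - (a * cosk k x + b * sink k x) @[x --> +oo] --> (0 : R) ->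
  `|a| <= 1 -> `|b| <= `|k| -> `|a| + `|b| / momentum_scale d k <= 1 ->
  `|v 0 - a| <= 16 * d /\
  `|derive1 v 0 - A 0 * v 0 - b
    - a * \int[mu]_(x in `[0, +oo[) (A x ^+ 2 - E x)| <= 100 * (d ^+ 3 + d * `|k|).
Proof.
move=> sv vlim a1 bk ab.
have [acv acw] := solution_quasi reg sv.
have acY := schrodinger_to_system d_gt0 k_neq0 acv acw.
set w := fun x => derive1 v x - A x * v x in acv acw acY *.
set Y := fun (i : bool) x => _ in acY.
have [l Yl] := linear_system_cvg mM Mk jk ks acY.
have vY x : v x = cosk k x * Y true x + momentum_scale d k * sink k x * Y false x.
  have -> : cosk k x * Y true x + momentum_scale d k * sink k x * Y false x =
    (cosk k x ^+ 2 + k ^+ 2 * sink k x ^+ 2) * v x.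
    by rewrite /Y; field; rewrite gt_eqF.
  by rewrite cosk_sink // mul1r.
(* Waves with the same asymptotics have the same amplitudes, so the coordinates tend to [a] and
   [b / momentum_scale]. *)
have [l1 l2] : l true - a = 0 /\ (momentum_scale d k * l false - b) / k = 0.
  apply: (oscillation_lim0 k_neq0).
  apply: eq_cvgy (cvgy0B vlim (small_wave Yl)) => x /=.
  by rewrite -vY /cosk /sink; field.
have lt : l true = a by apply/eqP; rewrite -subr_eq0 l1.
have lf : momentum_scale d k * l false = b.
  apply/eqP; rewrite -subr_eq0; move/eqP: l2; rewrite mulf_eq0 invr_eq0 (negbTE k_neq0).
  by rewrite orbF.
have lfE : l false = b / momentum_scale d k by rewrite -lf mulrAC divff ?mul1r // gt_eqF.
have YB i x : `|Y i x| <= 2.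
  apply: (le_trans (linear_system_bound mM Mk jk ks acY Yl i x)).
  by rewrite lt lfE normrM normfV (gtr0_norm e0) -[leRHS]mulr1 ler_wpM2l.
have mY i := ac_measurable (acY i).
have kd := system_bound_int reg d_gt0.
have dev i x : `|Y i x - l i| <= 16 * d.
  rewrite (linear_system_tail mM Mk jk ks acY Yl i x) addrAC subrr add0r normrN.
  apply: (le_trans (linear_op_int_le mM Mk jk i (@measurable_itv _ _) mY (fun j t _ => YB j t) _)) => //.
  by move: kd; lra.
have v0 : v 0 = Y true 0.
  by rewrite vY /cosk /sink mulr0 cos0 sin0 mul0r mulr0 mul0r addr0 mul1r.
have w0 : w 0 = momentum_scale d k * Y false 0.
  by rewrite /w /Y /cosk /sink mulr0 cos0 sin0; field; rewrite ?k_neq0 gt_eqF.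
split; first by rewrite v0 -lt.
have jG : L1 setT (residual_potential A E).
  apply: (L1_dominated _ _ (QG_L1 reg)) => //.
    apply: measurable_funB; last exact: reg_E_meas reg.
    by apply: measurable_funX; exact: ac_measurable (reg_ac reg).
  move=> x _; rewrite ler_peMl // -[leLHS](expr1n _ 2) lerXn2r ?nnegrE ?addr_ge0 //.
  by rewrite lerDl.
pose rem x := a * residual_potential A E x + momentum_scale d k * linear_op M Y false x.
have jL : L1 setT (linear_op M Y false) := linear_system_L1 mM Mk jk ks acY false.
have -> : derive1 v 0 - A 0 * v 0 - b - a * \int[mu]_(x in `[0, +oo[) (A x ^+ 2 - E x)
    = - \int[mu]_(x in `[0, +oo[) rem x.
  change (w 0 - b - a * \int[mu]_(x in `[0, +oo[) (residual_potential A E x) = - \int[mu]_(x in `[0, +oo[) rem x).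
  rewrite w0 (linear_system_tail mM Mk jk ks acY Yl) mulrBr lf /rem.
  have jGr := L1_setT_ray 0 jG; have jLr := L1_setT_ray 0 jL.
  have mr : measurable (`[0%R, +oo[%classic : set mR) by exact: measurable_itv.
  rewrite (RintegralD mr (L1Z a mr jGr) (L1Z (momentum_scale d k) mr jLr)).
  rewrite (RintegralZl a mr jGr) (RintegralZl (momentum_scale d k) mr jLr).
  by rewrite -/M; ring.
rewrite normrN.
(* [B] is [|k|], a bound on [|b|], plus [momentum_scale] times the deviation [16 d] of [Y false]. *)
pose B := (1 + 16 * d) * `|k| + 16 * d ^+ 2.
pose PA x := (1 + `|x|) ^+ 2 * `|A x|; pose QG x := (1 + `|x|) ^+ 2 * `|residual_potential A E x|.
have bet x : `|momentum_scale d k * Y false x| <= B.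
  have -> : momentum_scale d k * Y false x = b + momentum_scale d k * (Y false x - l false).
    by rewrite mulrBr lf subrKC.
  apply: (le_trans (ler_normD _ _)); rewrite normrM (gtr0_norm e0).
  have := ler_wpM2l (ltW e0) (dev false x).
  by rewrite /B /momentum_scale; move: bk; lra.
have remE x : rem x = residual_potential A E x * (a - cosk k x ^+ 2 * Y true x)
   + 2 * k ^+ 2 * sink k x * cosk k x * A x * Y true x
   - (cosk k x ^+ 2 * A x + sink k x * cosk k x * residual_potential A E x - k ^+ 2 * sink k x ^+ 2 * A x)
     * (momentum_scale d k * Y false x).
  by rewrite /rem /linear_op /M /system_matrix; field; rewrite gt_eqF.
have remB x : `|rem x| <= (4 * `|k| + 2 * B) * PA x + (16 * d + `|k| + B) * QG x.
  rewrite remE.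
  have := cosk_sink k_neq0 x; have := cosk_le1 k x; have := ksink_le1 k_neq0 x.
  have := sink_le k_neq0 x; have := bet x; have := YB true x; have := dev true x.
  rewrite lt /PA /QG.
  move: (cosk k x) (sink k x) (momentum_scale d k * Y false x) (Y true x) (A x) (residual_potential A E x).
  move=> c s be al Ax Gx al_a al2 beB sx ks1 c1 cs.
  have B0 : 0 <= B := le_trans (normr_ge0 _) beB.
  exact: (remainder_bound _ _ (ltW d_gt0) (normr_ge0 x) B0 a1 al_a al2 beB sx ks1 c1 cs).
have jP := reg_A_L1 reg; have jQ := QG_L1 reg.
have B0 : 0 <= B by apply: le_trans (bet 0).
apply: (@le_trans _ _ (\int[mu]_(x in setT)
    ((4 * `|k| + 2 * B) * PA x + (16 * d + `|k| + B) * QG x))).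
  apply: norm_Rintegral_sub => //.
  - apply: measurable_funTS; apply: measurable_funD.
      by apply: measurable_funM; [exact: measurable_cst|exact: L1_measurable jG].
    by apply: measurable_funM; [exact: measurable_cst|exact: L1_measurable jL].
  - by apply: L1D => //; exact: L1Z.
  - by move=> x _; exact: le_trans (remB x).
rewrite RintegralD //; [|exact: L1Z..].
rewrite !RintegralZl //.
exact: (final_bound (erefl B) (ltW d_gt0) d_le (normr_ge0 k) (reg_A_int reg) (QG_int reg d_gt0)).
Qed.

End RealJost.

(** * Jost solutions and transmission coefficients *)

Local Notation normc := Normc.normc.

Lemma normc_le (z : R[i]) : normc z <= `|complex.Re z| + `|complex.Im z|.
Proof.
case: z => a b /=; rewrite -[leRHS]ger0_norm ?addr_ge0 // -sqrtr_sqr.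
rewrite ler_wsqrtr // sqrrD !real_normK ?num_real //.
have : 0 <= `|a| * `|b| *+ 2 by rewrite mulrn_wge0 // mulr_ge0.
by lra.
Qed.

Lemma norm_Re_le (z : R[i]) : `|complex.Re z| <= normc z.
Proof. by case: z => a b /=; rewrite -sqrtr_sqr ler_wsqrtr // lerDl sqr_ge0. Qed.

Lemma norm_Im_le (z : R[i]) : `|complex.Im z| <= normc z.
Proof. by case: z => a b /=; rewrite -sqrtr_sqr ler_wsqrtr // lerDr sqr_ge0. Qed.

Lemma normc_ge0 (z : R[i]) : 0 <= normc z.
Proof. by case: z => a b; exact: sqrtr_ge0. Qed.

Lemma normc_eq0 (z : R[i]) : (normc z == 0) = (z == 0).
Proof.
apply/eqP/eqP => [/Normc.eq0_normc//|->].
exact: Normc.normc0.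
Qed.

Lemma normr_complexE (z : R[i]) : `|z| = (normc z)%:C%C.
Proof. by case: z. Qed.

Lemma ltc_real (a : R) (e : R[i]) : 0 < e -> (a%:C%C < e) = (a < complex.Re e).
Proof.
by case: e => e1 e2; rewrite !ltcE /= => /andP[/eqP -> _]; rewrite eqxx.
Qed.

(** The norm of [R[i]] takes its values in [R[i]]; this passes to the real-valued [normc], so that
    estimates can be carried out in [R]. *)
Lemma cvg_complex0 (T : Type) (F : set_system T) {FF : Filter F} (f : T -> R[i]^o) :
  f @ F --> (0 : R[i]^o) <-> (normc (f x) @[x --> F] --> (0 : R)).
Proof.
split=> [/cvgr0Pnorm_lt H|/cvgr0Pnorm_lt H].
  apply/cvgr0Pnorm_lt => e e0; have e0' : 0 < (e%:C%C : R[i]) by rewrite ltcR.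
  apply: filterS (H _ e0') => x; rewrite [X in X < _ -> _]normr_complexE ltcR.
  by rewrite ger0_norm // normc_ge0.
apply/cvgr0Pnorm_lt => e e0; have e0' : 0 < complex.Re e.
  by have := e0; rewrite ltcE => /andP[].
apply: filterS (H _ e0') => x; rewrite ger0_norm ?normc_ge0 // => fx.
by rewrite [X in X < _]normr_complexE ltc_real.
Qed.

Lemma normc_Cexpi (t : R) : normc (Cexpi t) = 1.
Proof. by rewrite /= cos2Dsin2 sqrtr1. Qed.

Lemma Cexpi_neq0 (t : R) : Cexpi t != 0.
Proof. by rewrite -normc_eq0 normc_Cexpi oner_neq0. Qed.

(** As [Cexpi (k * x)] has modulus 1, the quotient tends to 1 exactly when the difference tends to
    0, and the difference splits into real and imaginary parts. *)
Lemma jost_limit k (f : R -> R[i]) :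
  ((f x / Cexpi (k * x) : R[i]^o) @[x --> +oo] --> (1 : R[i]^o)) <->
  (complex.Re (f x) - cos (k * x) @[x --> +oo] --> (0 : R)) /\
  (complex.Im (f x) - sin (k * x) @[x --> +oo] --> (0 : R)).
Proof.
pose g x := f x - Cexpi (k * x).
have H1 : ((f x / Cexpi (k * x) : R[i]^o) @[x --> +oo] --> (1 : R[i]^o)) <->
    (normc (g x) @[x --> +oo] --> (0 : R)).
  have -> : (fun x => normc (g x)) = (fun x => normc (f x / Cexpi (k * x) - 1)).
    apply/funext => x; rewrite -[RHS]mulr1 -(normc_Cexpi (k * x)) -Normc.normcM; congr normc.
    by rewrite mulrBl divfK ?Cexpi_neq0 // mul1r.
  rewrite -(cvg_complex0 (fun x => f x / Cexpi (k * x) - 1)).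
  by apply: iff_sym; exact: (@subr_cvg0 _ R[i]^o).
rewrite H1; have gE x : g x = ((complex.Re (f x) - cos (k * x)) +i*
    (complex.Im (f x) - sin (k * x)))%C by rewrite /g; case: (f x).
split=> [/cvgr0Pnorm_le H|[/cvgr0Pnorm_le Hr /cvgr0Pnorm_le Hi]].
  split; apply/cvgr0Pnorm_le => e e0; apply: filterS (H e e0) => x;
    rewrite ger0_norm ?normc_ge0 //; apply: le_trans; rewrite gE.
    exact: (norm_Re_le ((complex.Re (f x) - cos (k * x)) +i* _)%C).
  exact: (norm_Im_le (_ +i* (complex.Im (f x) - sin (k * x)))%C).
apply/cvgr0Pnorm_le => e e0; have e20 : 0 < e / 2 by rewrite divr_gt0.
apply: filterS2 (Hr _ e20) (Hi _ e20) => x h1 h2.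
rewrite ger0_norm ?normc_ge0 // gE; apply: (le_trans (normc_le _)) => /=; lra.
Qed.

Lemma schrodinger_real_reflect U k v : schrodinger_solution_real U k v ->
  schrodinger_solution_real (fun x => U (- x)) k (fun x => v (- x)) /\
  forall x, derive1 (fun x => v (- x)) x = - derive1 v (- x).
Proof.
move=> [dv acv].
have acv' : ac (derive1 v) (fun x => (U x - k ^+ 2) * v x) by [].
have dvx x : is_derive x (1 : R) v (derive1 v x).
  by rewrite derive1E; apply: DeriveDef => //; exact: dv.
have acvv : ac v (derive1 v) by apply: derivable_ac; exact: ac_continuous acv'.
have acr := ac_reflect acvv.
have cr : continuous (fun x => - derive1 v (- x)).
  have := acZ (-1) (ac_reflect acv') => /ac_continuous H x.
  by have := H x; under eq_fun do rewrite mulN1r.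
have dE := ac_derive1 acr cr.
split; last by move=> x; rewrite dE.
split; first by move=> x; have := ac_derivable acr cr x; case.
rewrite dE.
change (ac (fun x => - derive1 v (- x)) (fun x => (U (- x) - k ^+ 2) * v (- x))).
apply: ac_eq (acZ (-1) (ac_reflect acv')) _ _ => x; first by rewrite mulN1r.
by ring.
Qed.

Lemma jost_minus_reflect U k (f : R -> R[i]) : is_jost_minus U k f ->
  is_jost_plus (fun x => U (- x)) k (fun x => f (- x)).
Proof.
move=> [[sr si] lim]; split.
  by split; [exact: (schrodinger_real_reflect sr).1|exact: (schrodinger_real_reflect si).1].
move/cvgNy_compNP : lim; rewrite /comp /=.
by under eq_fun do rewrite mulrN opprK.
Qed.

Lemma jost_plus_reflect U k (f : R -> R[i]) : is_jost_plus (fun x => U (- x)) k f ->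
  is_jost_minus U k (fun x => f (- x)).
Proof.
move=> [[sr si] lim].
have UE : (fun x => U (- - x)) = U by apply/funext => x; rewrite opprK.
split.
  by split; [have := (schrodinger_real_reflect sr).1|have := (schrodinger_real_reflect si).1];
    rewrite UE.
apply/cvgNy_compNP; rewrite /comp /=.
by under eq_fun do rewrite opprK mulrN opprK.
Qed.

(** The sign of [- A (- x)] is forced by [A' = U - E]. It leaves [A^2] unchanged but reverses [A 0],
    whence the cancellation in [wronskian_estimate]. *)
Lemma regularized_reflect (U A E : R -> R) (d : R) : regularized U A E d ->
  regularized (fun x => U (- x)) (fun x => - A (- x)) (fun x => E (- x)) d.
Proof.
move=> reg.
have wr (f : R -> R) : mfun f -> L1 setT (fun x => (1 + `|x|) ^+ 2 * `|f x|) ->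
    L1 setT (fun x => (1 + `|x|) ^+ 2 * `|f (- x)|) /\
    \int[mu]_(x in setT) ((1 + `|x|) ^+ 2 * `|f (- x)|) =
    \int[mu]_(x in setT) ((1 + `|x|) ^+ 2 * `|f x|).
  move=> mf jf; have mg : mfun (fun x => (1 + `|x|) ^+ 2 * `|f x|).
    by apply: measurable_funM; [exact: measurable_weight|exact: measurable_norm_fun].
  have := L1_reflect (@measurableT _ mR) mg jf.
  have := Rintegral_reflect (@measurableT _ mR) mg jf.
  rewrite preimage_setT => H1 H2; split.
    by apply: L1_eq H2 => // x _; rewrite normrN.
  by rewrite -H1; apply: eq_Rintegral => x _; rewrite normrN.
have mA := ac_measurable (reg_ac reg).
have [A1 A2] := wr _ mA (reg_A_L1 reg).
have [E1 E2] := wr _ (reg_E_meas reg) (reg_E_L1 reg).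
constructor.
- apply: ac_eq (acZ (-1) (ac_reflect (reg_ac reg))) _ _ => x; first by rewrite mulN1r.
  by ring.
- by move=> x; rewrite normrN; exact: reg_bound reg _.
- by under eq_fun do rewrite normrN.
- by under eq_Rintegral do rewrite normrN; rewrite A2; exact: reg_A_int reg.
- exact: measurableT_comp (reg_E_meas reg) (@oppr_measurable R setT).
- exact: E1.
- by rewrite E2; exact: reg_E_int reg.
Qed.

Section JostEstimates.
Variables (U A E : R -> R) (d k : R).
Hypothesis reg : regularized U A E d.
Hypothesis d_gt0 : 0 < d.
Hypothesis d_le : d <= 32^-1.
Hypothesis k_neq0 : k != 0.

Lemma jost_plus_exists : exists f : R -> R[i], is_jost_plus U k f.
Proof.
have [v [sv lv]] := real_jost_exists reg d_gt0 d_le k_neq0 1 0.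
have [w [sw lw]] := real_jost_exists reg d_gt0 d_le k_neq0 0 k.
exists (fun x => (v x +i* w x)%C); split; first by split.
apply/jost_limit; split => /=.
  by apply: eq_cvgy lv => x; rewrite /cosk; ring.
by apply: eq_cvgy lw => x; rewrite /sink; field.
Qed.

(** Since [e^(ikx) = cosk + i k sink], the real part has amplitudes [(1, 0)] and the imaginary part
    [(0, k)]; hence [I] shows up only in the real part. *)
Lemma jost_plus_estimate (f : R -> R[i]) : is_jost_plus U k f ->
  let e := 100 * (d ^+ 3 + d * `|k|) in
  let I := \int[mu]_(x in `[0, +oo[) (A x ^+ 2 - E x) in
  [/\ `|complex.Re (f 0) - 1| <= 16 * d, `|complex.Im (f 0)| <= 16 * d,
    `|complex.Re (Cderive f 0) - A 0 * complex.Re (f 0) - I| <= e &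
    `|complex.Im (Cderive f 0) - A 0 * complex.Im (f 0) - k| <= e].
Proof.
move=> [[sr si] /jost_limit[lr li]] e I.
have ek : `|k| <= momentum_scale d k by rewrite /momentum_scale lerDl ltW.
have e0 : 0 < momentum_scale d k by rewrite /momentum_scale ltr_wpDl.
have lr' : complex.Re (f x) - (1 * cosk k x + 0 * sink k x) @[x --> +oo] --> (0 : R).
  by apply: eq_cvgy lr => x; rewrite /cosk; ring.
have li' : complex.Im (f x) - (0 * cosk k x + k * sink k x) @[x --> +oo] --> (0 : R).
  by apply: eq_cvgy li => x; rewrite /sink; field.
have [h1 h2] := real_jost_estimate reg d_gt0 d_le k_neq0 sr lr'
  ltac:(by rewrite normr1) ltac:(by rewrite normr0) ltac:(by rewrite normr1 normr0 mul0r addr0).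
have [h3 h4] := real_jost_estimate reg d_gt0 d_le k_neq0 si li'
  ltac:(by rewrite normr0) (lexx _) ltac:(by rewrite normr0 add0r ler_pdivrMr // mul1r).
split => //.
- by rewrite -[complex.Im _]subr0.
- by move: h2; rewrite subr0 mul1r.
- by move: h4; rewrite mul0r subr0.
Qed.

End JostEstimates.

Lemma Cderive_reflect U k (f : R -> R[i]) : is_jost_plus U k f ->
  Cderive (fun x => f (- x)) 0 = - Cderive f 0.
Proof.
move=> [[sr si] _]; rewrite /Cderive (schrodinger_real_reflect sr).2.
by rewrite (schrodinger_real_reflect si).2 oppr0.
Qed.

(* A product of the form p z + r w, as in the Wronskian, with p and r close
   to 1 in R[i] and with z = z1 + i z2 close to i k. *)
Lemma product_estimate (d e k I p1 p2 z1 z2 : R) : 0 <= d -> d <= 32^-1 -> 0 <= e ->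
  e = 100 * (d ^+ 3 + d * `|k|) ->
  `|I| <= 2 * d ^+ 2 -> `|p1 - 1| <= 16 * d -> `|p2| <= 16 * d ->
  `|z1 - I| <= e -> `|z2 - k| <= e ->
  `|(p1 * z1 - p2 * z2) - I| <= 3 * e /\ `|(p1 * z2 + p2 * z1) - k| <= 3 * e.
Proof.
move=> d0 dle e0 eE hI hp1 hp2 hz1 hz2.
have k0 := normr_ge0 k; have dk : 0 <= d * `|k| by rewrite mulr_ge0.
have d3 : 0 <= d ^+ 3 by rewrite exprn_ge0.
have de : d * e <= 32^-1 * e by rewrite ler_wpM2r.
have z1b : `|z1| <= 2 * d ^+ 2 + e.
  by rewrite -(subrK I z1); apply: (le_trans (ler_normD _ _)); lra.
have z2b : `|z2| <= `|k| + e.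
  by rewrite -(subrK k z2); apply: (le_trans (ler_normD _ _)); lra.
have dz1 : 16 * d * (2 * d ^+ 2 + e) <= e.
  have -> : 16 * d * (2 * d ^+ 2 + e) = 32 * d ^+ 3 + 16 * (d * e) by ring.
  by clear -de eE d3 dk; lra.
have dz2 : 16 * d * (`|k| + e) <= e.
  have -> : 16 * d * (`|k| + e) = 16 * (d * `|k|) + 16 * (d * e) by ring.
  by clear -de eE d3 dk; lra.
have q (a b A B : R) : `|a| <= A -> `|b| <= B -> `|a * b| <= A * B.
  by move=> ha hb; rewrite normrM ler_pM.
have t1 := le_trans (q _ _ _ _ hp1 z1b) dz1.
have t2 := le_trans (q _ _ _ _ hp2 z2b) dz2.
have t3 := le_trans (q _ _ _ _ hp1 z2b) dz2.
have t4 := le_trans (q _ _ _ _ hp2 z1b) dz1.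
split.
  have -> : p1 * z1 - p2 * z2 - I = (p1 - 1) * z1 - p2 * z2 + (z1 - I) by ring.
  apply: (le_trans (ler_normD _ _)); have := ler_normB ((p1 - 1) * z1) (p2 * z2).
  by clear -t1 t2 hz1; lra.
have -> : p1 * z2 + p2 * z1 - k = (p1 - 1) * z2 + p2 * z1 + (z2 - k) by ring.
apply: (le_trans (ler_normD _ _)); have := ler_normD ((p1 - 1) * z2) (p2 * z1).
by clear -t3 t4 hz2; lra.
Qed.

Section Transmission.
Variables (U A E : R -> R) (d k : R).
Hypothesis reg : regularized U A E d.
Hypothesis d_gt0 : 0 < d.
Hypothesis d_le : d <= 32^-1.
Hypothesis k_neq0 : k != 0.

Let W := wronskian (jost_plus U k) (jost_minus U k) 0.
Let I := \int[mu]_(x in setT) (A x ^+ 2 - E x).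

Let G_L1 : L1 setT (fun x => A x ^+ 2 - E x).
Proof.
apply: (L1_dominated _ _ (QG_L1 reg)) => //.
  apply: measurable_funB; last exact: reg_E_meas reg.
  by apply: measurable_funX; exact: ac_measurable (reg_ac reg).
move=> x _; rewrite ler_peMl // -[leLHS](expr1n _ 2) lerXn2r ?nnegrE ?addr_ge0 //.
by rewrite lerDl.
Qed.

Let I_split : \int[mu]_(x in `[0, +oo[) (A x ^+ 2 - E x) +
  \int[mu]_(x in `[0, +oo[) ((- A (- x)) ^+ 2 - E (- x)) = I.
Proof.
rewrite /I (Rintegral_halves G_L1); congr (_ + _).
by apply: eq_Rintegral => x _; rewrite sqrrN.
Qed.

Let I_bound : `|\int[mu]_(x in `[0, +oo[) (A x ^+ 2 - E x)| <= 2 * d ^+ 2.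
Proof.
apply: le_trans (QG_int reg d_gt0); apply: norm_Rintegral_sub => //.
- by apply: measurable_funTS; exact: L1_measurable G_L1.
- exact: QG_L1 reg.
- move=> x _; rewrite ler_peMl // -[leLHS](expr1n _ 2) lerXn2r ?nnegrE ?addr_ge0 //.
  by rewrite lerDl.
Qed.

(** Put [f = jost_plus] and [g(x) = jost_minus(- x)], so that the Wronskian at 0 is
    [- (f g' + g f')]. By [jost_plus_estimate], [f' - A 0 f] and [g' + A 0 g] are close to [ik] plus
    the integral of [A^2 - E] over the corresponding half line. The terms in [A 0] cancel, and each
    of the two remaining products costs [3 e] by [product_estimate]. *)
Lemma wronskian_estimate :
  let e := 100 * (d ^+ 3 + d * `|k|) in
  `|complex.Re W + I| <= 6 * e /\ `|complex.Im W + 2 * k| <= 6 * e.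
Proof.
move=> e; have e0 : 0 <= e.
  by rewrite mulr_ge0 // addr_ge0 ?mulr_ge0 ?exprn_ge0 // ltW.
have regr := regularized_reflect reg.
have Jp : is_jost_plus U k (jost_plus U k).
  exact: (xgetPex (fun=> 0) (jost_plus_exists reg d_gt0 d_le k_neq0)).
have Jm : is_jost_minus U k (jost_minus U k).
  have [g jg] := jost_plus_exists regr d_gt0 d_le k_neq0.
  exact: (xgetPex (fun=> 0) (ex_intro _ _ (jost_plus_reflect jg))).
have Jg := jost_minus_reflect Jm.
have [f1 f2 f3 f4] := jost_plus_estimate reg d_gt0 d_le k_neq0 Jp.
have [g1 g2 g3 g4] := jost_plus_estimate regr d_gt0 d_le k_neq0 Jg.
have Dm : Cderive (jost_minus U k) 0 = - Cderive (fun x => jost_minus U k (- x)) 0.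
  rewrite -(Cderive_reflect Jg); congr (Cderive _ 0).
  by apply/funext => x; rewrite opprK.
have I1 := I_bound.
have I2 : `|\int[mu]_(x in `[0, +oo[) ((- A (- x)) ^+ 2 - E (- x))| <= 2 * d ^+ 2.
  apply: le_trans (QG_int regr d_gt0); apply: norm_Rintegral_sub => //.
  - apply: measurable_funTS; apply: measurable_funB; last exact: reg_E_meas regr.
    by apply: measurable_funX; exact: ac_measurable (reg_ac regr).
  - exact: QG_L1 regr.
  - move=> x _; rewrite ler_peMl // -[leLHS](expr1n _ 2) lerXn2r ?nnegrE ?addr_ge0 //.
    by rewrite lerDl.
rewrite /W /wronskian Dm -I_split.
move: f1 f2 f3 f4 g1 g2 g3 g4 I1 I2; rewrite oppr0.
move: (\int[mu]_(x in `[0, +oo[) (A x ^+ 2 - E x)) => Ip.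
move: (\int[mu]_(x in `[0, +oo[) ((- A (- x)) ^+ 2 - E (- x))) => Im.
move: (jost_plus U k 0) (jost_minus U k 0) (Cderive (jost_plus U k) 0).
move: (Cderive (fun x => jost_minus U k (- x)) 0) => [r1' r2'] [p1 p2] [r1 r2] [p1' p2'] /=.
rewrite -/e => f1 f2 f3 f4 g1 g2 g3 g4 hIp hIm.
have dd := ltW d_gt0.
have [a1 a2] := product_estimate dd d_le e0 (erefl e) hIp g1 g2 f3 f4.
have [b1 b2] := product_estimate dd d_le e0 (erefl e) hIm f1 f2 g3 g4.
split.
  have -> : p1 * - r1' - p2 * - r2' - (r1 * p1' - r2 * p2') + (Ip + Im) =
   - ((r1 * (p1' - A 0 * p1) - r2 * (p2' - A 0 * p2) - Ip)
    + (p1 * (r1' - - A 0 * r1) - p2 * (r2' - - A 0 * r2) - Im)) by ring.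
  rewrite normrN; apply: (le_trans (ler_normD _ _)).
  by clear -a1 b1; lra.
have -> : p1 * - r2' + p2 * - r1' - (r1 * p2' + r2 * p1') + 2 * k =
   - ((r1 * (p2' - A 0 * p2) + r2 * (p1' - A 0 * p1) - k)
    + (p1 * (r2' - - A 0 * r2) + p2 * (r1' - - A 0 * r1) - k)) by ring.
rewrite normrN; apply: (le_trans (ler_normD _ _)).
by clear -a2 b2; lra.
Qed.

End Transmission.

(* The transmission coefficient of the potential [- S delta_0]. *)
Definition delta_transmission (S k : R) : R[i] := (0 -i* (2 * k))%C / ((- S) -i* (2 * k))%C.

(* [|-2ik - m eps^2|] dominates [|k| + eps^2], while the error on the Wronskian
   is [O(eps (|k| + eps^2))]. *)
Lemma transmission_close (m K : R) : 0 < m -> 0 < K ->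
  exists C e0 : R, 0 < e0 /\ forall eps : R, 0 < eps -> eps < e0 ->
  forall U A E : R -> R, regularized U A E (K * eps) ->
  `|\int[mu]_(x in setT) (A x ^+ 2 - E x) - m * eps ^+ 2| <= K * eps ^+ 3 ->
  forall k : R, normc (transmission U k - delta_transmission (m * eps ^+ 2) k) <= C * eps.
Proof.
move=> m0 K0.
(* [C1 eps (eps^2 + |k|)] is the total error on the Wronskian: twice [6 e] from [wronskian_estimate]
   and [K eps^3] from the integral. The lower bound [c (eps^2 + |k|)] for the model Wronskian
   follows from its real and imaginary parts, [m eps^2] and [2 |k|] in absolute value. *)
pose C1 := 12 * (100 * (K ^+ 3 + K)) + K.
pose c := Num.min m 2 / 2.
have C10 : 0 < C1.
  by rewrite addr_gt0 // mulr_gt0 ?ltr0n // mulr_gt0 ?ltr0n // addr_gt0 // exprn_gt0.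
have c0 : 0 < c by rewrite divr_gt0 // lt_min m0 /=.
pose e0 := Num.min (32^-1 / K) (c / 2 / C1).
(* The first bound in [e0] gives [K eps <= 32^-1]; the second gives [C1 eps <= c / 2], so that the
   true Wronskian keeps half of the lower bound. With [q = eps^2 + |k|], the constant is the
   quotient of [2 q * C1 eps q] by [(c / 2) q * c q]. *)
exists (4 * C1 / c ^+ 2), e0; split.
  rewrite /e0 lt_min; apply/andP; split; apply: divr_gt0 => //.
  by rewrite divr_gt0.
move=> eps eps0; rewrite lt_min => /andP[eK eC] U A E reg hI.
have d0 : 0 < K * eps by rewrite mulr_gt0.
have dle : K * eps <= 32^-1 by rewrite mulrC -ler_pdivlMr // ltW.
have eC' : C1 * eps <= c / 2 by rewrite mulrC -ler_pdivlMr // ltW.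
pose W (k : R) := wronskian (jost_plus U k) (jost_minus U k) 0.
pose W0 (k : R) : R[i] := ((- (m * eps ^+ 2)) -i* (2 * k))%C.
pose q (k : R) : R := eps ^+ 2 + `|k|.
have q0 k : 0 < q k by rewrite /q ltr_pwDl // exprn_gt0.
have W0_ge k : c * q k <= normc (W0 k).
  have h1 : m * eps ^+ 2 <= normc (W0 k).
    apply: le_trans (norm_Re_le _); rewrite /= normrN ger0_norm //.
    by rewrite mulr_ge0 ?sqr_ge0 // ltW.
  have h2 : 2 * `|k| <= normc (W0 k).
    by apply: le_trans (norm_Im_le _); rewrite /= normrN normrM ger0_norm.
  have cm : 2 * c <= m by rewrite /c mulrC divfK // ge_min lexx.
  have c2 : 2 * c <= 2 by rewrite /c mulrC divfK // ge_min lexx orbT.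
  have h3 := ler_wpM2r (sqr_ge0 eps) cm; have h4 := ler_wpM2r (normr_ge0 k) c2.
  by rewrite /q; clear -h1 h2 h3 h4; lra.
have WW0 k : k != 0 -> normc (W k - W0 k) <= C1 * eps * q k.
  move=> k0; have [h1 h2] := wronskian_estimate reg d0 dle k0.
  apply: (le_trans (normc_le _)).
  have -> : complex.Re (W k - W0 k) = (complex.Re (W k) + \int[mu]_(x in setT) (A x ^+ 2 - E x))
     - (\int[mu]_(x in setT) (A x ^+ 2 - E x) - m * eps ^+ 2).
    by rewrite /W0; case: (W k) => a b /=; ring.
  have -> : complex.Im (W k - W0 k) = complex.Im (W k) + 2 * k.
    by rewrite /W0; case: (W k) => a b /=; ring.
  have h3 := le_trans (ler_normB _ _) (lerD h1 hI).
  apply: (le_trans (lerD h3 h2)).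
  have K3 : 0 <= K ^+ 3 by rewrite exprn_ge0 // ltW.
  have e3 : 0 <= eps ^+ 3 by rewrite exprn_ge0 // ltW.
  have ek : 0 <= eps * `|k| by rewrite mulr_ge0 // ltW.
  have t1 : 0 <= K ^+ 3 * (eps * `|k|) by rewrite mulr_ge0.
  have t2 : 0 <= K * eps ^+ 3 by rewrite mulr_ge0 // ltW.
  have t3 : 0 <= K * (eps * `|k|) by rewrite mulr_ge0 // ltW.
  have -> : C1 * eps * q k = 12 * (100 * (K ^+ 3 * eps ^+ 3)) + 12 * (100 * (K ^+ 3 * (eps * `|k|))) +
    12 * (100 * (K * eps ^+ 3)) + 12 * (100 * (K * (eps * `|k|))) + K * eps ^+ 3 + K * (eps * `|k|).
    by rewrite /C1 /q; ring.
  have -> : (K * eps) ^+ 3 = K ^+ 3 * eps ^+ 3 by ring.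
  by clear -t1 t2 t3; lra.
have W_ge k : k != 0 -> c / 2 * q k <= normc (W k).
  move=> k0; have h1 := W0_ge k; have h2 := WW0 k k0.
  have h3 : C1 * eps * q k <= c / 2 * q k by rewrite ler_wpM2r // ltW.
  have h4 : normc (W0 k) <= normc (W k) + normc (W k - W0 k).
    have {1}-> : W0 k = W k - (W k - W0 k) by ring.
    by apply: (le_trans (le_normcD _ _)); rewrite normcN.
  by clear -h1 h2 h3 h4; lra.
have nk k : normc (0 -i* (2 * k))%C = 2 * `|k|.
  by rewrite /= expr0n /= add0r sqrrN sqrtr_sqr normrM ger0_norm.
have tfE k : transmission_formula U k = (0 -i* (2 * k))%C / W k by [].
have Ce : 0 <= 4 * C1 / c ^+ 2 * eps.
  apply: mulr_ge0; last exact: ltW.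
  by apply: divr_ge0; [apply: mulr_ge0 => //; exact: ltW|exact: sqr_ge0].
move=> k; rewrite /transmission; have [->|k0] := eqVneq k 0.
  (* Off 0 the Wronskian stays above [(c / 2) eps^2] in modulus while the numerator tends to 0. The
     coefficient thus vanishes at [k = 0], as does that of the point interaction. *)
  have -> : lim (transmission_formula U h @[h --> 0^']) = 0 :> R[i]^o.
    apply: cvg_lim; first exact: norm_hausdorff.
    apply/cvg_complex0; apply/cvgr0Pnorm_le => e e_gt0.
    have r0 : 0 < e * (c / 2 * eps ^+ 2) / 2.
      by rewrite divr_gt0 // mulr_gt0 // mulr_gt0 ?exprn_gt0 // divr_gt0.
    near=> h.
    have h0 : h != 0 by near: h; exact: nbhs_dnbhs_neq.
    have hr : `|h| < e * (c / 2 * eps ^+ 2) / 2 by near: h; exact: dnbhs0_lt.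
    rewrite ger0_norm ?normc_ge0 // tfE Normc.normcM Normc.normcV nk.
    have Wh : c / 2 * eps ^+ 2 <= normc (W h).
      apply: le_trans (W_ge h h0); apply: ler_wpM2l; last by rewrite /q lerDl.
      by move: c0; lra.
    have cpos : 0 < c / 2 * eps ^+ 2 by rewrite mulr_gt0 ?exprn_gt0 // divr_gt0.
    rewrite ler_pdivrMr; last exact: lt_le_trans Wh.
    apply: (@le_trans _ _ (e * (c / 2 * eps ^+ 2))); last by rewrite ler_wpM2l // ltW.
    by move: hr; lra.
  rewrite /delta_transmission mulr0 sub0r normcN Normc.normcM.
  rewrite (_ : normc (0 -i* 0)%C = 0) ?mul0r //.
  by rewrite /= expr0n /= oppr0 expr0n /= addr0 sqrtr0.
have Wn : 0 < normc (W k) by apply: lt_le_trans (W_ge k k0); rewrite mulr_gt0 // divr_gt0.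
have W0n : 0 < normc (W0 k) by apply: lt_le_trans (W0_ge k); rewrite mulr_gt0.
have Wz : W k != 0 by rewrite -normc_eq0 gt_eqF.
have W0z : W0 k != 0 by rewrite -normc_eq0 gt_eqF.
rewrite tfE /delta_transmission -/(W0 k).
have -> : (0 -i* (2 * k))%C / W k - (0 -i* (2 * k))%C / W0 k =
  - ((0 -i* (2 * k))%C * (W k - W0 k) / (W k * W0 k)) by field; rewrite Wz W0z.
rewrite normcN !Normc.normcM Normc.normcV Normc.normcM nk.
rewrite ler_pdivrMr ?mulr_gt0 //.
have kq : `|k| <= q k by rewrite /q lerDr sqr_ge0.
have h1 : 2 * `|k| * normc (W k - W0 k) <= 2 * q k * (C1 * eps * q k).
  by apply: ler_pM; rewrite ?normc_ge0 ?mulr_ge0 // ?ler_wpM2l // WW0.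
apply: (le_trans h1).
have h2 : c / 2 * q k * (c * q k) <= normc (W k) * normc (W0 k).
  have cq : 0 <= c * q k by apply: mulr_ge0; exact: ltW.
  have cq2 : 0 <= c / 2 * q k by rewrite mulrAC; move: cq; lra.
  exact: ler_pM cq2 cq (W_ge k k0) (W0_ge k).
apply: le_trans (ler_wpM2l Ce h2).
rewrite le_eqVlt; apply/orP; left; apply/eqP; field.
by rewrite gt_eqF.
Unshelve. all: by end_near. Qed.

(** * Test functions and weak derivatives *)

(** The derivative is an existential witness, so closure under sums, products and inverses is an
    induction on [n]. At order 0 nothing is required; only the conjunction over all [n] matters. *)
Fixpoint Ck n f : Prop :=
  if n is m.+1 then exists2 g, (forall x, is_derive x (1 : R) f (g x)) & Ck m g
  else True.

Definition smooth f := forall n, Ck n f.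

Lemma Ck_decr n f : Ck n.+1 f -> Ck n f.
Proof.
elim: n f => [//|n IH] f [g fg Cg]; exists g => //; exact: IH.
Qed.

Lemma Ck_derive1 n f : Ck n.+1 f -> Ck n (derive1 f).
Proof.
move=> [g fg Cg]; suff -> : derive1 f = g by [].
by apply/funext => x; rewrite derive1E; have ? := fg x; apply: derive_val.
Qed.

Lemma smooth_derive1 f : smooth f -> smooth (derive1 f).
Proof. by move=> sf n; apply: Ck_derive1; exact: sf. Qed.

Lemma smooth_is_derive f x : smooth f -> is_derive x (1 : R) f (derive1 f x).
Proof.
move=> sf; have [g fg _] := sf 1%N; have ? := fg x.
by rewrite derive1E; apply: DeriveDef => //; case: (fg x).
Qed.

Lemma smooth_derivable f : smooth f -> forall n x, derivable (derive1n n f) x 1.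
Proof.
move=> sf n; elim: n f sf => [|n IH] f sf x.
  by rewrite derive1n0; case: (smooth_is_derive x sf).
by rewrite derive1Sn; apply: IH; exact: smooth_derive1.
Qed.

Lemma derivable_smooth f : (forall n x, derivable (derive1n n f) x 1) -> smooth f.
Proof.
move=> df n; elim: n f df => [//|n IH] f df; exists (derive1 f).
  by move=> x; rewrite derive1E; apply: DeriveDef => //; exact: (df 0%N).
by apply: IH => m x; rewrite -derive1Sn; exact: df.
Qed.

Lemma CkD n f g : Ck n f -> Ck n g -> Ck n (fun x => f x + g x).
Proof.
elim: n f g => [//|n IH] f g [f' ff' Cf] [g' gg' Cg].
exists (fun x => f' x + g' x); last exact: IH.
by move=> x; apply: is_deriveD.
Qed.

Lemma CkZ n c f : Ck n f -> Ck n (fun x => c * f x).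
Proof.
elim: n f => [//|n IH] f [f' ff' Cf].
exists (fun x => c * f' x); last exact: IH.
by move=> x; apply: is_deriveZ.
Qed.

Lemma CkM n f g : Ck n f -> Ck n g -> Ck n (fun x => f x * g x).
Proof.
elim: n f g => [//|n IH] f g Cf0 Cg0.
have [f' ff' Cf] := Cf0; have [g' gg' Cg] := Cg0.
exists (fun x => f x * g' x + g x * f' x).
  by move=> x; apply: is_deriveM.
by apply: CkD; apply: IH => //; exact: Ck_decr.
Qed.

Lemma Ck_cst n c : Ck n (fun=> c).
Proof. by elim: n c => [//|n IH] c; exists (fun=> 0) => // x; exact: is_derive_cst. Qed.

Lemma Ck_affine n a b f : Ck n f -> Ck n (fun x => f (a * x + b)).
Proof.
elim: n f => [//|n IH] f [f' ff' Cf].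
exists (fun x => a * f' (a * x + b)); last exact/CkZ/IH.
move=> x; have da : is_derive x (1 : R) (fun y => a * y + b) a.
  have := is_deriveD (is_deriveZ a (is_derive_id x (1 : R))) (is_derive_cst b x 1).
  by rewrite /GRing.scale /= mulr1 addr0.
apply: (is_derive_eq (@is_derive1_comp R f (fun y => a * y + b) x _ _ (ff' _) da)).
exact: mulrC.
Qed.

Lemma Ck_inv n f : (forall x, f x != 0) -> Ck n f -> Ck n (fun x => (f x)^-1).
Proof.
move=> f0; elim: n => [//|n IH] Cf0.
have [f' ff' Cf] := Cf0; have Cfi := IH (Ck_decr Cf0).
exists (fun x => - 1 * ((f x)^-1 * (f x)^-1) * f' x).
  move=> x; apply: (is_derive_eq (is_deriveV (f0 x) (ff' x))).
  by rewrite /GRing.scale /= expr2 invfM mulN1r.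
by apply: CkM => //; apply: CkZ; apply: CkM.
Qed.

(** For [n = 0] this is the classical smooth function [e^(-1/x)], extended by 0 to the left. The
    factors [x^(-n)] make the family stable under differentiation up to linear combinations. *)
Definition flat n x : R := if 0 < x then (x^-1) ^+ n * expR (- x^-1) else 0.

(** With [y = 1/x], the claim is [y^(n+1) <= (n+1)^(n+1) e^y], which follows from
    [1 + y/(n+1) <= e^(y/(n+1))]. *)
Lemma flat_le n x : `|flat n x| <= (n.+1%:R) ^+ n.+1 * `|x|.
Proof.
rewrite /flat; case: ltP => [x0|_]; last first.
  by rewrite normr0 mulr_ge0 ?exprn_ge0.
rewrite !gtr0_norm ?mulr_gt0 ?exprn_gt0 ?invr_gt0 ?expR_gt0 //.
have y0 : 0 < x^-1 by rewrite invr_gt0.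
have -> : x = x^-1^-1 by rewrite invrK.
rewrite invrK; move: (x^-1) y0 => y y0.
rewrite expRN ler_pdivrMr ?expR_gt0 // mulrAC ler_pdivlMr // -exprSr.
have -> : y = n.+1%:R * (y / n.+1%:R) by rewrite mulrC divfK.
rewrite exprMn ler_wpM2l ?exprn_ge0 // expRM_natl.
rewrite lerXn2r ?nnegrE ?expR_ge0 ?divr_ge0 ?ltW //.
by apply: lt_le_trans (expR_ge1Dx _); rewrite ltrDr.
Qed.

Lemma flat_derive n x : is_derive x (1 : R) (flat n)
  (- n%:R * flat n.+1 x + flat n.+2 x).
Proof.
have [x0|x0|->] := ltgtP x 0.
- have H : is_derive x (1 : R) (fun=> 0 : R) 0 by exact: is_derive_cst.
  rewrite /flat !ltNge !ltW //= mulr0 addr0.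
  apply: (near_eq_is_derive _ H); near=> y; rewrite ltNge ltW //.
  by near: y; exact: lt_nbhsl.
- have xn : x != 0 by rewrite gt_eqF.
  have dv : is_derive x (1 : R) (fun y => y^-1) (- x ^- 2).
    apply: (is_derive_eq (is_deriveV xn (is_derive_id x 1))).
    by rewrite /GRing.scale /= mulr1.
  have dX : is_derive x (1 : R) (fun y => (y^-1) ^+ n) (n%:R * (x^-1) ^+ n.-1 * - x ^- 2).
    case: n => [|n].
      by rewrite mul0r mul0r; exact: is_derive_cst.
    have -> : (fun y : R => (y^-1) ^+ n.+1) = (GRing.inv ^+ n.+1 : R -> R).
      by apply/funext => y; rewrite exprfctE.
    apply: (is_derive_eq (is_deriveX n.+1 dv)).
    by rewrite /GRing.scale /=.
  have dE : is_derive x (1 : R) (fun y => expR (- y^-1)) (expR (- x^-1) * x ^- 2).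
    apply: (is_derive_eq (@is_derive1_comp R (@expR R) (fun y => - y^-1) x _ _
      (is_derive_expR (- x^-1)) (is_deriveN dv))).
    by rewrite opprK.
  have H := is_deriveM dX dE.
  rewrite /flat x0.
  apply: (near_eq_is_derive (f := fun y => (y^-1) ^+ n * expR (- y^-1))).
    near=> y; have -> // : 0 < y by near: y; exact: lt_nbhsr.
  apply: (is_derive_eq H); rewrite /GRing.scale /=.
  case: n {dX H} => [|n] /=.
    by rewrite !mul0r mulr0 addr0 oppr0 mul0r add0r expr0 mul1r mulrC exprVn.
  by rewrite !exprS; field.
- have f0 m : flat m 0 = 0 by rewrite /flat ltxx.
  rewrite !f0 mulr0 addr0.
  (* At 0 the difference quotient of [flat n] is [flat n.+1], which tends to 0 by [flat_le]. *)
  have H : h^-1 *: ((flat n \o shift 0) (h *: (1 : R)) - flat n 0) @[h --> 0^'] --> (0 : R).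
    apply/cvgr0Pnorm_le => e e0; near=> h.
    have -> : h^-1 *: ((flat n \o shift 0) (h *: (1 : R)) - flat n 0) = flat n.+1 h.
      rewrite f0 subr0 /= addr0 /GRing.scale /= mulr1 /flat; case: ifP => _; last by rewrite mulr0.
      by rewrite exprS mulrA.
    apply: (le_trans (flat_le _ _)); rewrite mulrC -ler_pdivlMr ?exprn_gt0 //.
    by near: h; apply: dnbhs0_le; rewrite divr_gt0 // exprn_gt0.
  apply: DeriveDef; first by apply/cvg_ex; exists 0.
  by apply: cvg_lim.
Unshelve. all: by end_near. Qed.

Lemma flat_smooth n : smooth (flat n).
Proof.
move=> m; elim: m n => [//|m IH] n.
exists (fun x => - n%:R * flat n.+1 x + flat n.+2 x); last by apply: CkD => //; exact: CkZ.
by move=> x; exact: flat_derive.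
Qed.

Lemma smooth_continuous f : smooth f -> continuous f.
Proof.
move=> sf x; apply: differentiable_continuous; apply/derivable1_diffP.
by case: (smooth_is_derive x sf).
Qed.

Definition hump a b x : R := flat 0 (x - a) * flat 0 (b - x).

Lemma hump_smooth a b : smooth (hump a b).
Proof.
move=> n; apply: CkM.
  have := Ck_affine 1 (- a) (flat_smooth 0 n).
  by under eq_fun do rewrite mul1r.
have := Ck_affine (- 1) b (flat_smooth 0 n).
by under eq_fun do rewrite mulN1r addrC.
Qed.

Lemma hump_ge0 a b x : 0 <= hump a b x.
Proof. by rewrite mulr_ge0 // /flat; case: ifP => // _; rewrite mulr_ge0 ?expr0 ?expR_ge0. Qed.

Lemma hump_gt0 a b x : a < x < b -> 0 < hump a b x.
Proof.
move=> /andP[ax xb]; rewrite mulr_gt0 // /flat subr_gt0 ?ax ?xb mulr_gt0 ?expr0 ?expR_gt0 //.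
Qed.

Lemma hump_eq0 a b x : ~~ (a < x < b) -> hump a b x = 0.
Proof.
rewrite negb_and /hump /flat !subr_gt0 => /orP[/negbTE ->|/negbTE ->].
  by rewrite mul0r.
by rewrite mulr0.
Qed.

Lemma test_hump (u : R -> R) a b : smooth u -> (forall x, ~~ (a < x < b) -> u x = 0) ->
  test_function u.
Proof.
move=> su u0; split; first exact: smooth_derivable.
exists (Num.max `|a| `|b|) => x; rewrite gt_max => /andP[xa xb]; apply: u0.
apply/negP => /andP[ax xb'].
have := ler_norm b; have := ler_norm (- a); rewrite normrN.
by move: xa xb; have [x0|x0] := leP 0 x; [rewrite (ger0_norm x0)|rewrite (ltr0_norm x0)]; lra.
Qed.

(* Smooth approximation from below of the indicator function of ]a, b[. *)
Definition plateau a b n x := hump a b x / (hump a b x + n.+1%:R^-1).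

Lemma plateau_test a b n : test_function (plateau a b n).
Proof.
apply: (@test_hump _ a b) => [m|x xab]; last by rewrite /plateau hump_eq0 // mul0r.
apply: CkM; first exact: hump_smooth.
apply: Ck_inv.
  by move=> x; rewrite gt_eqF // ltr_wpDl ?hump_ge0 // invr_gt0.
by apply: CkD; [exact: hump_smooth|exact: Ck_cst].
Qed.

Lemma plateau_bound a b n x : 0 <= plateau a b n x <= 1.
Proof.
have p0 := hump_ge0 a b x; have i0 : 0 < (n.+1%:R^-1 : R) by rewrite invr_gt0.
have q0 : 0 < hump a b x + n.+1%:R^-1 by rewrite ltr_wpDl.
rewrite /plateau; apply/andP; split; first by rewrite divr_ge0 // ltW.
by rewrite ler_pdivrMr // mul1r lerDl ltW.
Qed.

Lemma plateau_cvg a b x :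
  plateau a b n x @[n --> \oo] --> (\1_(`]a, b[%classic) x : R).
Proof.
rewrite indicE mem_setE; have [xab|xab] := boolP (x \in `]a, b[).
  rewrite in_itv /= in xab; have p0 := hump_gt0 xab.
  rewrite [X in _ --> X](_ : _ = hump a b x / (hump a b x + 0)); last first.
    by rewrite addr0 divff // gt_eqF.
  apply: cvgM; first exact: cvg_cst.
  apply: cvgV; first by rewrite addr0 gt_eqF.
  by apply: cvgD; [exact: cvg_cst|exact: cvg_harmonic].
rewrite in_itv /= in xab.
by under eq_fun do rewrite /plateau hump_eq0 // mul0r; exact: cvg_cst.
Qed.

Lemma ae_imp (P Q : mR -> Prop) : {ae mu, forall x, P x} ->
  (forall x, P x -> Q x) -> {ae mu, forall x, Q x}.
Proof. by move=> hP PQ; apply: (@filterS _ _ (ae_filter_ringOfSetsType mu) _ _ _ hP). Qed.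

Lemma ae_imp2 (P Q S : mR -> Prop) : {ae mu, forall x, P x} ->
  {ae mu, forall x, Q x} -> (forall x, P x -> Q x -> S x) -> {ae mu, forall x, S x}.
Proof.
by move=> hP hQ PQ; apply: (@filterS2 _ _ (ae_filter_ringOfSetsType mu) _ _ _ _ hP hQ).
Qed.

Lemma Rdominated_cvg D (u : nat -> R -> R) f g : measurable D ->
  (forall n, measurable_fun D (u n)) -> measurable_fun D f ->
  {ae mu, forall x, D x -> u n x @[n --> \oo] --> f x} -> L1 D g ->
  {ae mu, forall x n, D x -> `|u n x| <= g x} ->
  L1 D f /\ \int[mu]_(x in D) u n x @[n --> \oo] --> \int[mu]_(x in D) f x.
Proof.
move=> mD mu_ mf uf jg ug.
have mu' n : measurable_fun D (EFin \o u n) by exact/measurable_EFinP.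
have mf' : measurable_fun D (EFin \o f) by exact/measurable_EFinP.
have uf' : {ae mu, forall x, D x -> (EFin \o u n) x @[n --> \oo] --> (EFin \o f) x}.
  apply: (ae_imp uf) => x h Dx; apply: cvg_EFin; first exact: nearW.
  exact: h Dx.
have ug' : {ae mu, forall x n, D x -> (`|(EFin \o u n) x| <= (EFin \o g) x)%E}.
  by apply: (ae_imp ug) => x h n Dx; rewrite /= lee_fin h.
have [jf _ H] := dominated_convergence mD mu' mf' uf' jg ug'.
split => //; apply: fine_cvg; rewrite fineK //.
exact: integrable_fin_num.
Qed.

Lemma Rintegral_support D f : (forall x, ~ D x -> f x = 0) ->
  \int[mu]_(x in D) f x = \int[mu]_(x in setT) f x.
Proof.
move=> f0; rewrite Rintegral_mkcond; apply: eq_Rintegral => x _.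
by rewrite patchE; case: ifPn => //; rewrite notin_setE => /f0.
Qed.

Lemma L1_support D f : measurable D -> (forall x, ~ D x -> f x = 0) ->
  L1 D f -> L1 setT f.
Proof.
move=> mD f0 /(integrable_mkcond _ mD).1; apply: eq_integrable => // x _.
by rewrite patchE /=; case: ifPn => //; rewrite notin_setE => /f0 ->.
Qed.

(** * Functions determined by their integrals against test functions *)

Lemma test_support phi : test_function phi -> exists2 M, 0 < M &
  forall x, M <= `|x| -> phi x = 0.
Proof.
move=> [_ [M HM]]; exists (`|M| + 1); first by rewrite ltr_wpDl.
by move=> x hx; apply: HM; have := ler_norm M; lra.
Qed.

Lemma test_smooth phi : test_function phi -> smooth phi.
Proof. by move=> [dphi _]; exact: derivable_smooth. Qed.

Lemma test_derive1 phi : test_function phi -> test_function (derive1 phi).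
Proof.
move=> tphi; split; first by apply: smooth_derivable; apply: smooth_derive1; exact: test_smooth.
have [M M0 HM] := test_support tphi; exists M => x Mx.
have H : is_derive x (1 : R) phi 0.
  apply: (@near_eq_is_derive _ _ _ (fun=> 0)).
  near=> y; rewrite HM // ltW //; near: y.
  have : `|y| @[y --> x] --> `|x| by apply: cvg_norm.
  by move/cvgr_gt; apply.
by rewrite derive1E; apply: derive_val.
Unshelve. all: by end_near. Qed.

Lemma outside_itv M x : ~ (`[- M, M]%classic : set mR) x -> M <= `|x|.
Proof.
rewrite /= in_itv /= => /negP; rewrite -ler_norml -ltNge; exact: ltW.
Qed.

Section TestIntegral.
Variables (f phi : R -> R).
Hypothesis jf : forall a b, a <= b -> L1 `[a, b] f.
Hypothesis tphi : test_function phi.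

Lemma test_L1 : L1 setT (fun x => f x * phi x).
Proof.
have [M M0 HM] := test_support tphi.
apply: (@L1_support `[- M, M]) => //.
  by move=> x /outside_itv /HM ->; rewrite mulr0.
have cphi := smooth_continuous (test_smooth tphi).
have MM : - M <= M by lra.
apply: L1_eq (L1_itv_continuousM (jf MM) cphi) => // x _; exact: mulrC.
Qed.

End TestIntegral.

Lemma test_continuous phi : test_function phi -> continuous phi.
Proof. by move=> /test_smooth/smooth_continuous. Qed.

Lemma test_L1_self phi : test_function phi -> L1 setT phi.
Proof.
move=> tphi; have j1 a b : a <= b -> L1 `[a, b] (fun=> 1 : R).
  by move=> _; apply: continuous_L1_itv => x; exact: cvg_cst.
by have := test_L1 j1 tphi; under eq_fun do rewrite mul1r.
Qed.

(** The primitive vanishing to the left of the support vanishes to its right as well, precisely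
    because [psi] has integral 0. *)
Lemma test_primitive psi : test_function psi -> \int[mu]_(x in setT) psi x = 0 ->
  exists2 phi, test_function phi & derive1 phi = psi.
Proof.
move=> tpsi ipsi; have [M M0 HM] := test_support tpsi.
have cpsi := test_continuous tpsi.
have [P acP] := ac_primitive (fun a b (_ : a <= b) => continuous_L1_itv a b cpsi).
have acPM : ac (fun x => P x - P (- M)) psi.
  by apply: ac_eq (acB acP (ac_cst (P (- M)))) _ _ => // x; rewrite subr0.
have dP := ac_derivable acPM cpsi.
exists (fun x => P x - P (- M)); last exact: ac_derive1 acPM cpsi.
split.
  apply: smooth_derivable => -[|n] //; exists psi => //.
  exact: test_smooth.
exists M => x Mx.
have [x0|x0] := leP 0 x.
  rewrite ger0_norm // in Mx.
  have Mx' : - M <= x by lra.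
  have [_ ->] := acP _ _ Mx'; rewrite Rintegral_support // => y.
  rewrite /= in_itv /= => /negP; rewrite negb_and -!ltNge => /orP[h|h]; apply: HM.
    by rewrite ltr0_norm; lra.
  by rewrite gtr0_norm; lra.
rewrite ltr0_norm // in Mx.
have Mx' : x <= - M by lra.
rewrite -opprB; have [_ ->] := acP _ _ Mx'.
rewrite (_ : \int[mu]_(t in `[x, - M]) psi t = \int[mu]_(t in `[x, - M]) 0).
  by rewrite Rintegral_cst // mul0r oppr0.
apply: eq_Rintegral => y; rewrite inE /= in_itv /= => /andP[_ yM]; apply: HM.
by rewrite ltr0_norm; lra.
Qed.

(** The plateaus converge to the indicator of an open interval, so [f] has integral 0 on every
    bounded interval; Lebesgue's differentiation theorem on each [[- n, +oo[] then gives [f = 0]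
    almost everywhere. *)
Lemma test_orthogonal_ae0 f : (forall a b, a <= b -> L1 `[a, b] f) ->
  (forall psi, test_function psi -> \int[mu]_(x in setT) (f x * psi x) = 0) ->
  {ae mu, forall x, f x = 0}.
Proof.
move=> jf f0.
have mf := locL1_measurable jf.
have itv0 a b : a < b -> \int[mu]_(x in `[a, b]) f x = 0.
  move=> ab; have jab := jf _ _ (ltW ab).
  pose u n x := f x * plateau a b n x.
  have mp n : mfun (plateau a b n).
    exact: continuous_measurable_fun (test_continuous (plateau_test a b n)).
  have [_ H] : L1 `[a, b] (fun x => f x * \1_(`]a, b[%classic) x) /\
      \int[mu]_(x in `[a, b]) u n x @[n --> \oo] -->
      \int[mu]_(x in `[a, b]) (f x * \1_(`]a, b[%classic) x).
    apply: (Rdominated_cvg (g := fun x => `|f x|)) => //.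
    - by move=> n; apply: measurable_funTS; apply: measurable_funM.
    - by apply: measurable_funTS; apply: measurable_funM.
    - apply: aeW => x _; apply: cvgM; [exact: cvg_cst|exact: plateau_cvg].
    - exact: L1_norm_fun.
    - apply: aeW => x n _; rewrite /u normrM ler_piMr //.
      by have /andP[h0 h1] := plateau_bound a b n x; rewrite ger0_norm.
  have u0 n : \int[mu]_(x in `[a, b]) u n x = 0.
    rewrite Rintegral_support; first exact: f0 (plateau_test a b n).
    move=> x /=; rewrite in_itv /= => /negP xab.
    rewrite /u /plateau hump_eq0 ?mul0r ?mulr0 //; apply: contra xab => /andP[h1 h2].
    by rewrite !ltW.
  have -> : \int[mu]_(x in `[a, b]) f x =
      \int[mu]_(x in `[a, b]) (f x * \1_(`]a, b[%classic) x).
    rewrite [RHS]Rintegral_support; last first.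
      move=> x /=; rewrite in_itv /= => xab; rewrite indicE memNset ?mulr0 //=.
      by rewrite in_itv /= => /andP[h1 h2]; apply: xab; rewrite !ltW.
    have joo : L1 `]a, b[ f.
      apply: L1_subset jab => //.
      exact: subset_itv_oo_cc.
    have jco : L1 `]a, b] f.
      apply: L1_subset jab => //.
      by apply: subset_itvr; rewrite bnd_simp.
    rewrite -Rintegral_itv_obnd_cbnd // -Rintegral_itv_bndo_bndc //.
    rewrite Rintegral_mkcond; apply: eq_Rintegral => x _.
    by rewrite patchE indicE; case: ifPn; rewrite ?mulr1 ?mulr0.
  rewrite (_ : (fun n => \int[mu]_(x in `[a, b]) u n x) = (fun=> 0)) in H; last exact/funext.
  by apply: esym; apply: (cvg_unique _ (cvg_cst (0 : R)) H).
have jb (b : R) (n : nat) : L1 `[- n%:R, b] f.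
  have [h|h] := leP (- n%:R) b; first exact: jf.
  by rewrite set_itv_ge -?leNgt ?bnd_simp //; exact: integrable_set0.
have locf : locally_integrable [set: R] f.
  split; [exact: mf|exact: openT|move=> K _ cK].
  have [M [_ HM]] := compact_bounded cK.
  have KM : K `<=` `[- (`|M| + 1), `|M| + 1]%classic.
    move=> x Kx; rewrite /= in_itv /= -ler_norml.
    by apply: (HM (`|M| + 1)) => //; have := ler_norm M; lra.
  have MM : - (`|M| + 1) <= `|M| + 1 by have := normr_ge0 M; lra.
  have mK : measurable (K : set mR) by exact: compact_measurable.
  have := L1_subset mK (@measurable_itv _ _) KM (jf _ _ MM).
  by move=> /integrableP[_].
have H n : {ae mu, forall x, - n%:R < x -> f x = 0}.
  have := FTC1 (a := BLeft (- n%:R)) (fun y => jb y n) locf.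
  move=> /= hF; apply: (ae_imp hF) => x h nx; have [|_ <-] := h.
    by rewrite lte_fin.
  have -> : (fun y => \int[mu]_(t in `[- n%:R, y]) f t) = (fun=> 0).
    apply/funext => y; have [ny|yn|<-] := ltgtP (- n%:R) y.
    - exact: itv0.
    - by rewrite set_itv_ge -?leNgt ?bnd_simp // Rintegral_set0.
    - by rewrite set_itv1 Rintegral_set1.
  by rewrite derive1E derive_cst.
apply: (ae_imp (ae_foralln H)) => x h.
apply: (h (Num.trunc `|x|).+1); have := truncnS_gt `|x|.
by have := ler_norm (- x); rewrite normrN; lra.
Qed.

Lemma test_function_sub phi psi r : test_function phi -> test_function psi ->
  test_function (fun x => phi x - r * psi x).
Proof.
move=> tphi tpsi; have sphi := test_smooth tphi; have spsi := test_smooth tpsi.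
split.
  apply: smooth_derivable => n.
  have := CkD (sphi n) (CkZ (- r) (spsi n)).
  by under eq_fun do rewrite mulNr.
have [M M0 HM] := test_support tphi; have [N N0 HN] := test_support tpsi.
exists (Num.max M N) => x; rewrite gt_max => /andP[h1 h2].
by rewrite HM ?HN ?mulr0 ?subr0 // ltW.
Qed.

Lemma unit_test_function : exists2 psi, test_function psi &
  \int[mu]_(x in setT) psi x = 1.
Proof.
have t0 := @plateau_test 0 1 0; have jt := test_L1_self t0.
have p0 x : 0 <= plateau (0 : R) 1 0 x by have /andP[] := plateau_bound (0 : R) 1 0 x.
pose m := \int[mu]_(x in setT) (plateau 0 1 0 x : R).
have m0 : 0 < m.
  have ab : (4^-1 : R) <= 3 / 4 by lra.
  have cp : {within `[4^-1, 3 / 4 : R], continuous (plateau (0 : R) 1 0)}.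
    by apply: continuous_subspaceT; exact: test_continuous t0.
  have [c] := EVT_min ab cp; rewrite in_itv /= => /andP[c1 c2] cmin.
  have pc : 0 < plateau 0 1 0 c.
    have b0 : 0 < hump (0 : R) 1 c by apply: hump_gt0; lra.
    by rewrite divr_gt0 // addr_gt0 // invr_gt0.
  apply: (@lt_le_trans _ _ (\int[mu]_(x in `[4^-1, 3 / 4]) plateau 0 1 0 c)).
    rewrite Rintegral_cst // /= lebesgue_measure_itv /= lte_fin ifT /=; last by lra.
    by rewrite mulr_gt0 //; lra.
  apply: (@le_trans _ _ (\int[mu]_(x in `[4^-1, 3 / 4]) plateau 0 1 0 x)).
    apply: le_Rintegral => //.
    - by apply: continuous_L1_itv => x; exact: cvg_cst.
    - exact: L1_setT_itv.
  exact: Rintegral_subset.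
(* The scaling by [m^-1] is written as a difference so that [test_function_sub] applies. *)
exists (fun x => 0 - (- m^-1) * plateau 0 1 0 x).
  apply: test_function_sub t0; split => [n x|]; last by exists 0.
  apply: smooth_derivable => k; exact: Ck_cst.
under eq_Rintegral do rewrite sub0r mulNr opprK.
by rewrite RintegralZl // mulVf // gt_eqF.
Qed.

(** If [l] were nonzero, [|F|] would exceed [|l| / 2] on some [[x, x + 1]] with [x] so large that
    the tail of its integral is below [|l| / 2]. *)
Lemma L1_cvgy_eq0 F (l : R) : L1 setT F -> F x @[x --> +oo] --> l -> l = 0.
Proof.
move=> jF Fl; apply/eqP; apply/negP => /negP l0.
have l2 : 0 < `|l| / 2 by rewrite divr_gt0 // normr_gt0.
have jaF := L1_norm_fun (@measurableT _ mR) jF.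
suff [x [tx Fx]] : exists x, \int[mu]_(t in `[x, +oo[) `|F t| < `|l| / 2 /\
    forall t, x <= t -> `|l| / 2 <= `|F t|.
  have jc : L1 `[x, x + 1] (fun=> `|l| / 2) by apply: continuous_L1_itv => y; exact: cvg_cst.
  have : \int[mu]_(t in `[x, x + 1]) (`|l| / 2) <= \int[mu]_(t in `[x, +oo[) `|F t|.
    apply: (@le_trans _ _ (\int[mu]_(t in `[x, x + 1]) `|F t|)).
      apply: le_Rintegral => //; first exact: L1_setT_itv.
      by move=> t /=; rewrite in_itv /= => /andP[/Fx].
    apply: Rintegral_subset => //; last exact: L1_setT_ray.
    by apply: subset_itv; rewrite bnd_simp.
  rewrite Rintegral_cst // /= lebesgue_measure_itv /= lte_fin ltrDl ltr01 /=.
  by rewrite addrAC subrr add0r mulr1 leNgt tx.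
have [N1 [_ H1]] := (cvgr0Pnorm_lt _).1 (tail_cvg0 jaF) _ l2.
have [N2 [_ H2]] := (cvgrPdist_le _ _).1 Fl _ l2.
exists (Num.max N1 N2 + 1); split=> [|t].
  have := H1 (Num.max N1 N2 + 1); rewrite ger0_norm => [|]; last first.
    by apply: Rintegral_ge0.
  by apply; rewrite ltr_pwDr // le_max lexx.
move=> Nt; have := H2 t; have -> : N2 < t.
  by apply: lt_le_trans Nt; rewrite ltr_pwDr // le_max lexx orbT.
by move=> /(_ isT); have := ler_normB (l - F t) (- F t); rewrite opprK subrK normrN; lra.
Qed.

(** The du Bois-Reymond argument: let [H] be the primitive of [h] vanishing at [+oo]. Then [g - H]
    is orthogonal to all derivatives of test functions, that is, to those of integral 0, hence is
    almost everywhere a constant [c]. As [g] is integrable and [H + c] tends to [c], this constant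
    is 0. *)
Lemma weak_derivative_primitive g h : L1 setT g -> L1 setT h ->
  (forall phi, test_function phi -> \int[mu]_(x in setT) (g x * derive1 phi x) =
     - \int[mu]_(x in setT) (h x * phi x)) ->
  {ae mu, forall x, g x = 0 - \int[mu]_(t in `[x, +oo[) h t}.
Proof.
move=> jg jh wgh; set H := fun x => 0 - \int[mu]_(t in `[x, +oo[) h t.
have acH : ac H h by exact: tail_ac.
have H0 : H x @[x --> +oo] --> (0 : R) by exact: tail_ac_cvg.
have cH := ac_continuous acH.
have jH a b : a <= b -> L1 `[a, b] H by move=> _; exact: continuous_L1_itv.
have jhl a b : a <= b -> L1 `[a, b] h by move=> _; exact: L1_setT_itv.
have jgl a b : a <= b -> L1 `[a, b] g by move=> _; exact: L1_setT_itv.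
have parts phi : test_function phi ->
    \int[mu]_(x in setT) (H x * derive1 phi x) = - \int[mu]_(x in setT) (h x * phi x).
  move=> tphi; have t1 := test_derive1 tphi.
  have j1 := test_L1 jH t1; have j2 := test_L1 jhl tphi.
  apply/eqP; rewrite -addr_eq0 -RintegralD //; apply/eqP.
  have [M M0 HM] := test_support tphi; have [N N0 HN] := test_support t1.
  have acphi : ac phi (derive1 phi).
    apply: derivable_ac; first exact: test_continuous.
    by move=> x; apply: smooth_is_derive; exact: test_smooth.
  pose L := Num.max M N.
  have L0 : 0 < L by rewrite lt_max M0.
  have LL : - L <= L by lra.
  rewrite -(@Rintegral_support `[- L, L]); last first.
    move=> x /outside_itv; rewrite ge_max => /andP[/HM -> /HN ->].
    by rewrite !mulr0 addr0.
  have [_] := acM acH acphi LL.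
  rewrite (HM L) ?(HM (- L)) ?normrN ?(gtr0_norm L0) ?le_max ?lexx // !mulr0 subrr => E0.
  by rewrite [RHS]E0; apply: eq_Rintegral => x _; rewrite addrC.
pose D x := g x - H x.
have jD a b : a <= b -> L1 `[a, b] D.
  by move=> ab; apply: L1B => //; [exact: jgl|exact: jH].
have D0 phi : test_function phi -> \int[mu]_(x in setT) (D x * derive1 phi x) = 0.
  move=> tphi; have t1 := test_derive1 tphi.
  have j1 := test_L1 jH t1; have j2 := test_L1 jgl t1.
  have -> : \int[mu]_(x in setT) (D x * derive1 phi x) =
      \int[mu]_(x in setT) (g x * derive1 phi x - H x * derive1 phi x).
    by apply: eq_Rintegral => x _; rewrite /D mulrBl.
  by rewrite RintegralB // parts // wgh // subrr.
have [psi0 t0 i0] := unit_test_function.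
pose c := \int[mu]_(x in setT) (D x * psi0 x).
have Dc : {ae mu, forall x, D x - c = 0}.
  apply: test_orthogonal_ae0.
    by move=> a b ab; apply: L1B => //; [exact: jD|apply: continuous_L1_itv => x; exact: cvg_cst].
  move=> psi tpsi; pose r := \int[mu]_(x in setT) psi x.
  have jpsi := test_L1_self tpsi; have jpsi0 := test_L1_self t0.
  have t1 : test_function (fun x => psi x - r * psi0 x) by exact: test_function_sub.
  have [|phi tphi dphi] := test_primitive t1.
    by rewrite RintegralB //; [rewrite RintegralZl // i0 mulr1 subrr|exact: L1Z].
  have jDp := test_L1 jD tpsi; have jDp0 := test_L1 jD t0.
  have := D0 _ tphi; rewrite dphi.
  have -> : \int[mu]_(x in setT) (D x * (psi x - r * psi0 x)) =
      \int[mu]_(x in setT) (D x * psi x - r * (D x * psi0 x)).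
    by apply: eq_Rintegral => x _; ring.
  rewrite RintegralB //; last exact: L1Z.
  rewrite RintegralZl // -/c => E0.
  have -> : \int[mu]_(x in setT) ((D x - c) * psi x) =
      \int[mu]_(x in setT) (D x * psi x - c * psi x).
    by apply: eq_Rintegral => x _; ring.
  rewrite RintegralB //; last exact: L1Z.
  by rewrite RintegralZl // -/r mulrC.
suff c0 : c = 0.
  by apply: (ae_imp Dc) => x; rewrite c0 subr0 /D => /eqP; rewrite subr_eq0 => /eqP.
apply/eqP; apply/negP => /negP c0.
have mHc : mfun (fun x => H x + c).
  by apply: measurable_funD; [exact: ac_measurable acH|exact: measurable_cst].
have gH : {ae mu, forall x, [set: R] x -> g x = H x + c}.
  by apply: (ae_imp Dc) => x /eqP; rewrite /D subr_eq0 => /eqP <- _; rewrite addrC subrK.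
have jHc : L1 setT (fun x => H x + c) by exact: (ae_eq_L1 (@measurableT _ mR) gH).
have Hc : H x + c @[x --> +oo] --> 0 + c by apply: cvgD => //; exact: cvg_cst.
by move/eqP: c0; apply; have := L1_cvgy_eq0 jHc Hc; rewrite add0r.
Qed.

Definition weight x : R := (1 + `|x|) ^+ 3.

Lemma weight_ge1 x : 1 <= weight x.
Proof. by rewrite /weight exprn_ege1 // lerDl. Qed.

(** Representatives of a function and of its weak derivatives up to order 3, each of the first three
    being an actual primitive of the next, so that integration by parts is legitimate. The sup bound
    stops at order 2, since the third derivative is merely integrable. *)
Record sobolev_chain (N : R) (g : nat -> R -> R) : Prop := SobolevChain {
  sobolev_chain_ac : forall l, (l < 3)%N -> ac (g l) (g l.+1);
  sobolev_chain_sup : forall l x, (l < 3)%N -> `|g l x| <= N;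
  sobolev_chain_meas : forall l, (l < 4)%N -> mfun (g l);
  sobolev_chain_L1 : forall l, (l < 4)%N -> L1 setT (fun x => weight x * `|g l x|);
  sobolev_chain_int : forall l, (l < 4)%N ->
    \int[mu]_(x in setT) (weight x * `|g l x|) <= N }.

Lemma locally_integrable_L1 f : locally_integrable setT f ->
  mfun f /\ forall a b, a <= b -> L1 `[a, b] f.
Proof.
move=> [mf _ jf]; split=> // a b ab; apply/integrableP; split.
  by apply/measurable_EFinP; apply: measurable_funTS.
apply: jf => //; exact: segment_compact.
Qed.

Lemma L1_weight f : mfun f -> L1 setT (fun x => weight x * `|f x|) -> L1 setT f.
Proof.
move=> mf jw; apply: (L1_dominated (@measurableT _ mR) mf jw) => x _.
by rewrite ler_peMl // weight_ge1.
Qed.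

(** Testing order [l] against [derive1 phi] and order [l + 1] against [phi] shows that [f l.+1] is
    the first weak derivative of [f l]. So [f l] may be replaced by the tail primitive of [f l.+1]
    for [l < 3]; the same tail integral yields the sup bound. *)
Lemma sobolev_chain_exists (u : R -> R) (f : nat -> R -> R) N :
  (forall l, (l < 4)%N -> is_weak_derivative_real l u (f l)) ->
  (forall l, (l < 4)%N -> L1 setT (fun x => weight x * `|f l x|)) ->
  (forall l, (l < 4)%N -> \int[mu]_(x in setT) (weight x * `|f l x|) <= N) ->
  exists2 g, sobolev_chain N g & {ae mu, forall x, u x = g 0%N x}.
Proof.
move=> wf jw iw.
have mf l : (l < 4)%N -> mfun (f l).
  by move=> /wf [_ /locally_integrable_L1 []].
have jf l : (l < 4)%N -> L1 setT (f l).
  by move=> l4; apply: L1_weight; [exact: mf|exact: jw].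
pose g l x := if (l < 3)%N then 0 - \int[mu]_(t in `[x, +oo[) f l.+1 t else f l x.
have fg l : (l < 4)%N -> {ae mu, forall x, f l x = g l x}.
  rewrite ltnS leq_eqVlt => /orP[/eqP ->|l3].
    by apply: aeW => x; rewrite /g ltnn.
  rewrite /g l3; apply: weak_derivative_primitive; [exact/jf/ltnW|exact: jf|].
  move=> phi tphi; have [_ _ w1] := wf _ (ltnW l3 : (l < 4)%N).
  have [_ _ w2] := wf l.+1 l3.
  have := w2 _ tphi; have := w1 _ (test_derive1 tphi).
  rewrite -derive1Sn => -> /(congr1 (fun z => (-1) ^+ l * z)).
  by rewrite exprS mulN1r mulNr mulrN !mulrA -!expr2 sqrr_sign !mul1r.
have mg l : (l < 4)%N -> mfun (g l).
  move=> l4; rewrite /g; case l3: (l < 3)%N; last exact: mf.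
  exact: ac_measurable (tail_ac 0 (jf _ (l3 : (l.+1 < 4)%N))).
have acg l : (l < 3)%N -> ac (g l) (g l.+1).
  move=> l3; apply: (ac_ae _ (mg _ (l3 : (l.+1 < 4)%N)) (fg _ (l3 : (l.+1 < 4)%N))).
  by apply: ac_eq (tail_ac 0 (jf _ (l3 : (l.+1 < 4)%N))) _ _ => // x; rewrite /g l3.
have fgw l : (l < 4)%N ->
    {ae mu, forall x, [set: R] x -> weight x * `|f l x| = weight x * `|g l x|}.
  by move=> l4; apply: (ae_imp (fg _ l4)) => x ->.
have mw F : mfun F -> mfun (fun x => weight x * `|F x|).
  move=> mF; apply: measurable_funM; first exact: measurable_weight.
  exact: measurable_norm_fun.
have jg l : (l < 4)%N -> L1 setT (fun x => weight x * `|g l x|).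
  move=> l4; exact: (ae_eq_L1 (@measurableT _ mR) (fgw _ l4) (mw _ (mg _ l4)) (jw _ l4)).
have ig l : (l < 4)%N -> \int[mu]_(x in setT) (weight x * `|g l x|) <= N.
  move=> l4; rewrite -(ae_eq_Rintegral (@measurableT _ mR) (fgw _ l4) (mw _ (mf _ l4)) (mw _ (mg _ l4))).
  exact: iw.
exists g; first split=> //.
- move=> l x l3; rewrite {1}/g l3 sub0r normrN.
  apply: le_trans (iw _ (l3 : (l.+1 < 4)%N)).
  apply: norm_Rintegral_sub => //.
  + by apply: measurable_funTS; exact: mf.
  + exact: jw.
  + by move=> y _; rewrite mulr_ge0 // (le_trans ler01) ?weight_ge1.
  + by move=> y _; rewrite ler_peMl // weight_ge1.
(* A weak derivative of order 0 agrees with [u] only almost everywhere. *)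
- have [ju _ w0] := wf 0%N isT; have [mu_ jul] := locally_integrable_L1 ju.
  have uf : {ae mu, forall x, u x - f 0%N x = 0}.
    apply: test_orthogonal_ae0 => [a b ab|psi tpsi].
      by apply: L1B => //; [exact: jul|exact: L1_setT_itv (jf 0%N isT)].
    have := w0 _ tpsi; rewrite expr0 mul1r derive1n0 => E0.
    under eq_Rintegral do rewrite mulrBl.
    rewrite RintegralB ?E0 ?subrr //; apply: test_L1 => // a b _.
    exact: L1_setT_itv (jf 0%N isT).
  apply: (ae_imp2 uf (fg 0%N isT)) => x /eqP; rewrite subr_eq0 => /eqP -> ->.
  by [].
Qed.

Lemma measurable_normc (z : R -> R[i]) : mfun (fun x => complex.Re (z x)) ->
  mfun (fun x => complex.Im (z x)) -> mfun (fun x => Normc.normc (z x)).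
Proof.
move=> mr mi.
have -> : (fun x => Normc.normc (z x)) =
    (fun x => Num.sqrt (complex.Re (z x) ^+ 2 + complex.Im (z x) ^+ 2)).
  by apply/funext => x; case: (z x).
apply: (measurableT_comp (f := @Num.sqrt R)).
  by apply: continuous_measurable_fun => x; exact: sqrt_continuous.
by apply: measurable_funD; apply: measurable_funX.
Qed.

Lemma sobolev_real_chains (u : R -> R[i]) : sobolev 3 3 u ->
  let N := fine (sobolev_norm 3 3 u) in
  [/\ 0 <= N, sobolev_norm 3 3 u = N%:E,
  (exists2 g, sobolev_chain N g & {ae mu, forall x, complex.Re (u x) = g 0%N x}) &
  (exists2 g, sobolev_chain N g & {ae mu, forall x, complex.Im (u x) = g 0%N x})].
Proof.
move=> [wu su] N; pose f l := weak_derivative l u.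
have wf l : (l < 4)%N -> is_weak_derivative l u (f l).
  by move=> l4; have := xgetPex (fun=> 0) (wu l l4).
have n0 x : 0 <= weight x by rewrite (le_trans ler01) ?weight_ge1.
have nn l : (0%E <= L1_norm 3 (f l))%E.
  by apply: integral_ge0 => x _; rewrite lee_fin mulr_ge0 // ?n0 // normc_ge0.
have s0 : (0%E <= sobolev_norm 3 3 u)%E by apply: sume_ge0 => i _; exact: nn.
have NE : sobolev_norm 3 3 u = N%:E by rewrite fineK // ge0_fin_numE.
have fN l : (l < 4)%N -> (L1_norm 3 (f l) <= N%:E)%E.
  move=> l4; rewrite -NE /sobolev_norm (bigD1 (Ordinal l4)) //= leeDl //.
  by apply: sume_ge0 => i _; exact: nn.
have mr l : (l < 4)%N -> mfun (fun x => complex.Re (f l x)).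
  by move=> /wf[[_ /locally_integrable_L1[]]].
have mi l : (l < 4)%N -> mfun (fun x => complex.Im (f l x)).
  by move=> /wf[_ [_ /locally_integrable_L1[]]].
have jn l : (l < 4)%N -> L1 setT (fun x => weight x * Normc.normc (f l x)).
  move=> l4; apply/integrableP; split.
    apply/measurable_EFinP; apply: measurable_funM; first exact: measurable_weight.
    by apply: measurable_normc; [exact: mr|exact: mi].
  apply: le_lt_trans (ltry N); apply: le_trans (fN _ l4); rewrite le_eqVlt.
  apply/orP; left; apply/eqP; apply: eq_integral => x _ /=.
  by rewrite ger0_norm ?mulr_ge0 ?n0 ?normc_ge0 // mulrC.
have jin l : (l < 4)%N ->
    \int[mu]_(x in setT) (weight x * Normc.normc (f l x)) <= N.
  move=> l4; rewrite -lee_fin; apply: le_trans (fN _ l4).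
  rewrite /Rintegral fineK; last exact: integrable_fin_num (jn _ l4).
  by rewrite le_eqVlt; apply/orP; left; apply/eqP; apply: eq_integral => x _ /=; rewrite mulrC.
have H (p : R[i] -> R) : (forall z, `|p z| <= Normc.normc z) ->
    (forall l, (l < 4)%N -> mfun (fun x => p (f l x))) ->
    (forall l, (l < 4)%N -> is_weak_derivative_real l (fun x => p (u x)) (fun x => p (f l x))) ->
    exists2 g, sobolev_chain N g & {ae mu, forall x, p (u x) = g 0%N x}.
  move=> pn mp wp.
  have jp l : (l < 4)%N -> L1 setT (fun x => weight x * `|p (f l x)|).
    move=> l4; apply: L1_dominated (jn _ l4) _ => //.
      apply: measurable_funM; first exact: measurable_weight.
      exact: measurable_norm_fun (mp _ l4).
    by move=> x _; rewrite normrM normr_id ger0_norm // ler_wpM2l.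
  apply: (sobolev_chain_exists (f := fun l x => p (f l x)) wp jp) => l l4.
  apply: le_trans (jin _ l4); apply: le_Rintegral => //.
  - exact: jp.
  - exact: jn.
  - by move=> x _; rewrite ler_wpM2l.
split=> //.
- by rewrite -lee_fin -NE.
- by apply: H => [|l|l /wf[]//]; [exact: norm_Re_le|exact: mr].
- by apply: H => [|l|l /wf[]//]; [exact: norm_Im_le|exact: mi].
Qed.

(** It serves to pass from a sum over nonzero integers to series over [nat]: a partial sum along the
    injection [e] is a finite subsum of the [esum]. *)
Lemma fine_esum_bound (T : choiceType) (a : T -> R) (e : nat -> T) (S : set T) :
  injective e -> (forall n, S (e n)) -> (forall t, S t -> 0 <= a t) ->
  (\esum_(t in S) (a t)%:E < +oo)%E ->
  exists M : R, forall n, \sum_(0 <= i < n) a (e i) <= M.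
Proof.
move=> inje Se a0 fin.
have S0 : (0%E <= \esum_(t in S) (a t)%:E)%E.
  by apply: esum_ge0 => t St; rewrite lee_fin a0.
exists (fine (\esum_(t in S) (a t)%:E)) => n.
rewrite -lee_fin fineK ?ge0_fin_numE // -sumEFin.
apply: esum_ge; exists (e @` `I_n).
  by split=> [|_ [m _ <-]]; [apply: finite_image; exact: finite_II|exact: Se].
rewrite (reindex_fsbig e `I_n) -?fsbig_ord ?big_mkord //.
by split=> [i In|i j _ _ /inje//|t]; first by exists i.
Qed.

(** * Series of integrable functions *)

(** [limn] has the default value 0 where the sequence diverges. The set [D] where the upper and
    lower limits are finite and equal is measurable, and the function is the upper limit on [D] and
    0 elsewhere. *)
Lemma measurable_limn (u : nat -> R -> R) : (forall n, mfun (u n)) ->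
  mfun (fun x => limn (fun n => u n x)).
Proof.
move=> mu_; pose eu n (x : mR) := (u n x)%:E.
have meu n : measurable_fun (setT : set mR) (eu n) by exact/measurable_EFinP.
pose h (x : mR) := limn_esup (eu^~ x); pose k (x : mR) := limn_einf (eu^~ x).
have mh : measurable_fun (setT : set mR) h by exact: measurable_fun_limn_esup.
have mk : measurable_fun (setT : set mR) k.
  apply: measurableT_comp => //; apply: measurable_fun_limn_esup => n.
  exact: measurableT_comp.
have mfh : mfun (fine \o h) by apply: measurableT_comp.
have mfk : mfun (fine \o k) by apply: measurableT_comp.
pose D := [set x : mR | h x \is a fin_num] `&` [set x : mR | k x \is a fin_num]
  `&` [set x : mR | (fine (h x) == fine (k x)) ].
have mD : measurable D.
  apply: measurableI; first apply: measurableI.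
  - by rewrite -[X in measurable X]setTI; exact: emeasurable_fin_num.
  - by rewrite -[X in measurable X]setTI; exact: emeasurable_fin_num.
  - have := measurable_fun_eqr mfh mfk => /(_ measurableT [set true] I).
    by rewrite setTI.
suff -> : (fun x => limn (fun n => u n x)) = (fun x => \1_D x * fine (h x)).
  apply: measurable_funM => //; exact/measurable_indicP.
apply/funext => x; rewrite indicE; case: (pselect (D x)) => Dx.
  rewrite mem_set // mul1r; apply/cvg_lim => //.
  move: Dx => [[hf kf] /eqP hk].
  have cs : esups (eu^~ x) @ \oo --> (fine (h x))%:E.
    by rewrite fineK // /h limn_esup_lim; exact: is_cvg_esups.
  have ci : einfs (eu^~ x) @ \oo --> (fine (h x))%:E.
    by rewrite hk fineK // /k limn_einf_lim; exact: is_cvg_einfs.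
  suff : eu n x @[n --> \oo] --> (fine (h x))%:E by move=> /fine_cvgP[_].
  apply: squeeze_cvge ci cs; apply: nearW => n; apply/andP; split.
    by apply: ereal_inf_lbound; exists n => //=.
  by apply: ereal_sup_ubound; exists n => //=.
rewrite memNset // mul0r dvgP // => cu; apply: Dx.
have ceu : eu n x @[n --> \oo] --> (limn (fun n => u n x))%:E.
  by apply: cvg_EFin; [exact: nearW|exact: cu].
have [e1 e2] := cvg_limn_einf_sup ceu.
by rewrite /D /= /h /k e1 e2.
Qed.

(** By monotone convergence the sum [S] of the weighted absolute values has integral at most [M],
    hence is finite almost everywhere. The witness [g] is [fine S / weight], which dominates the
    partial sums wherever [S] is finite. *)
Lemma weighted_series (f : nat -> R -> R) (c : nat -> R) (M : R) :
  (forall n, mfun (f n)) ->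
  (forall n, L1 setT (fun x => weight x * `|f n x|)) ->
  (forall n, \int[mu]_(x in setT) (weight x * `|f n x|) <= c n) ->
  (forall n, \sum_(0 <= i < n) c i <= M) ->
  exists g, [/\ mfun g, L1 setT (fun x => weight x * g x),
    \int[mu]_(x in setT) (weight x * g x) <= M, (forall x, 0 <= g x) &
    {ae mu, forall x, forall n, \sum_(0 <= i < n) `|f i x| <= g x}].
Proof.
move=> mf jf fc cM.
have w0 x : 0 < weight x by rewrite (lt_le_trans ltr01) ?weight_ge1.
have mw : mfun (fun x => weight x) by exact: measurable_weight.
pose e (n : nat) (x : mR) := (weight x * `|f n x|)%:E.
have me n : measurable_fun (setT : set mR) (e n).
  apply/measurable_EFinP; apply: measurable_funM => //; exact: measurable_norm_fun.
have e0 n x : (0%E <= e n x)%E by rewrite lee_fin mulr_ge0 // ltW.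
pose S (x : mR) := (\sum_(n <oo) e n x)%E.
have mS : measurable_fun (setT : set mR) S.
  by apply: ge0_emeasurable_sum => // n x _ _.
have S0 x : (0%E <= S x)%E by apply: nneseries_ge0 => n _ _.
have SM : (\int[mu]_(x in setT) S x <= M%:E)%E.
  rewrite integral_nneseries //; apply: lime_le.
    by apply: is_cvg_nneseries => n _ _; apply: integral_ge0.
  apply: nearW => n; apply: le_trans (_ : (\sum_(0 <= i < n) (c i)%:E <= _)%E).
    apply: lee_sum => i _; rewrite -(fineK (integrable_fin_num (@measurableT _ mR) (jf i))).
    rewrite lee_fin; exact: fc.
  by rewrite sumEFin lee_fin.
have jS : mu.-integrable setT S.
  apply/integrableP; split=> //; apply: le_lt_trans (ltry M); apply: le_trans SM.
  by apply: ge0_le_integral => // [|x _]; [exact: measurableT_comp|rewrite gee0_abs].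
have fS : {ae mu, forall x, [set: R] x -> S x \is a fin_num}.
  exact: integrable_ae.
pose g x := fine (S x) / weight x.
have gE x : weight x * g x = fine (S x) by rewrite mulrC divfK // gt_eqF.
have mfS : mfun (fine \o S) by apply: measurableT_comp.
have jfS : L1 setT (fine \o S).
  apply: le_integrable jS => //; first exact/measurable_EFinP.
  move=> x _ /=; case: (S x) (S0 x) => [r||] //=; by rewrite normr0 leey.
exists g; split.
- apply: measurable_funM => //; apply: continuous_measurable_fun => x.
  apply: cvgV; first by rewrite gt_eqF.
  apply: (@continuous_comp _ _ _ (fun y => 1 + `|y|) (fun y => y ^+ 3)); last exact: exprn_continuous.
  by apply: cvgD; [exact: cvg_cst|apply: cvg_norm; exact: cvg_id].
- by apply: L1_eq jfS.
- rewrite -lee_fin /Rintegral.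
  under eq_integral do rewrite gE.
  apply: le_trans SM; rewrite fineK; last exact: integrable_fin_num jfS.
  apply: ge0_le_integral => //; first by move=> x _; rewrite lee_fin fine_ge0.
    exact/measurable_EFinP.
  move=> x _; case: (S x) (S0 x) => [r||] //=; by rewrite leey.
- move=> x; rewrite /g mulr_ge0 ?fine_ge0 // invr_ge0 ltW //.
- apply: (ae_imp fS) => x /(_ I) fSx n.
  rewrite /g ler_pdivlMr // mulrC mulr_sumr -lee_fin fineK // -sumEFin.
  exact: (nneseries_lim_ge (u_ := e^~ x) (P := xpredT) (m := 0%N) n (fun i _ _ => e0 i x)).
Qed.

Lemma weighted_dominated F g (M : R) : mfun F -> mfun g -> (forall x, 0 <= g x) ->
  L1 setT (fun x => weight x * g x) -> \int[mu]_(x in setT) (weight x * g x) <= M ->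
  {ae mu, forall x, `|F x| <= g x} ->
  L1 setT (fun x => weight x * `|F x|) /\
  \int[mu]_(x in setT) (weight x * `|F x|) <= M.
Proof.
move=> mF mg g0 jg gM Fg.
have w0 x : 0 < weight x by rewrite (lt_le_trans ltr01) ?weight_ge1.
have mw : mfun (fun x => weight x * `|F x|).
  by apply: measurable_funM; [exact: measurable_weight|exact: measurable_norm_fun].
have le : (\int[mu]_(x in setT) (weight x * `|F x|)%:E <=
    \int[mu]_(x in setT) (weight x * g x)%:E)%E.
  apply: ae_ge0_le_integral => //.
  - by move=> x _; rewrite lee_fin mulr_ge0 // ltW.
  - exact/measurable_EFinP.
  - by move=> x _; rewrite lee_fin mulr_ge0 // ltW.
  - exact: measurable_int jg.
  - by apply: (ae_imp Fg) => x h _; rewrite lee_fin ler_wpM2l // ltW.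
have jF : L1 setT (fun x => weight x * `|F x|).
  apply/integrableP; split; first exact/measurable_EFinP.
  have [_ +] := integrableP _ _ _ jg; apply: le_lt_trans.
  under eq_integral do rewrite /= ger0_norm ?mulr_ge0 ?(ltW (w0 _)) //.
  under [leRHS]eq_integral do rewrite /= ger0_norm ?mulr_ge0 ?(ltW (w0 _)) //.
  exact: le.
split=> //; apply: le_trans gM; rewrite /Rintegral fine_le //.
- exact: integrable_fin_num jF.
- exact: integrable_fin_num jg.
Qed.

Lemma ac_limit (F f : nat -> R -> R) (G h g : R -> R) : (forall n, ac (F n) (f n)) ->
  (forall x, F n x @[n --> \oo] --> G x) -> mfun h ->
  {ae mu, forall x, f n x @[n --> \oo] --> h x} -> L1 setT g ->
  {ae mu, forall x n, `|f n x| <= g x} -> ac G h.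
Proof.
move=> acF FG mh fh jg fg a b ab.
have [//|n||//|||jh ch] := @Rdominated_cvg `[a, b]%classic f h g.
- by apply: measurable_funTS; exact: ac_measurable_deriv (acF n).
- exact: measurable_funTS.
- by apply: (ae_imp fh) => x h1 _.
- exact: L1_setT_itv.
- by apply: (ae_imp fg) => x h1 n _.
split=> //; apply/esym/(cvg_unique _ ch) => //.
have -> : (fun n => \int[mu]_(x in `[a, b]) f n x) = (fun n => F n b - F n a).
  by apply/funext => n; have [_ ->] := acF n _ _ ab.
exact: cvgB.
Qed.

Lemma is_cvg_series_bounded (u : nat -> R) (M : R) :
  (forall n, \sum_(0 <= i < n) `|u i| <= M) ->
  cvgn (fun n => \sum_(0 <= i < n) u i) /\
  (`|limn (fun n => (\sum_(0 <= i < n) u i)%R)| <= M).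
Proof.
move=> uM; have cu : cvgn (series u).
  apply: normed_cvg; apply: nondecreasing_is_cvgn; first by apply: nondecreasing_series => n _ _; exact: normr_ge0.
  by exists M => _ [n _ <-]; exact: uM.
split=> //; have cn : `|series u n| @[n --> \oo] --> `|limn (series u)|.
  exact: cvg_norm.
rewrite (_ : limn _ = limn (series u)) // -(cvg_lim (@norm_hausdorff _ _) cn).
apply: limr_le; first by apply/cvg_ex; eexists; exact: cn.
by apply: nearW => n; apply: le_trans (uM n); exact: ler_norm_sum.
Qed.

(** * Calculus of weighted integral bounds *)

Definition weighted_bound (c : R) f := [/\ mfun f,
  L1 setT (fun x => weight x * `|f x|) &
  \int[mu]_(x in setT) (weight x * `|f x|) <= c].

Lemma weight_ge0 x : 0 <= weight x.
Proof. by rewrite (le_trans ler01) ?weight_ge1. Qed.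

#[local] Hint Resolve weight_ge0 : core.

Lemma weighted_bound_L1 c f : weighted_bound c f -> L1 setT f.
Proof. by case=> mf jf _; exact: L1_weight. Qed.

Lemma weighted_bound_norm c f : weighted_bound c f ->
  \int[mu]_(x in setT) `|f x| <= c.
Proof.
move=> wf; have [mf jf fc] := wf; apply: le_trans fc; apply: le_Rintegral => //.
  exact: L1_norm_fun (weighted_bound_L1 wf).
by move=> x _; rewrite ler_peMl // weight_ge1.
Qed.

Lemma weighted_bound_sq c f : weighted_bound c f ->
  L1 setT (fun x => (1 + `|x|) ^+ 2 * `|f x|) /\
  \int[mu]_(x in setT) ((1 + `|x|) ^+ 2 * `|f x|) <= c.
Proof.
move=> [mf jf fc].
have le x : (1 + `|x|) ^+ 2 * `|f x| <= weight x * `|f x|.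
  by rewrite ler_wpM2r // /weight exprS ler_peMl ?exprn_ge0 ?addr_ge0 ?lerDl.
have j2 : L1 setT (fun x => (1 + `|x|) ^+ 2 * `|f x|).
  apply: L1_dominated jf _ => //.
    by apply: measurable_funM; [exact: measurable_weight|exact: measurable_norm_fun].
  by move=> x _; rewrite ger0_norm // mulr_ge0 // exprn_ge0 // addr_ge0.
by split=> //; apply: le_trans fc; exact: le_Rintegral.
Qed.

Lemma weighted_bound_le c d f : weighted_bound c f -> c <= d -> weighted_bound d f.
Proof. by move=> [mf jf fc] cd; split=> //; exact: le_trans cd. Qed.

Lemma weighted_bound_eq c f g : weighted_bound c f -> f =1 g -> weighted_bound c g.
Proof. by move=> wf /funext <-. Qed.

Lemma weighted_bound_dominated c f g : mfun f -> weighted_bound c g ->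
  (forall x, `|f x| <= `|g x|) -> weighted_bound c f.
Proof.
move=> mf [mg jg gc] fg.
have [||||||h1 h2] := @weighted_dominated f (fun x => `|g x|) c => //.
- exact: measurable_norm_fun.
- exact: aeW.
Qed.

Lemma weighted_boundD c d f g : weighted_bound c f -> weighted_bound d g ->
  weighted_bound (c + d) (fun x => f x + g x).
Proof.
move=> [mf jf fc] [mg jg gd].
have j : L1 setT (fun x => weight x * `|f x| + weight x * `|g x|) by exact: L1D.
have mfg : mfun (fun x => f x + g x) by exact: measurable_funD.
have le x : weight x * `|f x + g x| <= weight x * `|f x| + weight x * `|g x|.
  by rewrite -mulrDr ler_wpM2l // ler_normD.
have jfg : L1 setT (fun x => weight x * `|f x + g x|).
  apply: L1_dominated j _ => //.
    by apply: measurable_funM; [exact: measurable_weight|exact: measurable_norm_fun].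
  by move=> x _; rewrite ger0_norm // mulr_ge0.
split=> //; apply: le_trans (lerD fc gd); rewrite -RintegralD //.
exact: le_Rintegral.
Qed.

Lemma weighted_boundZ k c f : weighted_bound c f ->
  weighted_bound (`|k| * c) (fun x => k * f x).
Proof.
move=> [mf jf fc].
have E x : `|k| * (weight x * `|f x|) = weight x * `|k * f x|.
  by rewrite normrM mulrCA.
split.
- by apply: measurable_funM => //; exact: measurable_cst.
- by apply: L1_eq (L1Z `|k| (@measurableT _ mR) jf) => // x _; rewrite E.
- under eq_Rintegral do rewrite -E.
  by rewrite RintegralZl // ler_wpM2l.
Qed.

Lemma weighted_boundM c d f g : mfun f -> (forall x, `|f x| <= d) ->
  weighted_bound c g -> weighted_bound (d * c) (fun x => f x * g x).
Proof.
move=> mf fd wg; have d0 : 0 <= d by apply: le_trans (fd 0).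
have [mg _ _] := wg; rewrite -(ger0_norm d0).
apply: weighted_bound_dominated (weighted_boundZ d wg) _.
  exact: measurable_funM.
by move=> x; rewrite !normrM ler_wpM2r // (ger0_norm d0).
Qed.

Lemma weighted_bound_sum (f : nat -> R -> R) (c : nat -> R) n :
  (forall n, weighted_bound (c n) (f n)) ->
  weighted_bound (\sum_(0 <= i < n) c i) (fun x => \sum_(0 <= i < n) f i x).
Proof.
move=> wf; elim: n => [|n IH].
  have := weighted_boundZ 0 (wf 0%N); rewrite normr0 mul0r => w0.
  by rewrite big_geq //; apply: weighted_bound_eq w0 _ => x; rewrite mul0r big_geq.
rewrite big_nat_recr //=; apply: weighted_bound_eq (weighted_boundD IH (wf n)) _ => x.
by rewrite big_nat_recr.
Qed.

(** Besides the bound on the sum, the single function [g] dominates all partial sums at once, as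
    dominated convergence requires. *)
Lemma weighted_bound_series (f : nat -> R -> R) (c : nat -> R) (M : R) :
  (forall n, weighted_bound (c n) (f n)) ->
  (forall n, \sum_(0 <= i < n) c i <= M) ->
  let F x := limn (fun n => (\sum_(0 <= i < n) f i x)%R) in
  weighted_bound M F /\ exists g, [/\ weighted_bound M g, forall x, 0 <= g x,
   {ae mu, forall x n, \sum_(0 <= i < n) `|f i x| <= g x} &
   {ae mu, forall x, (\sum_(0 <= i < n) f i x)%R @[n --> \oo] --> F x}].
Proof.
move=> wf cM F.
have mf n : mfun (f n) by case: (wf n).
have jf n : L1 setT (fun x => weight x * `|f n x|) by case: (wf n).
have fc n : \int[mu]_(x in setT) (weight x * `|f n x|) <= c n by case: (wf n).
have [g [mg jg gM g0 fg]] := weighted_series mf jf fc cM.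
have wg : weighted_bound M g.
  split=> //; first by apply: L1_eq jg => // x _; rewrite ger0_norm.
  by under eq_Rintegral do rewrite ger0_norm //.
have mF : mfun F by apply: measurable_limn => n; exact: measurable_sum.
split.
  have [|] := weighted_dominated mF mg g0 jg gM; last by split.
  by apply: (ae_imp fg) => x /is_cvg_series_bounded[].
exists g; split=> //.
by apply: (ae_imp fg) => x /is_cvg_series_bounded[].
Qed.

(** * Oscillating integrals and the corrector *)

(** [F] has a limit at each end because [f] is integrable, and both limits are 0 because [F] is
    integrable. *)
Lemma ac_Rintegral_eq0 F f : ac F f -> L1 setT F -> L1 setT f ->
  \int[mu]_(x in setT) f x = 0.
Proof.
have half G g : ac G g -> L1 setT G -> L1 setT g -> \int[mu]_(x in `[0, +oo[) g x = - G 0.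
  move=> acG jG jg; have H := ac_cvgy (a := 0) acG jg.
  by apply/eqP; rewrite -addr_eq0 addrC; apply/eqP; exact: L1_cvgy_eq0 H.
move=> acF jF jf; have mf := ac_measurable_deriv acF; have mF := ac_measurable acF.
have jFr : L1 setT (fun x => F (- x)).
  by have := L1_reflect (@measurableT _ mR) mF jF; rewrite preimage_setT.
have jfr : L1 setT (fun x => f (- x)).
  by have := L1_reflect (@measurableT _ mR) mf jf; rewrite preimage_setT.
rewrite (Rintegral_halves jf) (half _ _ acF jF jf).
have := half _ _ (ac_reflect acF) jFr (L1N (@measurableT _ mR) jfr); rewrite oppr0.
have -> : \int[mu]_(x in `[0, +oo[) (- f (- x)) = - \int[mu]_(x in `[0, +oo[) f (- x).
  under eq_Rintegral do rewrite -mulN1r.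
  rewrite RintegralZl ?mulN1r //; exact: L1_setT_ray jfr.
by move=> /oppr_inj ->; rewrite addNr.
Qed.

Lemma chain_L1 (N : R) (g : nat -> R -> R) l : sobolev_chain N g -> (l < 4)%N ->
  weighted_bound N (g l).
Proof.
move=> cg l4; split; [exact: sobolev_chain_meas cg _ l4|exact: sobolev_chain_L1 cg _ l4|].
exact: sobolev_chain_int cg _ l4.
Qed.

Section Oscillation.
Variables (N1 N2 : R) (f g : nat -> R -> R).
Hypothesis cf : sobolev_chain N1 f.
Hypothesis cg : sobolev_chain N2 g.

Lemma chain_prod_bound i j : (i < 3)%N -> (j < 4)%N ->
  weighted_bound (N1 * N2) (fun x => f i x * g j x).
Proof.
move=> i3 j4; apply: weighted_boundM; last exact: chain_L1.
- exact: sobolev_chain_meas cf _ (ltnW i3 : (i < 4)%N).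
- by move=> x; exact: sobolev_chain_sup.
Qed.

Let fg x := f 0%N x * g 0%N x.
Let dfg x := f 1%N x * g 0%N x + f 0%N x * g 1%N x.

Let fg_ac : ac fg dfg.
Proof. exact: acM (sobolev_chain_ac cf (l := 0) isT) (sobolev_chain_ac cg (l := 0) isT). Qed.

Let dfg_bound : weighted_bound (2 * (N1 * N2)) dfg.
Proof.
by rewrite mulr_natl mulr2n; apply: weighted_boundD; exact: chain_prod_bound.
Qed.

(** One integration by parts: the integral of [p' f g] is [- w^-1] times that of [p (f g)'], and the
    factor 2 counts the two terms of [(f g)']. *)
Let oscillation_bound (p p' : R -> R) (w : R) : w != 0 ->
  ac p (fun x => w * p' x) -> (forall x, `|p x| <= 1) -> (forall x, `|p' x| <= 1) ->
  mfun p' -> `|\int[mu]_(x in setT) (fg x * p' x)| <= 2 * (N1 * N2) * `|w|^-1.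
Proof.
move=> w0 acp p1 p'1 mp'.
have mp := ac_measurable acp.
have b1 : weighted_bound (1 * (2 * (N1 * N2))) (fun x => p x * dfg x) by exact: weighted_boundM.
have b2 : weighted_bound (1 * (N1 * N2)) (fun x => p' x * fg x).
  by apply: weighted_boundM => //; exact: chain_prod_bound.
have b3 : weighted_bound (1 * (N1 * N2)) (fun x => p x * fg x).
  by apply: weighted_boundM => //; exact: chain_prod_bound.
have j1 := weighted_bound_L1 b1; have j2 := weighted_bound_L1 b2.
have j2w := L1Z w (@measurableT _ mR) j2.
have ac0 : ac (fun x => p x * fg x) (fun x => p x * dfg x + w * (p' x * fg x)).
  by apply: ac_eq (acM acp fg_ac) _ _ => // x; ring.
have := ac_Rintegral_eq0 ac0 (weighted_bound_L1 b3) (L1D (@measurableT _ mR) j1 j2w).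
rewrite RintegralD // RintegralZl // => /eqP.
rewrite addrC addr_eq0 => /eqP E0.
have -> : \int[mu]_(x in setT) (fg x * p' x) = - (w^-1 * \int[mu]_(x in setT) (p x * dfg x)).
  under eq_Rintegral do rewrite mulrC.
  by rewrite -mulrN -E0 mulKf.
rewrite normrN normrM normfV mulrC ler_wpM2r // ?invr_ge0 //.
rewrite -[leRHS]mul1r; apply: le_trans (weighted_bound_norm b1).
exact: le_normr_Rintegral.
Qed.

Lemma oscillation_cos (w : R) : w != 0 ->
  `|\int[mu]_(x in setT) (f 0%N x * g 0%N x * cos (w * x))| <= 2 * (N1 * N2) * `|w|^-1.
Proof.
move=> w0; apply: (oscillation_bound (p := fun x => sin (w * x))) => //.
- exact: ac_sin_linear.
- by move=> x; exact: sin_max.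
- by move=> x; exact: cos_max.
- exact: measurable_cos_linear.
Qed.

Lemma oscillation_sin (w : R) : w != 0 ->
  `|\int[mu]_(x in setT) (f 0%N x * g 0%N x * sin (w * x))| <= 2 * (N1 * N2) * `|w|^-1.
Proof.
(* The derivative of [cos(wx)] is [- w sin(wx)], so the previous bound is used with [- w]. *)
move=> w0; rewrite -[`|w|]normrN.
apply: (oscillation_bound (p := fun x => cos (w * x))); rewrite ?oppr_eq0 //.
- exact: ac_cos_linear.
- by move=> x; exact: cos_max.
- by move=> x; exact: sin_max.
- exact: measurable_sin_linear.
Qed.

End Oscillation.

Section Corrector.
Variables (a b : nat -> nat -> R -> R) (N om : nat -> R) (M dl : R).
Hypothesis ca : forall n, sobolev_chain (N n) (a n).
Hypothesis cb : forall n, sobolev_chain (N n) (b n).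
Hypothesis NM : forall n, \sum_(0 <= i < n) N i <= M.
Hypothesis dl_le1 : dl <= 1.
Hypothesis om_neq0 : forall n, om n != 0.
Hypothesis om_inv : forall n, `|om n|^-1 <= dl.
Hypothesis omD_neq0 : forall i j, om i + om j != 0.
Hypothesis omD_inv : forall i j, `|om i + om j|^-1 <= dl.
Hypothesis omB_neq0 : forall i j, i != j -> om i - om j != 0.
Hypothesis omB_inv : forall i j, i != j -> `|om i - om j|^-1 <= dl.

Let N_ge0 n : 0 <= N n.
Proof. exact: le_trans (sobolev_chain_sup (ca n) (l := 0) 0 isT). Qed.

Let M_ge0 : 0 <= M.
Proof. by have := NM 0; rewrite big_geq. Qed.

Let dl_ge0 : 0 <= dl.
Proof. by apply: le_trans (om_inv 0); rewrite invr_ge0. Qed.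

Let r n := (om n)^-1.

Let r_le n : `|r n| <= dl.
Proof. by rewrite normfV. Qed.

Let rX_le n k : `|r n ^+ k| <= dl ^+ k.
Proof. by rewrite normrX lerXn2r // nnegrE. Qed.

Let dlX_le k : dl ^+ k.+1 <= dl.
Proof. by rewrite exprS ler_piMr // exprn_ile1. Qed.

Let sn n x := sin (om n * x).
Let cs n x := cos (om n * x).

(* The real and imaginary parts of (a + i b) e^(i om x): twice the real part is
   the n-th term of the potential. *)
Definition im_osc l n x := a n l x * sn n x + b n l x * cs n x.
Definition re_osc l n x := a n l x * cs n x - b n l x * sn n x.

Lemma ac_im_osc l n : (l < 3)%N ->
  ac (im_osc l n) (fun x => im_osc l.+1 n x + om n * re_osc l n x).
Proof.
move=> l3; apply: ac_eq (acD (acM (sobolev_chain_ac (ca n) l3) (ac_sin_linear (om n)))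
  (acM (sobolev_chain_ac (cb n) l3) (ac_cos_linear (om n)))) _ _ => // x.
rewrite /im_osc /re_osc /sn /cs; ring.
Qed.

Lemma ac_re_osc l n : (l < 3)%N ->
  ac (re_osc l n) (fun x => re_osc l.+1 n x - om n * im_osc l n x).
Proof.
move=> l3; apply: ac_eq (acB (acM (sobolev_chain_ac (ca n) l3) (ac_cos_linear (om n)))
  (acM (sobolev_chain_ac (cb n) l3) (ac_sin_linear (om n)))) _ _ => // x.
rewrite /im_osc /re_osc /sn /cs; ring.
Qed.

Let trig_bound (p : R -> R) (c : R) f : (forall x, `|p x| <= 1) -> mfun p ->
  weighted_bound c f -> weighted_bound c (fun x => f x * p x).
Proof.
move=> p1 mp wf; rewrite -[c]mul1r.
by apply: weighted_bound_eq (weighted_boundM mp p1 wf) _ => x; rewrite mulrC.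
Qed.

Lemma im_osc_bound l n : (l < 4)%N -> weighted_bound (2 * N n) (im_osc l n).
Proof.
move=> l4; rewrite mulr_natl mulr2n; apply: weighted_boundD; apply: trig_bound.
- by move=> x; exact: sin_max.
- exact: measurable_sin_linear.
- exact: chain_L1.
- by move=> x; exact: cos_max.
- exact: measurable_cos_linear.
- exact: chain_L1.
Qed.

Lemma re_osc_bound l n : (l < 4)%N -> weighted_bound (2 * N n) (re_osc l n).
Proof.
move=> l4; have := weighted_boundZ (-1) (chain_L1 (cb n) l4).
rewrite normrN1 mul1r => wb.
rewrite mulr_natl mulr2n.
apply: weighted_bound_eq (weighted_boundD (f := fun x => a n l x * cs n x)
  (g := fun x => (-1 * b n l x) * sn n x) _ _) _.
- apply: trig_bound; [by move=> x; exact: cos_max|exact: measurable_cos_linear|exact: chain_L1].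
- by apply: trig_bound; [by move=> x; exact: sin_max|exact: measurable_sin_linear|].
- by move=> x; rewrite /re_osc mulN1r mulNr.
Qed.

Lemma osc_sup l n x : (l < 3)%N -> `|im_osc l n x| <= 2 * N n /\ `|re_osc l n x| <= 2 * N n.
Proof.
move=> l3; have ha := sobolev_chain_sup (ca n) x l3; have hb := sobolev_chain_sup (cb n) x l3.
have s1 : `|sn n x| <= 1 by exact: sin_max.
have c1 : `|cs n x| <= 1 by exact: cos_max.
have E (u v : R) : `|u| <= N n -> `|v| <= 1 -> `|u * v| <= N n.
  by move=> h1 h2; rewrite normrM -[N n]mulr1 ler_pM.
rewrite mulr_natl mulr2n; split.
  by apply: le_trans (ler_normD _ _) _; rewrite lerD // E.
by apply: le_trans (ler_normB _ _) _; rewrite lerD // E.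
Qed.

(* [cor] comes from integrating [2 * re_osc 0] three times by parts, and [err]
   is what remains. *)
Let rem n x := 2 * r n ^+ 2 * re_osc 1 n x - 2 * r n ^+ 3 * im_osc 2 n x.
Let cor n x := 2 * r n * im_osc 0 n x + rem n x.
Let err n x := 2 * r n ^+ 3 * im_osc 3 n x.

(** The sum telescopes: the derivative of each of the three terms produces a multiple of the next
    oscillation, which the following term cancels, leaving [2 re_osc 0] and the third order
    remainder. *)
Lemma cor_ac n : ac (cor n) (fun x => 2 * re_osc 0 n x - err n x).
Proof.
have h0 := acZ (2 * r n) (ac_im_osc n (l := 0) isT).
have h1 := acZ (2 * r n ^+ 2) (ac_re_osc n (l := 1) isT).
have h2 := acZ (2 * r n ^+ 3) (ac_im_osc n (l := 2) isT).
apply: ac_eq (acD h0 (acB h1 h2)) _ _ => // x.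
rewrite /err /r; move: (om_neq0 n) => o0; by field.
Qed.

Let coef_le n k : `|2 * r n ^+ k| <= 2 * dl ^+ k.
Proof. by rewrite normrM ger0_norm // ler_wpM2l. Qed.

Lemma rem_sup n x : `|rem n x| <= 8 * dl ^+ 2 * N n.
Proof.
have [h1 _] := osc_sup n x (l := 2) isT; have [_ h2] := osc_sup n x (l := 1) isT.
apply: le_trans (ler_normB _ _) _; rewrite normrM [X in _ + X]normrM.
have d3 : dl ^+ 3 <= dl ^+ 2 by rewrite exprS ler_piMl // exprn_ge0.
have := ler_pM (normr_ge0 _) (normr_ge0 _) (coef_le n 2) h2.
have := ler_pM (normr_ge0 _) (normr_ge0 _) (coef_le n 3) h1.
have := ler_wpM2r (N_ge0 n) d3; lra.
Qed.

Lemma main_sup n x : `|2 * r n * im_osc 0 n x| <= 4 * dl * N n.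
Proof.
have [h1 _] := osc_sup n x (l := 0) isT.
have := ler_pM (normr_ge0 _) (normr_ge0 _) (coef_le n 1) h1.
rewrite -normrM !expr1 => h; apply: le_trans h _; lra.
Qed.

Lemma cor_sup n x : `|cor n x| <= 12 * dl * N n.
Proof.
apply: le_trans (ler_normD _ _) _; have := main_sup n x; have := rem_sup n x.
have := ler_wpM2r (N_ge0 n) (dlX_le 1); lra.
Qed.

Lemma main_bound n : weighted_bound (4 * dl * N n) (fun x => 2 * r n * im_osc 0 n x).
Proof.
apply: weighted_bound_le (weighted_boundZ (2 * r n) (im_osc_bound n (l := 0) isT)) _.
have := ler_wpM2r (N_ge0 n) (coef_le n 1); rewrite !expr1; lra.
Qed.

Lemma rem_bound n : weighted_bound (8 * dl ^+ 2 * N n) (rem n).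
Proof.
have h1 := weighted_boundZ (2 * r n ^+ 2) (re_osc_bound n (l := 1) isT).
have h2 := weighted_boundZ (- (2 * r n ^+ 3)) (im_osc_bound n (l := 2) isT).
apply: weighted_bound_le (weighted_bound_eq (weighted_boundD h1 h2) _) _.
  by move=> x; rewrite mulNr.
have d3 : dl ^+ 3 <= dl ^+ 2 by rewrite exprS ler_piMl // exprn_ge0.
have := ler_wpM2r (N_ge0 n) (coef_le n 2); have := ler_wpM2r (N_ge0 n) (coef_le n 3).
have := ler_wpM2r (N_ge0 n) d3; rewrite normrN; lra.
Qed.

Lemma cor_bound n : weighted_bound (12 * dl * N n) (cor n).
Proof.
apply: weighted_bound_le (weighted_boundD (main_bound n) (rem_bound n)) _.
have := ler_wpM2r (N_ge0 n) (dlX_le 1); lra.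
Qed.

Lemma err_bound n : weighted_bound (4 * dl ^+ 3 * N n) (err n).
Proof.
apply: weighted_bound_le (weighted_boundZ (2 * r n ^+ 3) (im_osc_bound n (l := 3) isT)) _.
have := ler_wpM2r (N_ge0 n) (coef_le n 3); lra.
Qed.

Let NcM c n : 0 <= c -> \sum_(0 <= i < n) c * N i <= c * M.
Proof. by move=> c0; rewrite -mulr_sumr ler_wpM2l. Qed.

Let partial n x := \sum_(0 <= i < n) cor i x.

(** The series of [cor] converges at every point by the sup bounds. That of [err] involves third
    derivatives and is controlled only almost everywhere. *)
Definition corrector x := limn (fun n => \sum_(0 <= i < n) cor i x).
Definition residual x := limn (fun n => \sum_(0 <= i < n) err i x).

Let cor_abs_sum n x : \sum_(0 <= i < n) `|cor i x| <= 12 * dl * M.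
Proof.
apply: le_trans (NcM n _); last by rewrite mulr_ge0.
by apply: ler_sum => i _; exact: cor_sup.
Qed.

Lemma corrector_cvg x : partial n x @[n --> \oo] --> corrector x.
Proof. by have [] := is_cvg_series_bounded (cor_abs_sum^~ x). Qed.

Lemma corrector_sup x : `|corrector x| <= 12 * dl * M.
Proof. by have [] := is_cvg_series_bounded (cor_abs_sum^~ x). Qed.

Lemma residual_bound : weighted_bound (4 * dl ^+ 3 * M) residual.
Proof.
by have [] := weighted_bound_series err_bound (fun n => NcM n (c := 4 * dl ^+ 3) _);
  rewrite ?mulr_ge0 ?exprn_ge0.
Qed.

(** The relation between [cor], [re_osc] and [err] passes to the limit by [ac_limit], the
    derivatives of the partial sums converging almost everywhere under an integrable bound.
    Convergence to [V] is assumed only almost everywhere, so [V] may be built from arbitrary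
    representatives. *)
Lemma corrector_regularized (V : R -> R) (d : R) : mfun V ->
  {ae mu, forall x, (\sum_(0 <= i < n) 2 * re_osc 0 i x)%R @[n --> \oo] --> V x} ->
  12 * dl * M <= d -> 4 * dl ^+ 3 * M <= d ^+ 2 ->
  regularized V corrector residual d.
Proof.
move=> mV cV dM dM2.
have c1 : 0 <= 12 * dl by rewrite mulr_ge0.
have c2 : 0 <= 4 * dl ^+ 3 by rewrite mulr_ge0 // exprn_ge0.
have [wA [g [wg g0 Ag _]]] := weighted_bound_series cor_bound (fun n => NcM n c1).
have [wE [gE [wgE gE0 Eg Ec]]] := weighted_bound_series err_bound (fun n => NcM n c2).
have dw n : weighted_bound (8 * N n) (fun x => 2 * re_osc 0 n x - err n x).
  have h1 := weighted_boundZ 2 (re_osc_bound n (l := 0) isT).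
  have h2 := weighted_boundZ (-1) (err_bound n).
  apply: weighted_bound_le (weighted_bound_eq (weighted_boundD h1 h2) _) _.
    by move=> x; rewrite mulN1r.
  rewrite normrN1 ger0_norm // mul1r.
  have := ler_wpM2r (N_ge0 n) (le_trans (dlX_le 2) dl_le1); lra.
have [_ [gd [wgd gd0 dg _]]] := weighted_bound_series dw (fun n => NcM n (ler0n _ 8)).
have [mE _ _] := wE.
split.
- apply: (ac_limit (F := partial) (f := fun n x => \sum_(0 <= i < n) (2 * re_osc 0 i x - err i x)) (g := gd)).
  + elim=> [|n IH].
      by apply: ac_eq (ac_cst 0) _ _ => x; rewrite /partial big_geq.
    by apply: ac_eq (acD IH (cor_ac n)) _ _ => x; rewrite /partial big_nat_recr.
  + exact: corrector_cvg.
  + exact: measurable_funB.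
  + apply: (ae_imp2 cV Ec) => x h1 h2.
    under eq_fun do rewrite sumrB.
    exact: cvgB.
  + exact: weighted_bound_L1 wgd.
  + by apply: (ae_imp dg) => x h n; apply: le_trans (h n); exact: ler_norm_sum.
- by move=> x; exact: le_trans (corrector_sup x) _.
- by have [] := weighted_bound_sq wA.
- by have [_ h] := weighted_bound_sq wA; apply: le_trans h _.
- by [].
- by have [] := weighted_bound_sq wE.
- by have [_ h] := weighted_bound_sq wE; apply: le_trans h _.
Qed.

(** The bound is on the integral itself and not on the norm, because oscillating products are small
    only after integration. *)
Let small (c : R) f := L1 setT f /\ `|\int[mu]_(x in setT) f x| <= c.

Let small_eq c f g : small c f -> f =1 g -> small c g.
Proof. by move=> sf /funext <-. Qed.

Let small_le c d f : small c f -> c <= d -> small d f.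
Proof. by move=> [jf fc] cd; split=> //; exact: le_trans cd. Qed.

Let smallD c d f g : small c f -> small d g -> small (c + d) (fun x => f x + g x).
Proof.
move=> [jf fc] [jg gd]; split; first exact: L1D.
by rewrite RintegralD // (le_trans (ler_normD _ _)) // lerD.
Qed.

Let smallZ k c f : small c f -> small (`|k| * c) (fun x => k * f x).
Proof.
move=> [jf fc]; split; first exact: L1Z.
by rewrite RintegralZl // normrM ler_wpM2l.
Qed.

Let smallB c d f g : small c f -> small d g -> small (c + d) (fun x => f x - g x).
Proof.
move=> sf sg; have := smallD sf (smallZ (-1) sg); rewrite normrN1 mul1r => h.
by apply: small_eq h _ => x; rewrite mulN1r.
Qed.

Let small_bound c f : weighted_bound c f -> small c f.
Proof.
move=> wf; have jf := weighted_bound_L1 wf; split=> //.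
by apply: le_trans (le_normr_Rintegral _ _) (weighted_bound_norm wf).
Qed.

Let small_sum (F : nat -> R -> R) (c : nat -> R) n : (forall i, small (c i) (F i)) ->
  small (\sum_(0 <= i < n) c i) (fun x => \sum_(0 <= i < n) F i x).
Proof.
move=> sF; elim: n => [|n IH].
  have := smallZ 0 (sF 0); rewrite normr0 mul0r => s0.
  by rewrite big_geq //; apply: small_eq s0 _ => x; rewrite mul0r big_geq.
rewrite big_nat_recr //=; apply: small_eq (smallD IH (sF n)) _ => x.
by rewrite big_nat_recr.
Qed.

Let small_cos (N1 N2 w : R) (f g : nat -> R -> R) : sobolev_chain N1 f ->
  sobolev_chain N2 g -> w != 0 -> `|w|^-1 <= dl ->
  small (2 * (N1 * N2) * dl) (fun x => f 0 x * g 0 x * cos (w * x)).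
Proof.
move=> cf cg w0 wd.
have n1 : 0 <= N1 by exact: le_trans (sobolev_chain_sup cf (l := 0) 0 isT).
have n2 : 0 <= N2 by exact: le_trans (sobolev_chain_sup cg (l := 0) 0 isT).
split; last first.
  by apply: le_trans (oscillation_cos cf cg w0) _; rewrite ler_wpM2l // !mulr_ge0.
apply: weighted_bound_L1 (trig_bound _ _ (chain_prod_bound cf cg (i := 0) (j := 0) isT isT)).
- by move=> x; exact: cos_max.
- exact: measurable_cos_linear.
Qed.

Let small_sin (N1 N2 w : R) (f g : nat -> R -> R) : sobolev_chain N1 f ->
  sobolev_chain N2 g -> w != 0 -> `|w|^-1 <= dl ->
  small (2 * (N1 * N2) * dl) (fun x => f 0 x * g 0 x * sin (w * x)).
Proof.
move=> cf cg w0 wd.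
have n1 : 0 <= N1 by exact: le_trans (sobolev_chain_sup cf (l := 0) 0 isT).
have n2 : 0 <= N2 by exact: le_trans (sobolev_chain_sup cg (l := 0) 0 isT).
split; last first.
  by apply: le_trans (oscillation_sin cf cg w0) _; rewrite ler_wpM2l // !mulr_ge0.
apply: weighted_bound_L1 (trig_bound _ _ (chain_prod_bound cf cg (i := 0) (j := 0) isT isT)).
- by move=> x; exact: sin_max.
- exact: measurable_sin_linear.
Qed.

Let main n x := 2 * r n * im_osc 0 n x.
Let density n x := 2 * r n ^+ 2 * (a n 0 x ^+ 2 + b n 0 x ^+ 2).

(* The product of two terms of the corrector has frequencies [om i - om j]
   ([e = 1]) and [om i + om j] ([e = -1]); only the former can vanish, for
   [i = j], and this gives the density. *)
Let osc_pair i j w (e : R) : w != 0 -> `|w|^-1 <= dl -> e ^+ 2 = 1 ->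
  small (8 * (N i * N j) * dl) (fun x =>
    (b i 0 x * b j 0 x + e * (a i 0 x * a j 0 x)) * cos (w * x) +
    (a i 0 x * b j 0 x - e * (b i 0 x * a j 0 x)) * sin (w * x)).
Proof.
move=> w0 wd e2.
have e1 : `|e| = 1 by apply/eqP; rewrite -sqrp_eq1 // -normrX e2 normr1.
have h1 := small_cos (cb i) (cb j) w0 wd.
have h2 := smallZ e (small_cos (ca i) (ca j) w0 wd).
have h3 := small_sin (ca i) (cb j) w0 wd.
have h4 := smallZ e (small_sin (cb i) (ca j) w0 wd).
apply: small_le (small_eq (smallD (smallD h1 h2) (smallB h3 h4)) _) _.
  by move=> x; ring.
by rewrite e1; lra.
Qed.

(** The product is [2 r_i r_j], at most [2 dl^2], times oscillations at the frequencies
    [om i + om j] and [om i - om j], each with integral at most [8 N_i N_j dl]. For [i = j] the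
    difference frequency is 0, and its contribution is exactly [density i]. *)
Lemma pair_estimate i j : small (32 * dl ^+ 3 * (N i * N j))
  (fun x => main i x * main j x - (if i == j then density i x else 0)).
Proof.
have NN : 0 <= N i * N j by rewrite mulr_ge0.
have rr : `|2 * r i * r j| <= 2 * dl ^+ 2.
  by rewrite -mulrA normrM ger0_norm // ler_wpM2l // normrM expr2 ler_pM.
have cc : 0 <= 8 * (N i * N j) * dl by rewrite !mulr_ge0.
have le c : c <= 16 * (N i * N j) * dl -> `|2 * r i * r j| * c <= 32 * dl ^+ 3 * (N i * N j).
  move=> hc; apply: (@le_trans _ _ (2 * dl ^+ 2 * (16 * (N i * N j) * dl))).
    apply: le_trans (ler_wpM2l _ hc) _ => //; apply: ler_wpM2r => //; lra.
  by rewrite le_eqVlt; apply/orP; left; apply/eqP; ring.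
have h1 := osc_pair i j (omD_neq0 i j) (omD_inv i j) (sqrr_sign R 1).
have [ij|ij] := eqVneq i j.
  subst j.
  apply: small_le (small_eq (smallZ (2 * r i * r i) h1) _) (le _ _).
    move=> x; rewrite /main /density /im_osc (mulrDl (om i) (om i)) cosD sinD -/(cs i x) -/(sn i x).
    have := cos2Dsin2 (om i * x); rewrite -/(cs i x) -/(sn i x) => cs1.
    transitivity (2 * r i * (a i 0 x * sn i x + b i 0 x * cs i x) *
        (2 * r i * (a i 0 x * sn i x + b i 0 x * cs i x)) -
        2 * r i ^+ 2 * (a i 0 x ^+ 2 + b i 0 x ^+ 2) * (cs i x ^+ 2 + sn i x ^+ 2)).
      ring.
    by rewrite cs1 mulr1.
  lra.
have h2 := osc_pair i j (omB_neq0 ij) (omB_inv ij) (expr1n _ 2).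
apply: small_le (small_eq (smallZ (2 * r i * r j) (smallD h1 h2)) _) _.
  move=> x; rewrite /main /im_osc (mulrDl (om i) (om j)) (mulrDl (om i) (- om j)) (mulNr (om j)) cosB sinB cosD sinD subr0.
  by rewrite -/(cs i x) -/(sn i x) -/(cs j x) -/(sn j x); ring.
apply: le; lra.
Qed.

(** Write the partial sum as [P + T], with leading terms in [P] and [T = O(dl^2)]. Its square is
    [P^2 + T (partial + P)]: the pairs in [P^2] contribute 32, and the product contributes
    [8 (12 + 4) = 128], which makes 160. *)
Lemma partial_sq_estimate n : small (160 * dl ^+ 3 * M ^+ 2)
  (fun x => partial n x ^+ 2 - \sum_(0 <= i < n) density i x).
Proof.
pose P x := \sum_(0 <= i < n) main i x; pose T x := \sum_(0 <= i < n) rem i x.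
have PT x : partial n x = P x + T x by rewrite /partial /P /T -big_split.
have T_le x : `|T x| <= 8 * dl ^+ 2 * M.
  apply: le_trans (ler_norm_sum _ _ _) (le_trans _ (NcM n _)).
    by apply: ler_sum => i _; exact: rem_sup.
  by rewrite mulr_ge0 // exprn_ge0.
have wT : weighted_bound _ T := weighted_bound_sum n rem_bound.
have wP : weighted_bound _ P := weighted_bound_sum n main_bound.
have wS : weighted_bound _ (partial n) := weighted_bound_sum n cor_bound.
have [mT _ _] := wT.
have hT := small_bound (weighted_boundM mT T_le (weighted_boundD wS wP)).
have hP := small_sum n (fun i => small_sum n (fun j => pair_estimate i j)).
apply: small_le (small_eq (smallD hT hP) _) _ => [x|].
  have -> : \sum_(0 <= i < n) density i x =
      \sum_(0 <= i < n) \sum_(0 <= j < n) (if i == j then density i x else 0).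
    apply: eq_big_nat => i /andP[_ ni].
    rewrite -big_mkcond /= (eq_bigl (fun j => j == i)) => [|j]; last exact: eq_sym.
    by rewrite (big_nat1_eq _ (fun=> density i x) i) ni.
  under eq_bigr do rewrite sumrB.
  rewrite sumrB; have -> : \sum_(0 <= i < n) \sum_(0 <= j < n) main i x * main j x = P x ^+ 2.
    by rewrite expr2 /P mulr_suml; apply: eq_bigr => i _; rewrite mulr_sumr.
  by rewrite PT; ring.
have -> : \sum_(0 <= i < n) \sum_(0 <= j < n) 32 * dl ^+ 3 * (N i * N j) =
    32 * dl ^+ 3 * (\sum_(0 <= i < n) N i) ^+ 2.
  rewrite expr2 mulr_suml mulr_sumr; apply: eq_bigr => i _.
  by rewrite mulr_sumr mulr_sumr.
have sN : 0 <= \sum_(0 <= i < n) N i by apply: sumr_ge0.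
have d3 : 0 <= dl ^+ 3 by rewrite exprn_ge0.
have d2 : 0 <= 8 * dl ^+ 2 * M by rewrite !mulr_ge0 // exprn_ge0.
rewrite -!mulr_sumr -mulrDl.
have := ler_wpM2l d2 (ler_wpM2l dl_ge0 (NM n)).
have := ler_wpM2l d3 (lerXn2r 2 sN M_ge0 (NM n)).
move: (\sum_(0 <= i < n) N i) => s; lra.
Qed.

(** The constant of [partial_sq_estimate] does not depend on [n], so it survives the limit. The
    squares of the partial sums are dominated by [12 dl M] times the dominating function [g] of the
    series. *)
Lemma corrector_sq_estimate (T : R) :
  (\sum_(0 <= i < n) \int[mu]_(x in setT) density i x) @[n --> \oo] --> T ->
  L1 setT (fun x => corrector x ^+ 2) /\
  `|\int[mu]_(x in setT) (corrector x ^+ 2) - T| <= 160 * dl ^+ 3 * M ^+ 2.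
Proof.
move=> cT.
have c1 : 0 <= 12 * dl by rewrite mulr_ge0.
have [wA [g [wg g0 Ag _]]] := weighted_bound_series cor_bound (fun n => NcM n c1).
have wS n := weighted_bound_sum n cor_bound.
have wD i : weighted_bound (`|2 * r i ^+ 2| * (N i * N i + N i * N i)) (density i).
  apply: weighted_boundZ; apply: weighted_boundD.
    by apply: weighted_bound_eq (chain_prod_bound (ca i) (ca i) (i := 0) (j := 0) isT isT) _ => x; rewrite expr2.
  by apply: weighted_bound_eq (chain_prod_bound (cb i) (cb i) (i := 0) (j := 0) isT isT) _ => x; rewrite expr2.
have jD i := weighted_bound_L1 (wD i).
have [||||||jA cA] := @Rdominated_cvg [set: mR] (fun n x => partial n x ^+ 2)
    (fun x => corrector x ^+ 2) (fun x => 12 * dl * M * g x).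
- exact: measurableT.
- by move=> n; apply: measurable_funX; have [] := wS n.
- by apply: measurable_funX; have [] := wA.
- by apply: aeW => x _; apply: cvgM; exact: corrector_cvg.
- by apply: L1Z => //; exact: weighted_bound_L1 wg.
- apply: (ae_imp Ag) => x h n _; rewrite normrX expr2 ler_pM //.
    by apply: le_trans (cor_abs_sum n x); exact: ler_norm_sum.
  by apply: le_trans (h n); exact: ler_norm_sum.
split=> //.
have cI : (\int[mu]_(x in setT) (partial n x ^+ 2) -
    \sum_(0 <= i < n) \int[mu]_(x in setT) density i x) @[n --> \oo] -->
    \int[mu]_(x in setT) (corrector x ^+ 2) - T by exact: cvgB.
have {}cI := cvg_norm cI; have {}cI := cI eventually_filter.
rewrite -(cvg_lim (@norm_hausdorff _ _) cI).
apply: limr_le; first by apply/cvg_ex; eexists; exact: cI.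
apply: nearW => n; have [js hs] := partial_sq_estimate n.
rewrite -Rintegral_sum // -RintegralB //; last exact: L1_sum.
apply: L1_eq (L1D (@measurableT _ mR) js (L1_sum (index_iota 0 n) (@measurableT _ mR) jD)) => // x _.
by rewrite subrK.
Qed.

End Corrector.

(** * The oscillating and the effective potentials *)

Lemma schrodinger_real_ae (U U' v : R -> R) (k : R) : mfun U' ->
  {ae mu, forall x, U x = U' x} -> schrodinger_solution_real U k v ->
  schrodinger_solution_real U' k v.
Proof.
move=> mU' UU' [dv sv]; split=> // a b ab; have [jv ->] := sv _ _ ab.
have mv : mfun v.
  apply: continuous_measurable_fun => x.
  by apply: differentiable_continuous; apply/derivable1_diffP.
have m' : measurable_fun (`[a, b] : set mR) (fun x => (U' x - k ^+ 2) * v x).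
  apply: measurable_funTS; apply: measurable_funM => //.
  by apply: measurable_funB => //; exact: measurable_cst.
have E : {ae mu, forall x, `[a, b]%classic x ->
    (U x - k ^+ 2) * v x = (U' x - k ^+ 2) * v x}.
  by apply: (ae_imp UU') => x ->.
split; first exact: ae_eq_L1 E m' jv.
by apply: ae_eq_Rintegral E _ m' => //; exact: L1_measurable jv.
Qed.

(** The potential enters the equation only under integrals, so both potentials have the same sets of
    Jost solutions, and [xget] makes the same choice in equal sets. *)
Lemma transmission_ae (U U' : R -> R) : mfun U -> mfun U' ->
  {ae mu, forall x, U x = U' x} -> transmission U = transmission U'.
Proof.
move=> mU mU' UU'.
have U'U : {ae mu, forall x, U' x = U x} by apply: (ae_imp UU').
have S k (f : R -> R[i]) : schrodinger_solution U k f = schrodinger_solution U' k f.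
  apply/propext; split=> -[h1 h2]; split.
  - exact: schrodinger_real_ae h1.
  - exact: schrodinger_real_ae h2.
  - exact: schrodinger_real_ae h1.
  - exact: schrodinger_real_ae h2.
have Jp : jost_plus U = jost_plus U'.
  apply/funext => k; rewrite /jost_plus; congr (xget _ _).
  by apply/funext => f; rewrite /= /is_jost_plus S.
have Jm : jost_minus U = jost_minus U'.
  apply/funext => k; rewrite /jost_minus; congr (xget _ _).
  by apply/funext => f; rewrite /= /is_jost_minus S.
have F : transmission_formula U = transmission_formula U'.
  by apply/funext => k; rewrite /transmission_formula Jp Jm.
by apply/funext => k; rewrite /transmission F.
Qed.

Lemma effective_regularized (s : R -> R) (d : R) : 0 <= d ->
  weighted_bound (d ^+ 2) s -> regularized s (fun=> 0) s d.
Proof.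
move=> d0 ws; have [ms _ _] := ws.
have z : (fun x : R => (1 + `|x|) ^+ 2 * `|0 : R|) = (fun=> 0).
  by apply/funext => x; rewrite normr0 mulr0.
split=> //.
- by apply: ac_eq (ac_cst 0) _ _ => // x; rewrite subrr.
- by move=> x; rewrite normr0.
- rewrite z; apply: L1_eq (L1Z 0 (@measurableT _ mR) (weighted_bound_L1 ws)) => // x _.
  by rewrite mul0r.
- by rewrite z Rintegral_cst // mul0r.
- by have [] := weighted_bound_sq ws.
- by have [] := weighted_bound_sq ws.
Qed.

Lemma normc_dist (z1 z2 z0 : R[i]) (r s : R) :
  normc (z1 - z0) <= r ->
  normc (z2 - z0) <= s ->
  normc (z1 - z2) <= r + s.
Proof.
move=> h1 h2; have -> : z1 - z2 = (z1 - z0) - (z2 - z0) by ring.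
by apply: le_trans (le_normcD _ _) _; rewrite normcN lerD.
Qed.

Lemma eq_limn (u v : nat -> R) : u =1 v -> limn u = limn v.
Proof. by move=> /funext ->. Qed.

Section Data.
Variables (q : int -> R -> R[i]) (lambda : int -> R).
Hypothesis HV : hypotheses_V' q lambda.

Let idx (n : nat) : int := n.+1%:Z.
Let idx0 n : idx n != 0. Proof. by []. Qed.

Let qr n x := complex.Re (q (idx n) x).
Let qi n x := complex.Im (q (idx n) x).
Let lam n := lambda (idx n).
Let freq (eps : R) n := 2 * pi * lam n / eps.

(** The terms of index [j] and [- j] are conjugate, so a pair contributes twice a real part, and
    only positive indices remain, shifted by one to start at 0. *)
Let q_osc_series (eps x : R) : q_osc q lambda eps x =
  limn (fun n => \sum_(0 <= i < n) 2 * (qr i x * cos (freq eps i * x) - qi i x * sin (freq eps i * x))).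
Proof.
rewrite /q_osc /potential /Czsum /= /zsum.
apply: eq_limn => n; apply: eq_bigr => j _.
rewrite (V_conj HV) // (V_freq_opp HV) // /qr /qi /freq /lam /idx.
have -> : 2 * pi * lambda j.+1 / eps * x = 2 * pi * lambda j.+1 * (x / eps) by ring.
have -> : 2 * pi * - lambda j.+1 * (x / eps) = - (2 * pi * lambda j.+1 * (x / eps)) by ring.
case: (q j.+1 x) => u v /=; rewrite /Cexpi /= cosN sinN; ring.
Qed.

Let density x := limn (fun n => \sum_(0 <= i < n) 2 * (qr i x ^+ 2 + qi i x ^+ 2) / lam i ^+ 2).

Let sigma_eff_series (eps x : R) : sigma_eff q lambda eps x =
  - (eps ^+ 2 / (4 * pi ^+ 2)) * density x.
Proof.
rewrite /sigma_eff /zsum /density; congr (_ * _).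
apply: eq_limn => n; apply: eq_bigr => j _.
rewrite (V_conj HV) // (V_freq_opp HV) // /qr /qi /lam /idx.
case: (q j.+1 x) => u v /=; rewrite !sqr_sqrtr ?addr_ge0 ?sqr_ge0 // !sqrrN; ring.
Qed.

Let mq n : mfun (qr n) /\ mfun (qi n).
Proof.
have [w _] := V_sobolev HV (idx0 n); have [h [[wr _ _] [wi _ _]]] := w 0%N isT.
by split; [exact: (locally_integrable_L1 wr).1|exact: (locally_integrable_L1 wi).1].
Qed.

Let chains : exists (a b : nat -> nat -> R -> R) (N : nat -> R) (M : R),
  [/\ forall n, sobolev_chain (N n) (a n), forall n, sobolev_chain (N n) (b n),
   forall n, \sum_(0 <= i < n) N i <= M &
   {ae mu, forall x n, qr n x = a n 0%N x /\ qi n x = b n 0%N x}].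
Proof.
pose N j := fine (sobolev_norm 3 3 (q j)).
have H n : exists ab : (nat -> R -> R) * (nat -> R -> R),
    [/\ sobolev_chain (N (idx n)) ab.1, sobolev_chain (N (idx n)) ab.2 &
    {ae mu, forall x, qr n x = ab.1 0%N x /\ qi n x = ab.2 0%N x}].
  have [_ _ [a ca ea] [b cb eb]] := sobolev_real_chains (V_sobolev HV (idx0 n)).
  by exists (a, b); split=> //=; apply: (ae_imp2 ea eb).
have [ab Hab] := choice H.
have [M HM] : exists M : R, forall n, \sum_(0 <= i < n) N (idx i) <= M.
  apply: (fine_esum_bound (S := [set j : int | j != 0])).
  - by move=> i j [].
  - by [].
  - by move=> j j0; have [] := sobolev_real_chains (V_sobolev HV j0).
  - apply: le_lt_trans (V_summable HV); apply: le_esum => j j0.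
    by have [_ <-] := sobolev_real_chains (V_sobolev HV j0).
exists (fun n => (ab n).1), (fun n => (ab n).2), (fun n => N (idx n)), M; split=> //.
- by move=> n; have [] := Hab n.
- by move=> n; have [] := Hab n.
- by apply: ae_foralln => n; have [] := Hab n.
Qed.

(** A sum [lam i + lam j] is the difference of the frequencies of index [i + 1] and [- (j + 1)];
    these indices are always distinct, so the gap applies even when [i = j]. *)
Let gaps : exists2 theta : R, 0 < theta & [/\ forall n, theta <= `|lam n|,
  forall i j, theta <= `|lam i + lam j| & forall i j, i != j -> theta <= `|lam i - lam j|].
Proof.
have [theta t0 [gap low]] := V_freq_gap HV; exists theta => //; split=> [n|i j|i j ij].
- exact: low.
- have := gap (idx i) (- idx j) isT isT isT.
  by rewrite (V_freq_opp HV (idx0 j)) opprK.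
- by apply: gap => //; rewrite eqz_nat eqSS.
Qed.

Section Scale.
Variables (a b : nat -> nat -> R -> R) (N : nat -> R) (M theta : R).
Hypothesis ca : forall n, sobolev_chain (N n) (a n).
Hypothesis cb : forall n, sobolev_chain (N n) (b n).
Hypothesis NM : forall n, \sum_(0 <= i < n) N i <= M.
Hypothesis qab : {ae mu, forall x n, qr n x = a n 0%N x /\ qi n x = b n 0%N x}.
Hypothesis theta_gt0 : 0 < theta.
Hypothesis lam_ge : forall n, theta <= `|lam n|.
Hypothesis lamD_ge : forall i j, theta <= `|lam i + lam j|.
Hypothesis lamB_ge : forall i j, i != j -> theta <= `|lam i - lam j|.

Let N_ge0 n : 0 <= N n.
Proof. exact: le_trans (sobolev_chain_sup (ca n) (l := 0) 0 isT). Qed.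

Let M_ge0 : 0 <= M.
Proof. by have := NM 0; rewrite big_geq. Qed.

Let N_leM n : N n <= M.
Proof.
apply: le_trans (NM n.+1); rewrite big_nat_recr //= lerDr.
by apply: sumr_ge0.
Qed.

(** [L * eps] is the value of [dl] in the corrector: it bounds the inverse of every nonzero
    frequency met there, namely those of the form [2 pi t / eps] with [|t| >= theta]. *)
Let L := (2 * pi * theta)^-1.

Let L_gt0 : 0 < L.
Proof. by rewrite invr_gt0 !mulr_gt0 // pi_gt0. Qed.

Let inv_le (eps t : R) : 0 < eps -> theta <= `|t| -> `|2 * pi * t / eps|^-1 <= L * eps.
Proof.
move=> e0 ht; have t0 := lt_le_trans theta_gt0 ht; have p0 := pi_gt0 R.
rewrite normrM normfV (gtr0_norm e0) invf_div mulrC ler_wpM2r ?(ltW e0) //.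
rewrite normrM ger0_norm ?mulr_ge0 ?(ltW p0) // lef_pV2 ?posrE ?mulr_gt0 //.
by rewrite ler_wpM2l // mulr_ge0 // ltW.
Qed.

Let freq_neq0 (eps t : R) : 0 < eps -> theta <= `|t| -> 2 * pi * t / eps != 0.
Proof.
move=> e0 ht; have t0 := lt_le_trans theta_gt0 ht.
by rewrite !mulf_neq0 ?invr_neq0 ?(gt_eqF e0) ?(gt_eqF (pi_gt0 _)) ?pnatr_eq0 // -normr_gt0.
Qed.

Let freqD (eps : R) i j : freq eps i + freq eps j = 2 * pi * (lam i + lam j) / eps.
Proof. by rewrite /freq; ring. Qed.

Let freqB (eps : R) i j : freq eps i - freq eps j = 2 * pi * (lam i - lam j) / eps.
Proof. by rewrite /freq; ring. Qed.

Let q_osc_ae (eps : R) : {ae mu, forall x,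
  (\sum_(0 <= i < n) 2 * re_osc a b (freq eps) 0 i x)%R @[n --> \oo] --> q_osc q lambda eps x}.
Proof.
have w n := weighted_boundZ 2 (re_osc_bound (freq eps) ca cb n (l := 0) isT).
have [|_ [g [_ _ _ cv]]] := weighted_bound_series (M := 4 * M) w.
  move=> n; rewrite ger0_norm //; under eq_bigr do rewrite mulrA -natrM.
  by rewrite -mulr_sumr ler_wpM2l.
apply: (ae_imp2 qab cv) => x qx; rewrite q_osc_series.
congr (_ --> _); apply: eq_limn => n; apply: eq_bigr => i _.
by have [-> ->] := qx i.
Qed.

Let q_osc_measurable (eps : R) : mfun (q_osc q lambda eps).
Proof.
have -> := funext (q_osc_series eps); apply: measurable_limn => n.
apply: measurable_sum => i; apply: measurable_funM; first exact: measurable_cst.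
have [m1 m2] := mq i.
apply: measurable_funB; apply: measurable_funM => //.
  exact: measurable_cos_linear.
exact: measurable_sin_linear.
Qed.

Let dens n x := 2 * (a n 0%N x ^+ 2 + b n 0%N x ^+ 2) / lam n ^+ 2.

Let dens_ge0 n x : 0 <= dens n x.
Proof.
apply: divr_ge0; last exact: sqr_ge0.
by apply: mulr_ge0 => //; apply: addr_ge0; exact: sqr_ge0.
Qed.

Let dens_bound n : weighted_bound (4 * M / theta ^+ 2 * N n) (dens n).
Proof.
have wa := chain_prod_bound (ca n) (ca n) (i := 0) (j := 0) isT isT.
have wb := chain_prod_bound (cb n) (cb n) (i := 0) (j := 0) isT isT.
have w := weighted_boundZ (2 / lam n ^+ 2) (weighted_boundD wa wb).
apply: weighted_bound_le (weighted_bound_eq w _) _ => [x|].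
  by rewrite /dens; ring.
have h : `|2 / lam n ^+ 2| <= 2 / theta ^+ 2.
  rewrite normrM normfV normrX ger0_norm // ler_wpM2l //.
  have l0 := lt_le_trans theta_gt0 (lam_ge n).
  by rewrite lef_pV2 ?posrE ?exprn_gt0 // lerXn2r ?nnegrE // ltW.
have t2 : 0 <= 2 / theta ^+ 2 by rewrite divr_ge0 // exprn_ge0 // ltW.
have NN : 0 <= N n * N n by rewrite mulr_ge0.
apply: le_trans (ler_wpM2r (addr_ge0 NN NN) h) _.
have := ler_wpM2l t2 (ler_wpM2r (N_ge0 n) (N_leM n)); lra.
Qed.

Let densM n : \sum_(0 <= i < n) 4 * M / theta ^+ 2 * N i <= 4 * M / theta ^+ 2 * M.
Proof.
by rewrite -mulr_sumr ler_wpM2l // divr_ge0 ?mulr_ge0 ?exprn_ge0 // ltW.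
Qed.

Let density_measurable : mfun density.
Proof.
apply: measurable_limn => n; apply: measurable_sum => i.
have [m1 m2] := mq i.
apply: measurable_funM; last exact: measurable_cst.
apply: measurable_funM; first exact: measurable_cst.
by apply: measurable_funD; apply: measurable_funX.
Qed.

Let density_ae : {ae mu, forall x, (\sum_(0 <= i < n) dens i x)%R @[n --> \oo] --> density x}.
Proof.
have [_ [g [_ _ _ cv]]] := weighted_bound_series dens_bound densM.
apply: (ae_imp2 qab cv) => x qx; congr (_ --> _); apply: eq_limn => n.
by apply: eq_bigr => i _; have [-> ->] := qx i.
Qed.

Let density_bound : weighted_bound (4 * M / theta ^+ 2 * M) density.
Proof.
have [[mF jF FM] [g [_ _ _ cv]]] := weighted_bound_series dens_bound densM.
have [||||||] := @weighted_dominated density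
  (fun x => `|limn (fun n => (\sum_(0 <= i < n) dens i x)%R)|) (4 * M / theta ^+ 2 * M) => //.
- exact: measurable_norm_fun.
- apply: (ae_imp2 density_ae cv) => x h1 h2.
  by rewrite (cvg_unique (@norm_hausdorff _ _) h1 h2).
Qed.

Let density_ge0_ae : {ae mu, forall x, 0 <= density x}.
Proof.
apply: (ae_imp density_ae) => x h; rewrite -(cvg_lim (@norm_hausdorff _ _) h).
apply: limr_ge; first by apply/cvg_ex; eexists; exact: h.
by apply: nearW => n; apply: sumr_ge0 => i _; exact: dens_ge0.
Qed.

Let dens_integral_cvg : (\sum_(0 <= i < n) \int[mu]_(x in setT) dens i x)%R @[n --> \oo] -->
  \int[mu]_(x in setT) density x.
Proof.
have [_ [g [wg g0 dg _]]] := weighted_bound_series dens_bound densM.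
have jd i := weighted_bound_L1 (dens_bound i).
have [||||||_ cA] := @Rdominated_cvg [set: mR] (fun n x => \sum_(0 <= i < n) dens i x)
    density g.
- exact: measurableT.
- by move=> n; have [] := weighted_bound_sum n dens_bound.
- exact: density_measurable.
- by apply: (ae_imp density_ae) => x h _.
- exact: weighted_bound_L1 wg.
- by apply: (ae_imp dg) => x h n _; apply: le_trans (h n); exact: ler_norm_sum.
apply: cvg_trans cA; apply: near_eq_cvg; apply: nearW => n.
by rewrite Rintegral_sum.
Qed.

Let m := (\int[mu]_(x in setT) density x) / (4 * pi ^+ 2).

(** The first summand covers the bound [12 dl M] on the corrector, with [M + 1] to keep [K] positive
    when [M = 0]. The second collects the errors [160 dl^3 M^2] and [4 dl^3 M] on the integral of
    [A^2 - E]. *)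
Let K := 12 * (M + 1) * L + (160 * M ^+ 2 + 4 * M) * L ^+ 3.

Let K1_gt0 : 0 < 12 * (M + 1) * L.
Proof. by rewrite !mulr_gt0 // ltr_wpDl. Qed.

Let K2_ge0 : 0 <= (160 * M ^+ 2 + 4 * M) * L ^+ 3.
Proof. by rewrite mulr_ge0 ?addr_ge0 ?mulr_ge0 ?exprn_ge0 ?sqr_ge0 // ltW. Qed.

Let K_gt0 : 0 < K.
Proof. by rewrite ltr_wpDr. Qed.

Let KL : 12 * (M + 1) * L <= K.
Proof. by rewrite lerDl. Qed.

Let sq_le : 4 * M * L ^+ 2 <= K ^+ 2.
Proof.
apply: (@le_trans _ _ ((12 * (M + 1) * L) ^+ 2)); last first.
  by rewrite lerXn2r // nnegrE ltW.
rewrite exprMn ler_wpM2r ?sqr_ge0 //; have := M_ge0; have := sqr_ge0 M; nra.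
Qed.

Let sigma_bound (eps : R) : weighted_bound ((K * eps) ^+ 2) (sigma_eff q lambda eps).
Proof.
apply: weighted_bound_eq (weighted_bound_le (weighted_boundZ (- (eps ^+ 2 / (4 * pi ^+ 2))) density_bound) _) _; last first.
  by move=> x; rewrite sigma_eff_series.
have p0 := pi_gt0 R.
have c0 : 0 <= eps ^+ 2 / (4 * pi ^+ 2).
  by apply: divr_ge0; [exact: sqr_ge0|apply: mulr_ge0 => //; exact: sqr_ge0].
rewrite normrN (ger0_norm c0).
have -> : eps ^+ 2 / (4 * pi ^+ 2) * (4 * M / theta ^+ 2 * M) = 4 * M ^+ 2 * L ^+ 2 * eps ^+ 2.
  by rewrite /L; move: (@pi R) p0 => p p0; field; rewrite !gt_eqF.
rewrite exprMn ler_wpM2r ?sqr_ge0 //.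
apply: (@le_trans _ _ ((12 * (M + 1) * L) ^+ 2)); last first.
  by rewrite lerXn2r // nnegrE ltW.
rewrite exprMn ler_wpM2r ?sqr_ge0 //; have := M_ge0; have := sqr_ge0 M; nra.
Qed.

Lemma sigma_regularized (eps : R) : 0 < eps ->
  regularized (sigma_eff q lambda eps) (fun=> 0) (sigma_eff q lambda eps) (K * eps) /\
  `|\int[mu]_(x in setT) (0 ^+ 2 - sigma_eff q lambda eps x) - m * eps ^+ 2| <= K * eps ^+ 3.
Proof.
move=> e0; split; first by apply: effective_regularized; [rewrite mulr_ge0 // ltW|exact: sigma_bound].
have -> : \int[mu]_(x in setT) (0 ^+ 2 - sigma_eff q lambda eps x) = m * eps ^+ 2.
  under eq_Rintegral do rewrite sigma_eff_series expr2 mulr0 sub0r mulNr opprK.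
  rewrite RintegralZl //; last exact: weighted_bound_L1 density_bound.
  by rewrite /m; ring.
by rewrite subrr normr0 mulr_ge0 ?exprn_ge0 // ltW.
Qed.

Lemma q_osc_regularized (eps : R) : 0 < eps -> L * eps <= 1 ->
  exists A E : R -> R, regularized (q_osc q lambda eps) A E (K * eps) /\
  `|\int[mu]_(x in setT) (A x ^+ 2 - E x) - m * eps ^+ 2| <= K * eps ^+ 3.
Proof.
move=> e0 Le1; have p0 := pi_gt0 R; have Le0 : 0 <= L * eps by rewrite ltW // mulr_gt0.
have o0 n : freq eps n != 0 by apply: freq_neq0.
have oi n : `|freq eps n|^-1 <= L * eps by apply: inv_le.
have oD0 i j : freq eps i + freq eps j != 0 by rewrite freqD freq_neq0.
have oDi i j : `|freq eps i + freq eps j|^-1 <= L * eps by rewrite freqD inv_le.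
have oB0 i j : i != j -> freq eps i - freq eps j != 0.
  by move=> ij; rewrite freqB freq_neq0 // lamB_ge.
have oBi i j : i != j -> `|freq eps i - freq eps j|^-1 <= L * eps.
  by move=> ij; rewrite freqB inv_le // lamB_ge.
exists (corrector a b (freq eps)), (residual a b (freq eps)); split.
  apply: (corrector_regularized ca cb NM Le1 o0 oi (q_osc_measurable eps) (q_osc_ae eps)).
    rewrite mulrA mulrAC ler_wpM2r ?(ltW e0) //; apply: le_trans KL.
    by have := L_gt0; lra.
  apply: (@le_trans _ _ (4 * M * L ^+ 2 * eps ^+ 2)).
    have : (L * eps) ^+ 3 <= (L * eps) ^+ 2 by rewrite exprS ler_piMl // exprn_ge0.
    by move=> /(ler_wpM2r M_ge0); rewrite exprMn; lra.
  by rewrite exprMn ler_wpM2r ?sqr_ge0.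
(* As [freq = 2 pi lam / eps], each diagonal density is [eps^2 / (4 pi^2)] times [dens], so the
   integrals sum to [m eps^2]. *)
have cT : (\sum_(0 <= i < n) \int[mu]_(x in setT)
    (2 * (freq eps i)^-1 ^+ 2 * (a i 0%N x ^+ 2 + b i 0%N x ^+ 2)))%R @[n --> \oo] --> m * eps ^+ 2.
  have E i : \int[mu]_(x in setT)
      (2 * (freq eps i)^-1 ^+ 2 * (a i 0%N x ^+ 2 + b i 0%N x ^+ 2)) =
      eps ^+ 2 / (4 * pi ^+ 2) * \int[mu]_(x in setT) dens i x.
    rewrite -RintegralZl //; last exact: weighted_bound_L1 (dens_bound i).
    apply: eq_Rintegral => x _; rewrite /dens /freq.
    have l0 := lt_le_trans theta_gt0 (lam_ge i).
    have ln0 : lam i != 0 by rewrite -normr_gt0.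
    by move: (@pi R) p0 => p p0'; field; rewrite ln0 !gt_eqF.
  have -> : m * eps ^+ 2 = eps ^+ 2 / (4 * pi ^+ 2) * \int[mu]_(x in setT) density x.
    by rewrite /m; ring.
  have -> : (fun n => \sum_(0 <= i < n) \int[mu]_(x in setT)
      (2 * (freq eps i)^-1 ^+ 2 * (a i 0%N x ^+ 2 + b i 0%N x ^+ 2))) =
      (fun n => eps ^+ 2 / (4 * pi ^+ 2) * \sum_(0 <= i < n) \int[mu]_(x in setT) dens i x).
    by apply/funext => n; rewrite mulr_sumr; apply: eq_bigr => i _; exact: E.
  by apply: cvgM; [exact: cvg_cst|exact: dens_integral_cvg].
have [jA hA] := corrector_sq_estimate ca cb NM Le1 oi oD0 oDi oB0 oBi cT.
have wE := residual_bound ca cb NM oi.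
rewrite RintegralB //; last exact: weighted_bound_L1 wE.
have hE := le_trans (le_normr_Rintegral (@measurableT _ mR) (weighted_bound_L1 wE)) (weighted_bound_norm wE).
rewrite addrAC; apply: le_trans (ler_normB _ _) _; apply: le_trans (lerD hA hE) _.
have -> : 160 * (L * eps) ^+ 3 * M ^+ 2 + 4 * (L * eps) ^+ 3 * M =
    (160 * M ^+ 2 + 4 * M) * L ^+ 3 * eps ^+ 3 by ring.
by apply: ler_wpM2r; [rewrite exprn_ge0 // ltW|rewrite lerDr ltW].
Qed.

(** Both coefficients are compared with that of the same point interaction, whence [C + C]. The
    bound [eps < L^-1] ensures [dl <= 1]. *)
Lemma close_pos : 0 < m -> exists C e0 : R, 0 < e0 /\ forall eps, 0 < eps -> eps < e0 ->
  forall k, normc (transmission (sigma_eff q lambda eps) k -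
    transmission (q_osc q lambda eps) k) <= C * eps.
Proof.
move=> m0; have [C [e0 [e00 H]]] := transmission_close m0 K_gt0.
exists (C + C), (Num.min e0 L^-1); split; first by rewrite lt_min e00 invr_gt0.
move=> eps ep; rewrite lt_min => /andP[ee eL] k.
have Le1 : L * eps <= 1 by rewrite -ler_pdivlMl // mulr1 ltW.
have [r1 i1] := sigma_regularized ep; have [A [E [r2 i2]]] := q_osc_regularized ep Le1.
have h1 := H _ ep ee _ _ _ r1 i1 k; have h2 := H _ ep ee _ _ _ r2 i2 k.
by rewrite mulrDl; exact: normc_dist h1 h2.
Qed.

(** Here the model Wronskian has no lower bound of order [eps^2], and an exact argument replaces the
    estimate. The density is almost everywhere nonnegative with integral at most 0, hence 0 almost
    everywhere; so is each of its nonnegative terms, being at most the sum. All [q j] of positive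
    index then vanish almost everywhere, both potentials are almost everywhere 0, and
    [transmission_ae] applies. *)
Lemma close_zero : m <= 0 -> forall eps, 0 < eps ->
  transmission (sigma_eff q lambda eps) = transmission (q_osc q lambda eps).
Proof.
move=> m0 eps e0; apply: transmission_ae; first by have [] := sigma_bound eps.
  exact: q_osc_measurable.
have jd := weighted_bound_L1 density_bound.
have i0 : \int[mu]_(x in setT) `|density x| = 0.
  apply/eqP; rewrite eq_le; apply/andP; split; last exact: Rintegral_ge0.
  have -> : \int[mu]_(x in setT) `|density x| = \int[mu]_(x in setT) density x.
    apply: ae_eq_Rintegral => //.
    - by apply: (ae_imp density_ge0_ae) => x h _; rewrite ger0_norm.
    - exact: measurable_norm_fun.
  by move: m0; rewrite /m pmulr_lle0 // invr_gt0 mulr_gt0 // exprn_gt0 // pi_gt0.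
have d0 : {ae mu, forall x, density x = 0}.
  have jad := L1_norm_fun (@measurableT _ mR) jd.
  have /ae_eq_integral_abs : (\int[mu]_(x in setT) `|(EFin \o density) x| = 0)%E.
    have := fineK (integrable_fin_num (@measurableT _ mR) jad).
    by rewrite -[fine _]/(\int[mu]_(x in setT) `|density x|) i0 => <-.
  move=> H; have {}H := H (@measurableT _ mR) (measurable_int _ jd).
  by apply: (ae_imp H) => x /(_ I)[].
have q0 : {ae mu, forall x n, qr n x = 0 /\ qi n x = 0}.
  have dn0 : {ae mu, forall x n, dens n x = 0}.
    apply: (ae_imp2 density_ae d0) => x h hd n; apply/eqP; rewrite eq_le dens_ge0 andbT.
    have mono : nondecreasing_seq (fun n => \sum_(0 <= i < n) dens i x).
      by apply: nondecreasing_series => k _ _; exact: dens_ge0.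
    have hc : cvgn (fun n => \sum_(0 <= i < n) dens i x) by apply/cvg_ex; eexists; exact: h.
    have := nondecreasing_cvgn_le mono hc n.+1.
    rewrite (cvg_lim (@norm_hausdorff _ _) h) hd big_nat_recr //=; apply: le_trans.
    by rewrite lerDr; apply: sumr_ge0 => i _; exact: dens_ge0.
  apply: (ae_imp2 dn0 qab) => x h1 h2 n; have [-> ->] := h2 n.
  have l0 := lt_le_trans theta_gt0 (lam_ge n).
  have ln0 : lam n != 0 by rewrite -normr_gt0.
  have := h1 n; rewrite /dens => /eqP; rewrite !mulf_eq0 invr_eq0 !expf_eq0 /= (negbTE ln0) orbF.
  by rewrite pnatr_eq0 /= paddr_eq0 ?sqr_ge0 // !expf_eq0 /= => /andP[/eqP -> /eqP ->].
apply: (ae_imp2 d0 q0) => x h1 h2.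
rewrite sigma_eff_series h1 mulr0 q_osc_series.
rewrite (eq_limn (v := fun=> 0)) ?lim_cst // => n.
by rewrite big1 // => i _; have [-> ->] := h2 i; rewrite !mul0r subrr mulr0.
Qed.

End Scale.

Lemma transmission_difference : exists (C e0 : R), 0 < e0 /\ forall eps, 0 < eps ->
  eps < e0 -> forall k, normc
    (transmission (sigma_eff q lambda eps) k - transmission (q_osc q lambda eps) k) <= C * eps.
Proof.
have [a [b [N [M [ca cb NM qab]]]]] := chains.
have [theta t0 [h1 h2 h3]] := gaps.
have [m0|m0] := leP ((\int[mu]_(x in setT) density x) / (4 * pi ^+ 2)) 0; last first.
  exact: (close_pos ca cb NM qab t0 h1 h2 h3 m0).
exists 0, 1; split=> // eps e0 _ k.
rewrite (close_zero ca cb NM qab t0 h1 m0 e0) subrr mul0r.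
by rewrite complex.ComplexField.Normc.normc0.
Qed.

End Data.

End RealLine.

Unset Implicit Arguments.

Theorem corollary4p4 (R : realType) (q : int -> R -> R[i]) (lambda : int -> R)
    (HV : hypotheses_V' q lambda) :
  exists C : R, \forall eps \near 0^'+,
    (ereal_sup (range (fun k : R =>
       (Normc.normc (transmission (sigma_eff q lambda eps) k
                     - transmission (q_osc q lambda eps) k))%:E))
     <= (C * eps)%:E)%E.
Proof.
have [C [e0 [e00 H]]] := transmission_difference HV.
exists C; near=> eps; apply: ge_ereal_sup => _ [k _ <-]; rewrite lee_fin.
apply: H; last by near: eps; exact: nbhs_right_lt.
by near: eps; exact: nbhs_right_gt.
Unshelve. all: by end_near. Qed.
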